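(* Let $(\overline{M}^7,\varphi)$ be a $7$-manifold with a nearly $G_2$ structure $\varphi$, with induced metric $\overline{g}$ and induced cross product $B$. Let $M^6$ be an oriented hypersurface of $\overline{M}$ with induced metric $g$, unit normal vector field $N$ and shape operator $A:TM\to TM$. Let $\xi:TM\to TM$ be the metric compatible almost complex structure $\xi(X)=B(N,X)$. Then $(M,g,\xi)$ is a nearly Kähler structure if and only if $M$ is totally umbilic, i.e. there is a function $\alpha\in C^\infty(M)$ such that $AX=\alpha X$ for all $X\in\Gamma(TM)$.
   Context: A $G_2$ structure on a $7$-manifold $\overline{M}$ is a smooth $3$-form $\varphi$ such that for each $x\in\overline{M}$ there is a linear isomorphism $\rho:T_x\overline{M}\to\mathbb{R}^7$ with $\rho^*\varphi_0=\varphi_x$, where $$\varphi_0=dx^{123}-dx^{167}-dx^{527}-dx^{563}+dx^{415}+dx^{426}+dx^{437},\qquad dx^{ijk}=dx^i\wedge dx^j\wedge dx^k.$$ Such a $\varphi$ determines a unique Riemannian metric $\overline{g}$ and orientation, with volume form $\mathrm{vol}$, by $\overline{g}(u,v)\,\mathrm{vol}=-\tfrac16 (u\lrcorner\varphi)\wedge(v\lrcorner\varphi)\wedge\varphi$. Put $\psi=\star\varphi$, where $\star$ is the Hodge star of $\overline{g}$ and this orientation. The cross product $B$ is the skew-symmetric bilinear map on $T\overline{M}$ defined by $\overline{g}(B(X,Y),Z)=\varphi(X,Y,Z)$. The $G_2$ structure $\varphi$ is a nearly $G_2$ structure if $d\varphi=\tau_0\psi$ for a function $\tau_0$ (constant when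 the manifold is connected) and $d\psi=0$. For an oriented hypersurface $M$ with unit normal $N$ corresponding to the orientation, let $\overline{\nabla}$ and $\nabla$ be the Levi-Civita connections of $\overline{g}$ and $g$. The shape operator is the self-adjoint map $A$ given by $AX=-\overline{\nabla}_XN$. The map $\xi$ satisfies $\xi^2=-\mathrm{Id}$ and $g(\xi X,\xi Y)=g(X,Y)$. An almost Hermitian manifold $(L,g,J)$ is nearly Kähler if $(\nabla_XJ)X=0$ for all vector fields $X$ on $L$, where $\nabla$ is the Levi-Civita connection of $g$. *)

(* Defs.v *)
From mathcomp Require Import all_boot all_order all_algebra all_fingroup.
From mathcomp Require Import all_classical all_reals all_analysis.

Set Implicit Arguments.
Unset Strict Implicit.
Unset Printing Implicit Defensive.

Import Order.TTheory GRing.Theory Num.Theory.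
Import numFieldNormedType.Exports.

Local Open Scope classical_set_scope.
Local Open Scope ring_scope.

(** * Multilinear algebra on a real vector space *)

Section MultilinearAlgebra.
Context {R : realType} {V : lmodType R}.

Definition fcons k (u : V) (v : 'I_k -> V) : 'I_k.+1 -> V :=
  fun i => if unlift ord0 i is Some j then v j else u.

Definition fcat k l (u : 'I_k -> V) (v : 'I_l -> V) : 'I_(k + l) -> V :=
  fun i => match fintype.split i with inl a => u a | inr b => v b end.

Definition alternating_form k (a : ('I_k -> V) -> R) : Prop :=
  (forall v i c x y,
     a (dfwith v i (c *: x + y)) = c * a (dfwith v i x) + a (dfwith v i y)) /\
  (forall v i j, i != j -> v i = v j -> a v = 0).

(* Normalised so that (dx^1 /\ ... /\ dx^k)(v_1, ..., v_k) = det (dx^i (v_j)). *)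
Definition wedge k l (a : ('I_k -> V) -> R) (b : ('I_l -> V) -> R) :
    ('I_(k + l) -> V) -> R :=
  fun v => (k`! * l`!)%:R^-1 *
    \sum_(s : 'S_(k + l)) (-1) ^+ odd_perm s *
      a (fun i => v (s (lshift l i))) * b (fun j => v (s (rshift k j))).

Definition contraction k (u : V) (a : ('I_k.+1 -> V) -> R) : ('I_k -> V) -> R :=
  fun v => a (fcons u v).

Definition inner_product (g : V -> V -> R) : Prop :=
  [/\ forall c u v w, g (c *: u + v) w = c * g u w + g v w,
      forall u v, g u v = g v u
    & forall u, u != 0 -> 0 < g u u].

Definition orthonormal n (g : V -> V -> R) (e : 'I_n -> V) : Prop :=
  forall i j, g (e i) (e j) = (i == j)%:R.

End MultilinearAlgebra.

(** * Inner products in the standard basis of R^n *)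

Section Coordinates.
Context {R : realType} {n : nat}.
Local Notation V := 'rV[R]_n.

Definition stdb (i : 'I_n) : V := delta_mx ord0 i.

Definition gram (g : V -> V -> R) : 'M[R]_n :=
  \matrix_(i, j) g (stdb i) (stdb j).

(* The vector w with g w v = a v, for a linear a. *)
Definition sharp (g : V -> V -> R) (a : V -> R) : V :=
  (\row_i a (stdb i)) *m invmx (gram g).

(* (star a)_{j...} = 1/k! g^{s_1 t_1} ... g^{s_k t_k} a_{s...} vol_{t... j...},
   characterised by b /\ star a = <b, a> vol for all k-forms b. *)
Definition hodge_star k l (g : V -> V -> R) (vol : ('I_(k + l) -> V) -> R)
    (a : ('I_k -> V) -> R) : ('I_l -> V) -> R :=
  fun v => k`!%:R^-1 *
    \sum_(s : {ffun 'I_k -> 'I_n}) \sum_(t : {ffun 'I_k -> 'I_n})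
      (\prod_(i < k) invmx (gram g) (s i) (t i)) *
      a (fun i => stdb (s i)) * vol (fcat (fun i => stdb (t i)) v).

End Coordinates.

Section ModelForm.
Context {R : realType}.

(* Coordinates of R^7 are numbered from 1 to 7. *)
Definition dx (i : nat) : ('I_1 -> 'rV[R]_7) -> R :=
  fun v => v ord0 ord0 (inord i.-1).

Definition dx3 (i j k : nat) : ('I_3 -> 'rV[R]_7) -> R :=
  wedge (wedge (dx i) (dx j)) (dx k).

Definition phi0 : ('I_3 -> 'rV[R]_7) -> R :=
  fun v => dx3 1 2 3 v - dx3 1 6 7 v - dx3 5 2 7 v - dx3 5 6 3 v
           + dx3 4 1 5 v + dx3 4 2 6 v + dx3 4 3 7 v.

End ModelForm.

(** * Smooth manifolds *)

(* On an open set U this is C^oo: all iterated directional derivatives exist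
   and are differentiable. *)
Definition smooth_on {R : realType} {V W : normedModType R} (U : set V)
    (f : V -> W) : Prop :=
  forall (s : seq V) (x : V), U x ->
    differentiable (foldr (fun v (h : V -> W) => 'D_v h) f s) x.

(* cparam is the inverse of ccoord; its values off the image of the chart are
   irrelevant. *)
Record chart (R : realType) (n : nat) (T : topologicalType) := Chart {
  cdom : set T;
  ccoord : T -> 'rV[R]_n;
  cparam : 'rV[R]_n -> T;
  cdom_open : open cdom;
  cimg_open : open (ccoord @` cdom);
  ccoordK : forall p, cdom p -> cparam (ccoord p) = p;
  ccoord_continuous : forall p, cdom p -> {for p, continuous ccoord};
  cparam_continuous : forall p, cdom p -> {for ccoord p, continuous cparam}
}.

Record manifold (R : realType) (n : nat) := Manifold {
  mcarrier :> topologicalType;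
  atlas : set (chart R n mcarrier);
  manifold_hausdorff : hausdorff_space mcarrier;
  manifold_second_countable : @second_countable mcarrier;
  atlas_cover : forall p : mcarrier, exists c, atlas c /\ cdom c p;
  atlas_compatible : forall c c', atlas c -> atlas c' ->
    smooth_on (ccoord c @` (cdom c `&` cdom c')) (ccoord c' \o cparam c)
}.

Section Manifolds.
Context {R : realType}.

Definition chart_at n (M : manifold R n) (p : M) : chart R n M :=
  projT1 (cid (atlas_cover p)).

Definition coord_at n (M : manifold R n) (p : M) : 'rV[R]_n :=
  ccoord (chart_at p) p.

Definition overlap m n (M : manifold R m) (M' : manifold R n) (F : M -> M')
    (c : chart R m M) (c' : chart R n M') : set 'rV[R]_m :=
  ccoord c @` (cdom c `&` F @^-1` cdom c').

Definition smooth_map m n (M : manifold R m) (M' : manifold R n) (F : M -> M') :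
    Prop :=
  continuous F /\
  forall c c', atlas c -> atlas c' ->
    smooth_on (overlap F c c') (ccoord c' \o F \o cparam c).

Definition smooth_fun n (M : manifold R n) (f : M -> R) : Prop :=
  forall c, atlas c -> smooth_on (ccoord c @` cdom c) (f \o cparam c).

(* T_p M is R^n, by means of the chart chart_at p. The components in any other
   chart c around p are obtained with to_chart c, whose inverse is of_chart. *)
Definition tangent n (M : manifold R n) (p : M) := 'rV[R]_n.

Definition to_chart n (M : manifold R n) (c : chart R n M) (p : M)
    (v : tangent p) : 'rV[R]_n :=
  'd (ccoord c \o cparam (chart_at p)) (coord_at p) v.

Definition of_chart n (M : manifold R n) (c : chart R n M) (p : M)
    (w : 'rV[R]_n) : tangent p :=
  'd (ccoord (chart_at p) \o cparam c) (ccoord c p) w.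

Definition tangent_map m n (M : manifold R m) (M' : manifold R n) (F : M -> M')
    (p : M) (v : tangent p) : tangent (F p) :=
  'd (ccoord (chart_at (F p)) \o F \o cparam (chart_at p)) (coord_at p) v.

(* Vector fields along F, i.e. sections of F^* TM'. *)
Definition field_along m n (M : manifold R m) (M' : manifold R n) (F : M -> M') :=
  forall p : M, tangent (F p).

Definition field_in_charts m n (M : manifold R m) (M' : manifold R n)
    (F : M -> M') (Y : field_along F) (c : chart R m M) (c' : chart R n M') :
    'rV[R]_m -> 'rV[R]_n :=
  fun x => to_chart c' (Y (cparam c x)).

Definition smooth_along m n (M : manifold R m) (M' : manifold R n) (F : M -> M')
    (Y : field_along F) : Prop :=
  forall c c', atlas c -> atlas c' ->
    smooth_on (overlap F c c') (field_in_charts Y c c').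

Definition vector_field n (M : manifold R n) := field_along (@idfun M).

Definition smooth_vector_field n (M : manifold R n) (X : vector_field M) : Prop :=
  smooth_along X.

Definition endo_field n (M : manifold R n) := forall p : M, tangent p -> tangent p.

Definition smooth_endo_field n (M : manifold R n) (J : endo_field M) : Prop :=
  (forall (p : M) (a : R) (u v : tangent p),
     J p (a *: u + v) = a *: J p u + J p v) /\
  (forall c (w : 'rV[R]_n), atlas c ->
     smooth_on (ccoord c @` cdom c)
       (fun x => to_chart c (J (cparam c x) (of_chart c (cparam c x) w)))).

(** ** Differential forms *)

Definition form_field n (M : manifold R n) (k : nat) :=
  forall p : M, ('I_k -> tangent p) -> R.

Definition form_in_chart n (M : manifold R n) k (w : form_field M k)
    (c : chart R n M) (v : 'I_k -> 'rV[R]_n) : 'rV[R]_n -> R :=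
  fun x => w (cparam c x) (fun i => of_chart c (cparam c x) (v i)).

Definition smooth_form n (M : manifold R n) k (w : form_field M k) : Prop :=
  (forall p : M, alternating_form (w p)) /\
  (forall c v, atlas c -> smooth_on (ccoord c @` cdom c) (form_in_chart w c v)).

(* (dw)(v_0, ..., v_k) = sum_i (-1)^i v_i (w (v_0, ..., ^v_i, ..., v_k)) in the
   chart chart_at p, the v_i being extended with constant components; the value
   does not depend on the chart. *)
Definition ext_deriv n (M : manifold R n) k (w : form_field M k) :
    form_field M k.+1 :=
  fun p v => \sum_(i < k.+1) (-1) ^+ i *
    'D_(v i) (form_in_chart w (chart_at p) (fun j => v (lift i j))) (coord_at p).

(** ** Riemannian metrics and the Levi-Civita connection *)

Definition metric_field n (M : manifold R n) :=
  forall p : M, tangent p -> tangent p -> R.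

Definition metric_in_chart n (M : manifold R n) (g : metric_field M)
    (c : chart R n M) (u v : 'rV[R]_n) : 'rV[R]_n -> R :=
  fun x => g (cparam c x) (of_chart c (cparam c x) u) (of_chart c (cparam c x) v).

Definition riemannian_metric n (M : manifold R n) (g : metric_field M) : Prop :=
  (forall p : M, inner_product (g p)) /\
  (forall c u v, atlas c ->
     smooth_on (ccoord c @` cdom c) (metric_in_chart g c u v)).

(* The volume form of g for one of the orientations of M. *)
Definition volume_form n (M : manifold R n) (g : metric_field M)
    (vol : form_field M n) : Prop :=
  smooth_form vol /\
  (forall (p : M) (e : 'I_n -> tangent p), orthonormal (g p) e -> `|vol p e| = 1).

(* u^i v^j Gamma^k_ij for the Christoffel symbols of g in the chart chart_at p:
   g (Gamma (u, v), w) = 1/2 (u (g (v, w)) + v (g (u, w)) - w (g (u, v))). *)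
Definition christoffel n (M : manifold R n) (g : metric_field M) (p : M)
    (u v : tangent p) : tangent p :=
  let G := metric_in_chart g (chart_at p) in
  sharp (g p) (fun w => 2^-1 *
    ('D_u (G v w) (coord_at p) + 'D_v (G u w) (coord_at p)
     - 'D_w (G u v) (coord_at p))).

(* The covariant derivative at p, in the direction u, of a vector field Y along
   F : M -> M' for the Levi-Civita connection of a metric g' on M'. *)
Definition cov_deriv_along m n (M : manifold R m) (M' : manifold R n)
    (g' : metric_field M') (F : M -> M') (Y : field_along F) (p : M)
    (u : tangent p) : tangent (F p) :=
  'D_u (field_in_charts Y (chart_at p) (chart_at (F p))) (coord_at p)
  + christoffel g' (tangent_map F u) (Y p).

Definition levi_civita n (M : manifold R n) (g : metric_field M)
    (X Y : vector_field M) : vector_field M :=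
  fun p => cov_deriv_along g Y (p := p) (X p).

(** ** Nearly Kaehler structures *)

Definition almost_hermitian n (M : manifold R n) (g : metric_field M)
    (J : endo_field M) : Prop :=
  [/\ riemannian_metric g,
      smooth_endo_field J,
      forall (p : M) (u : tangent p), J p (J p u) = - u
    & forall (p : M) (u v : tangent p), g p (J p u) (J p v) = g p u v].

Definition apply_endo n (M : manifold R n) (J : endo_field M)
    (X : vector_field M) : vector_field M := fun p => J p (X p).

(* ((nabla_X J) Y)_p *)
Definition cov_deriv_endo n (M : manifold R n) (g : metric_field M)
    (J : endo_field M) (X Y : vector_field M) (p : M) : tangent p :=
  levi_civita g X (apply_endo J Y) p - J p (levi_civita g X Y p).

Definition nearly_kahler n (M : manifold R n) (g : metric_field M)
    (J : endo_field M) : Prop :=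
  almost_hermitian g J /\
  (forall X : vector_field M, smooth_vector_field X ->
     forall p : M, cov_deriv_endo g J X X p = 0).

(** ** G2 structures *)

Definition G2_structure (M : manifold R 7) (phi : form_field M 3) : Prop :=
  smooth_form phi /\
  (forall x : M, exists rho : {linear 'rV[R]_7 -> 'rV[R]_7}, bijective rho /\
     forall v : 'I_3 -> tangent x, phi x v = phi0 (fun i => rho (v i))).

(* g and vol are the metric and the volume form determined by phi. *)
Definition G2_metric (M : manifold R 7) (phi : form_field M 3)
    (g : metric_field M) (vol : form_field M 7) : Prop :=
  [/\ riemannian_metric g,
      volume_form g vol
    & forall (x : M) (u v : tangent x) (w : 'I_7 -> tangent x),
        g x u v * vol x w =
        - 6^-1 * wedge (wedge (contraction u (phi x)) (contraction v (phi x)))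
                       (phi x) w].

Definition G2_psi (M : manifold R 7) (phi : form_field M 3)
    (g : metric_field M) (vol : form_field M 7) : form_field M 4 :=
  fun x => @hodge_star R 7 3 4 (g x) (vol x) (phi x).

Definition nearly_G2 (M : manifold R 7) (phi : form_field M 3)
    (g : metric_field M) (vol : form_field M 7) : Prop :=
  exists tau0 : M -> R,
    (forall (x : M) (v : 'I_4 -> tangent x),
       ext_deriv phi v = tau0 x * G2_psi phi g vol v) /\
    (forall (x : M) (v : 'I_5 -> tangent x), ext_deriv (G2_psi phi g vol) v = 0).

Definition cross_product (M : manifold R 7) (phi : form_field M 3)
    (g : metric_field M) (B : forall x : M, tangent x -> tangent x -> tangent x) :
    Prop :=
  forall (x : M) (X Y Z : tangent x),
    g x (B x X Y) Z = phi x (fcons X (fcons Y (fun _ : 'I_1 => Z))).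

(** ** Oriented hypersurfaces *)

Definition immersion m n (M : manifold R m) (M' : manifold R n) (F : M -> M') :
    Prop :=
  smooth_map F /\ (forall p : M, injective (@tangent_map m n M M' F p)).

Definition induced_metric m n (M : manifold R m) (M' : manifold R n) (F : M -> M')
    (g' : metric_field M') : metric_field M :=
  fun p u v => g' (F p) (tangent_map F u) (tangent_map F v).

(* An orientation is given by a nowhere vanishing top degree form. *)
Definition orientation_form n (M : manifold R n) (o : form_field M n) : Prop :=
  smooth_form o /\ (forall p : M, exists v, o p v != 0).

Definition unit_normal n (M : manifold R n) (M' : manifold R n.+1) (F : M -> M')
    (g' : metric_field M') (N : field_along F) : Prop :=
  [/\ smooth_along N,
      forall p : M, g' (F p) (N p) (N p) = 1
    & forall (p : M) (u : tangent p), g' (F p) (N p) (tangent_map F u) = 0].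

(* A basis (v_1, ..., v_n) of T_p M is positive iff (N, v_1, ..., v_n) is. *)
Definition normal_oriented n (M : manifold R n) (M' : manifold R n.+1)
    (F : M -> M') (o : form_field M n) (vol' : form_field M' n.+1)
    (N : field_along F) : Prop :=
  forall (p : M) (v : 'I_n -> tangent p), 0 < o p v ->
    0 < vol' (F p) (fcons (N p) (fun i => tangent_map F (v i))).

(* dF (A u) = - nabla'_u N *)
Definition shape_operator n (M : manifold R n) (M' : manifold R n.+1)
    (F : M -> M') (g' : metric_field M') (N : field_along F) (A : endo_field M) :
    Prop :=
  forall (p : M) (u : tangent p),
    tangent_map F (A p u) = - cov_deriv_along g' N u.

Definition totally_umbilic n (M : manifold R n) (A : endo_field M) : Prop :=
  exists alpha : M -> R, smooth_fun alpha /\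
    forall X : vector_field M, smooth_vector_field X ->
      forall p : M, A p (X p) = alpha p *: (X p : tangent p).

End Manifolds.

(* Main.v *)
From HB Require Import structures.
Require Import Defs.
From mathcomp Require Import all_boot all_order all_algebra all_fingroup.
From mathcomp Require Import all_classical all_reals all_analysis.
From mathcomp Require Import ring lra.

Set Implicit Arguments.
Unset Strict Implicit.
Unset Printing Implicit Defensive.

Import Order.TTheory GRing.Theory Num.Theory.
Import numFieldNormedType.Exports.

Local Open Scope classical_set_scope.
Local Open Scope ring_scope.

(** Write D for the ambient Levi-Civita connection, dF for the differential of
    the immersion and x for the cross product.  The tensor [xi] is defined by
    g (dF (xi X), b) = phi (N, dF X, b).  Differentiating this identity along M
    ([nabla_cross]), with D_u N = - dF (A u) and with the Gauss formula (the
    tangential part of D_u (dF Y) is dF (nabla_u Y)), gives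
      g ((nabla_X xi) X, w) = (D_X phi) (N, X, w) - phi (dF (A X), dF X, dF w).
    The first term vanishes, because D phi is totally skew on a nearly G2
    manifold ([torsion_skew]), so that [nabla_xi] has the second term only.

    Hence a totally umbilic hypersurface is nearly Kaehler.  Conversely, in the
    nearly Kaehler case phi (A u, u, w) = 0 for all tangent u and w, since every
    tangent vector extends to a vector field ([extend_tangent_vector]).  Then
    u x A u is normal, and taking the cross product with u once more shows that
    A u is a combination of u and xi u.  A self-adjoint operator with this
    property is a multiple of the identity ([scalar_operator]).  The factor is
    smooth, being - g (D_u N, dF u) / g (dF u, dF u) for a coordinate field u
    ([umbilic_factor_smooth]).

    For the skewness of D phi one works at a point, in a frame where phi has the
    standard components.  The formula for the metric shows that this frame is
    orthonormal ([G2_metric_pointwise]), and psi turns out to be the opposite of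
    [psi4] (a, b, c, d) =
      phi (a, b, c x d) - g (a, c) g (b, d) + g (a, d) g (b, c)
    ([hodge_star_on_frame]).  As [psi4] is skew, its derivative is skew too; this
    makes D_u phi tangent to the SO(7)-orbit of phi, that is, D_u phi is the
    contraction of [psi4] with a vector T u ([so7E]).  The 49 entries of T
    satisfy the linear equations expressed by d phi = tau psi and d psi = 0,
    whose only solution is a multiple of the identity ([torsion_scalar]).

    Covariant derivatives are defined in one chart around each point.  That they
    do not depend on it, and the Gauss formula as well, both come from
    [nabla_isometry]: a map T with g = T^* G carries the covariant derivative of g
    to the tangential part of that of G.  It is applied to changes of charts and
    to the immersion. *)

(** * Germs of smooth functions *)

Section LocalCongruence.
Context {R : realType} {V W : normedModType R}.
Implicit Types (f g : V -> W) (x : V).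

Lemma near_near (P : set V) x :
  (\forall y \near x, P y) -> \forall y \near x, \forall z \near y, P z.
Proof. by move=> /nbhs_interior. Qed.

Lemma differentiable_near0 f x : (\forall y \near x, f y = 0) ->
  differentiable f x.
Proof.
move=> f0; have fx0 : f x = 0 by exact: nbhs_singleton f0.
have E : f \o shift x = cst (f x) + (\0 : {linear V -> W}) +o_ 0 id.
  apply/eqaddoE/eqaddoP => _/posnumP[e].
  have f0' : \forall h \near 0, f (h + x) = 0.
    by move: f0; rewrite (near_shift 0 x) /= subr0.
  near=> h; rewrite /= !fctE /= fx0 addr0 subr0.
  have -> : f (h + x) = 0 by near: h.
  by rewrite normr0 mulr_ge0.
apply/diff_locallyP; rewrite (diff_unique _ E); last exact: cst_continuous.
by split => //; exact: cst_continuous.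
Unshelve. all: by end_near. Qed.

Lemma near_eq_differentiable f g x : (\forall y \near x, f y = g y) ->
  differentiable f x -> differentiable g x.
Proof.
move=> fg df; have -> : g = f + (g - f) by rewrite addrC subrK.
apply: differentiableD => //; apply: differentiable_near0.
by near=> y; rewrite !fctE (near fg y) ?subrr.
Unshelve. all: by end_near. Qed.

Lemma near_eq_diff f g x v : (\forall y \near x, f y = g y) ->
  differentiable f x -> 'd f x v = 'd g x v.
Proof.
move=> fg df; rewrite -!deriveE //; last exact: near_eq_differentiable df.
exact: near_eq_derive.
Qed.

Lemma deriveDr f x u v : differentiable f x ->
  'D_(u + v) f x = 'D_u f x + 'D_v f x.
Proof. by move=> df; rewrite !deriveE // linearD. Qed.

Lemma deriveZr f x c v : differentiable f x ->
  'D_(c *: v) f x = c *: 'D_v f x.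
Proof. by move=> df; rewrite !deriveE // linearZ. Qed.

End LocalCongruence.

Section SmoothAt.
Context {R : realType} {V W : normedModType R}.
Implicit Types (f g : V -> W) (x : V).

(** [smooth_on] for germs.  Derivatives are required near x and not only at x, so
    that the notion is stable under ['D_v]; bounding their order by k makes
    inductions possible. *)
Definition smooth_at_order k f x := forall s : seq V, (size s <= k)%N ->
  \forall y \near x, differentiable (foldr (fun v (h : V -> W) => 'D_v h) f s) y.

Definition smooth_at f x := forall k, smooth_at_order k f x.

Lemma smooth_at_orderS k f x : smooth_at_order k.+1 f x <->
  (\forall y \near x, differentiable f y) /\
  forall v, smooth_at_order k ('D_v f) x.
Proof.
split=> [H|[H0 H1] s].
  split; first exact: (H [::]).
  by move=> v s sk; have := H (rcons s v); rewrite size_rcons foldr_rcons; apply.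
elim/last_ind: s => [//|s v _]; rewrite size_rcons foldr_rcons; exact: H1.
Qed.

Lemma smooth_at_order0 f x : smooth_at_order 0 f x <->
  (\forall y \near x, differentiable f y).
Proof. by split=> [H|H [|//]] //; exact: (H [::]). Qed.

Lemma smooth_atP f x : smooth_at f x <->
  (\forall y \near x, differentiable f y) /\ forall v, smooth_at ('D_v f) x.
Proof.
split=> [H|[H0 H1] [|k]].
- by split=> [|v k]; [exact: (H 0%N [::])|have /smooth_at_orderS[_] := H k.+1].
- exact/smooth_at_order0.
- by apply/smooth_at_orderS; split => // v; exact: H1.
Qed.

Lemma smooth_at_derive f x v : smooth_at f x -> smooth_at ('D_v f) x.
Proof. by move=> /smooth_atP[]. Qed.

Lemma smooth_at_near_differentiable f x : smooth_at f x ->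
  \forall y \near x, differentiable f y.
Proof. by move=> /smooth_atP[]. Qed.

Lemma smooth_at_differentiable f x : smooth_at f x -> differentiable f x.
Proof. by move=> /smooth_at_near_differentiable /nbhs_singleton. Qed.

Lemma smooth_at_order_near k f g x : (\forall y \near x, f y = g y) ->
  smooth_at_order k f x -> smooth_at_order k g x.
Proof.
have dE f' g' : (\forall y \near x, f' y = g' y) ->
    (\forall y \near x, differentiable f' y) ->
    \forall y \near x, differentiable g' y.
  move=> /near_near fg df; near=> y.
  by apply: (@near_eq_differentiable _ _ _ f'); near: y.
elim: k f g => [|k IH] f g fg.
  by move=> /smooth_at_order0 H; apply/smooth_at_order0; exact: dE H.
move=> /smooth_at_orderS[H0 H1]; apply/smooth_at_orderS; split.
  exact: dE H0.
move=> v; apply: IH (H1 v); near=> y; apply: near_eq_derive.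
by near: y; exact: near_near.
Unshelve. all: by end_near. Qed.

Lemma smooth_at_near f g x : (\forall y \near x, f y = g y) ->
  smooth_at f x -> smooth_at g x.
Proof. by move=> fg H k; exact: smooth_at_order_near (H k). Qed.

Lemma smooth_at_order_ext k f g x : f =1 g ->
  smooth_at_order k f x -> smooth_at_order k g x.
Proof. by move=> /funext ->. Qed.

Lemma smooth_at_ext f g x : f =1 g -> smooth_at f x -> smooth_at g x.
Proof. by move=> /funext ->. Qed.

Lemma smooth_at_cst (a : W) x : smooth_at (fun=> a) x.
Proof.
move=> k; elim: k a => [|k IH] a; last (apply/smooth_at_orderS; split).
- by apply/smooth_at_order0; near=> y; exact: differentiable_cst.
- by near=> y; exact: differentiable_cst.
- move=> v; have -> : 'D_v (fun=> a : W) = (fun=> 0); last exact: IH.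
  by apply/funext => y; exact: derive_cst.
Unshelve. all: by end_near. Qed.

Lemma smooth_at_orderD k f g x : smooth_at_order k f x ->
  smooth_at_order k g x -> smooth_at_order k (fun y => f y + g y) x.
Proof.
elim: k f g => [|k IH] f g.
  move=> /smooth_at_order0 Hf /smooth_at_order0 Hg; apply/smooth_at_order0.
  by apply: filterS2 Hf Hg => y; exact: differentiableD.
move=> /smooth_at_orderS[Hf0 Hf1] /smooth_at_orderS[Hg0 Hg1].
apply/smooth_at_orderS; split.
  by apply: filterS2 Hf0 Hg0 => y; exact: differentiableD.
move=> v; apply: smooth_at_order_near (IH _ _ (Hf1 v) (Hg1 v)).
apply: filterS2 Hf0 Hg0 => y df dg.
by rewrite (deriveD (f := f) (g := g)) //; exact: diff_derivable.
Qed.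

Lemma smooth_atD f g x : smooth_at f x -> smooth_at g x ->
  smooth_at (fun y => f y + g y) x.
Proof. by move=> Hf Hg k; exact: smooth_at_orderD. Qed.

Lemma smooth_at_sum (I : Type) (r : seq I) (P : pred I) (F : I -> V -> W) x :
  (forall i, P i -> smooth_at (F i) x) ->
  smooth_at (fun y => \sum_(i <- r | P i) F i y) x.
Proof.
move=> H; elim: r => [|i r IH].
  by apply: smooth_at_ext (smooth_at_cst 0 x) => y; rewrite big_nil.
case Pi: (P i); last by apply: smooth_at_ext IH => y; rewrite big_cons Pi.
by apply: smooth_at_ext (smooth_atD (H _ Pi) IH) => y; rewrite big_cons Pi.
Qed.

End SmoothAt.


Section ScalarSmooth.
Context {R : realType} {V : normedModType R}.
Implicit Types (f g : V -> R) (x : V).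

Lemma smooth_at_order_le {W : normedModType R} j k (f : V -> W) x : (j <= k)%N ->
  smooth_at_order k f x -> smooth_at_order j f x.
Proof. by move=> jk H s sj; apply: H; exact: leq_trans jk. Qed.

Lemma smooth_at_orderM k f g x : smooth_at_order k f x ->
  smooth_at_order k g x -> smooth_at_order k (fun y => f y * g y) x.
Proof.
elim: k f g => [|k IH] f g.
  move=> /smooth_at_order0 Hf /smooth_at_order0 Hg; apply/smooth_at_order0.
  by apply: filterS2 Hf Hg => y; exact: differentiableM.
move=> Hf Hg; have [Hf0 Hf1] := (smooth_at_orderS _ _ _).1 Hf.
have [Hg0 Hg1] := (smooth_at_orderS _ _ _).1 Hg.
apply/smooth_at_orderS; split.
  by apply: filterS2 Hf0 Hg0 => y; exact: differentiableM.
move=> v; have {}Hf := smooth_at_order_le (leqnSn k) Hf.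
have {}Hg := smooth_at_order_le (leqnSn k) Hg.
apply: smooth_at_order_near (smooth_at_orderD (IH _ _ Hf (Hg1 v)) (IH _ _ Hg (Hf1 v))).
apply: filterS2 Hf0 Hg0 => y df dg.
by rewrite (deriveM (f := f) (g := g)) //; exact: diff_derivable.
Qed.

Lemma smooth_atM f g x : smooth_at f x -> smooth_at g x ->
  smooth_at (fun y => f y * g y) x.
Proof. by move=> Hf Hg k; exact: smooth_at_orderM. Qed.

Lemma smooth_atN f x : smooth_at f x -> smooth_at (fun y => - f y) x.
Proof.
move=> Hf; apply: smooth_at_ext (smooth_atM (@smooth_at_cst R V R (-1) x) Hf) => y.
by rewrite mulN1r.
Qed.

Lemma smooth_atB f g x : smooth_at f x -> smooth_at g x ->
  smooth_at (fun y => f y - g y) x.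
Proof. by move=> Hf Hg; apply: smooth_atD => //; exact: smooth_atN. Qed.

Lemma smooth_at_prod (I : Type) (r : seq I) (F : I -> V -> R) x :
  (forall i, smooth_at (F i) x) ->
  smooth_at (fun y => \prod_(i <- r) F i y) x.
Proof.
move=> H; elim: r => [|i r IH].
  by apply: smooth_at_ext (@smooth_at_cst R V R 1 x) => y; rewrite big_nil.
by apply: smooth_at_ext (smooth_atM (H i) IH) => y; rewrite big_cons.
Qed.

Lemma near_neq0 f x : {for x, continuous f} -> f x != 0 ->
  \forall y \near x, f y != 0.
Proof.
move=> cf fx0; apply: (cf [set r | r != 0]); apply: open_nbhs_nbhs.
by split => //; exact: open_neq.
Qed.

(** The derivative - (1 / f)^2 D f of 1 / f involves 1 / f itself, to a lower
    order. *)
Lemma smooth_atV f x : f x != 0 -> smooth_at f x ->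
  smooth_at (fun y => (f y)^-1) x.
Proof.
move=> fx0 Hf.
have f0 := near_neq0 (differentiable_continuous (smooth_at_differentiable Hf)) fx0.
have d0 := smooth_at_near_differentiable Hf.
have dV : \near x, differentiable (fun y => (f y)^-1) x.
  by apply: filterS2 f0 d0 => y fy0 dy; exact: differentiableV.
elim=> [|k IH]; first exact/smooth_at_order0.
apply/smooth_at_orderS; split=> // v.
have H1 := smooth_at_orderM (smooth_at_orderM IH IH)
  (smooth_atN (smooth_at_derive v Hf) (k := k)).
apply: smooth_at_order_near H1.
apply: filterS2 f0 d0 => y fy0 dy.
rewrite (deriveV fy0); last exact: diff_derivable.
by rewrite /GRing.scale /= expr2 invfM mulrN mulNr.
Qed.

End ScalarSmooth.

Section Coordinatewise.
Context {R : realType} {V : normedModType R} {n : nat}.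
Implicit Types (Y : V -> 'rV[R]_n) (x v : V).

Lemma rV_sum (w : 'rV[R]_n) : w = \sum_j w ord0 j *: stdb j.
Proof. exact: row_sum_delta. Qed.

Lemma differentiable_coordP Y x :
  differentiable Y x <-> forall j, differentiable (fun y => Y y ord0 j) x.
Proof.
split=> [dY j|H].
  by have := differentiable_comp dY (differentiable_coord (Y x) ord0 j).
have -> : Y = \sum_(j < n) (fun y => Y y ord0 j *: stdb j).
  by apply/funext => y; rewrite fct_sumE [LHS]rV_sum.
by apply: differentiable_sum => j; exact: differentiableZl.
Qed.

Lemma derive_coord Y x v j : differentiable Y x ->
  ('D_v Y x) ord0 j = 'D_v (fun y => Y y ord0 j) x.
Proof. by move=> dY; rewrite derive_mx ?mxE //; exact: diff_derivable. Qed.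

Lemma smooth_at_order_coordP k Y x :
  smooth_at_order k Y x <-> forall j, smooth_at_order k (fun y => Y y ord0 j) x.
Proof.
elim: k Y => [|k IH] Y.
  rewrite smooth_at_order0; split=> [H j|H].
    apply/smooth_at_order0; apply: filterS H => y /differentiable_coordP; exact.
  have /filter_forall : forall j, \near x, differentiable (fun y => Y y ord0 j) x.
    by move=> j; apply/smooth_at_order0.
  by apply: filterS => y /differentiable_coordP.
rewrite smooth_at_orderS; split=> [[H0 H1] j|H].
  apply/smooth_at_orderS; split.
    by apply: filterS H0 => y /differentiable_coordP; exact.
  move=> v; have /IH/(_ j) := H1 v; apply: smooth_at_order_near.
  by apply: filterS H0 => y dY; rewrite derive_coord.
have H0 : \near x, differentiable Y x.
  have /filter_forall : forall j, \near x, differentiable (fun y => Y y ord0 j) x.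
    by move=> j; have /smooth_at_orderS[] := H j.
  by apply: filterS => y /differentiable_coordP.
split=> // v; apply/IH => j; have /smooth_at_orderS[_ /(_ v)] := H j.
apply: smooth_at_order_near.
by apply: filterS H0 => y dY; rewrite derive_coord.
Qed.

Lemma smooth_at_coordP Y x :
  smooth_at Y x <-> forall j, smooth_at (fun y => Y y ord0 j) x.
Proof.
split=> [H j k|H k]; first exact: ((smooth_at_order_coordP _ _ _).1 (H k)).
by apply/smooth_at_order_coordP => j; exact: H.
Qed.

End Coordinatewise.

Section Composition.
Context {R : realType} {V : normedModType R} {n : nat}.
Implicit Types (h : V -> 'rV[R]_n) (f : 'rV[R]_n -> R) (x v : V).

Lemma derive_comp (W : normedModType R) (f : 'rV[R]_n -> W) h x v :
  differentiable h x -> differentiable f (h x) ->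
  'D_v (fun y => f (h y)) x = 'D_('D_v h x) f (h x).
Proof.
move=> dh df; rewrite !deriveE //; last exact: differentiable_comp.
by rewrite (diff_comp dh df).
Qed.

Lemma derive_sum_stdb (W : normedModType R) (f : 'rV[R]_n -> W) y w : differentiable f y ->
  'D_w f y = \sum_j w ord0 j *: 'D_(stdb j) f y.
Proof.
move=> df; rewrite deriveE // {1}(rV_sum w) linear_sum /=.
by apply: eq_bigr => j _; rewrite linearZ /= deriveE.
Qed.

Lemma near_continuous (T : topologicalType) (h : V -> T) x (P : set T) :
  {for x, continuous h} -> (\forall y \near h x, P y) -> \forall y \near x, P (h y).
Proof. by move=> ch; exact: ch. Qed.

(** By the chain rule the derivative of f o h is a combination of compositions of
    the partial derivatives of f with h, to a lower order. *)
Lemma smooth_at_scalar_comp f h x : smooth_at h x -> smooth_at f (h x) ->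
  smooth_at (fun y => f (h y)) x.
Proof.
move=> Hh Hf k; move: f Hf.
have dh := smooth_at_near_differentiable Hh.
have ch := differentiable_continuous (nbhs_singleton dh).
elim: k => [|k IH] f Hf.
  have df := near_continuous ch (smooth_at_near_differentiable Hf).
  apply/smooth_at_order0; apply: filterS2 dh df => y.
  exact: (differentiable_comp (f := h) (g := f)).
have df := near_continuous ch (smooth_at_near_differentiable Hf).
apply/smooth_at_orderS; split.
  apply: filterS2 dh df => y; exact: (differentiable_comp (f := h) (g := f)).
move=> v.
have H (j : 'I_n) : smooth_at_order k
    (fun y => ('D_v h y) ord0 j * 'D_(stdb j) f (h y)) x.
  apply: smooth_at_orderM; last exact: (IH _ (smooth_at_derive (stdb j) Hf)).
  exact: ((smooth_at_coordP _ _).1 (smooth_at_derive v Hh) j k).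
have {}H : smooth_at_order k
    (fun y => \sum_j ('D_v h y) ord0 j * 'D_(stdb j) f (h y)) x.
  elim: (index_enum _) => [|j r IHr].
    by apply: smooth_at_order_ext (@smooth_at_cst R V R 0 x k) => y; rewrite big_nil.
  by apply: smooth_at_order_ext (smooth_at_orderD (H j) IHr) => y; rewrite big_cons.
apply: smooth_at_order_near H; apply: filterS2 dh df => y dhy dfy.
by rewrite (derive_comp v dhy dfy) derive_sum_stdb.
Qed.

Lemma smooth_at_comp m (f : 'rV[R]_n -> 'rV[R]_m) h x :
  smooth_at h x -> smooth_at f (h x) -> smooth_at (fun y => f (h y)) x.
Proof.
move=> Hh /smooth_at_coordP Hf; apply/smooth_at_coordP => j.
exact: (smooth_at_scalar_comp (f := fun z => f z ord0 j)).
Qed.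

Lemma smooth_at_id m (x : 'rV[R]_m) : smooth_at (fun y => y) x.
Proof.
apply/smooth_atP; split.
  by near=> y; apply/differentiable_coordP => j; exact: differentiable_coord.
move=> v; apply: smooth_at_ext (smooth_at_cst v x) => y.
by rewrite (derive_id y v).
Unshelve. all: by end_near. Qed.

End Composition.

Section MovingArgument.
Context {R : realType} {V : normedModType R} {n : nat}.
Variables (L : V -> 'rV[R]_n -> R) (Y : V -> 'rV[R]_n) (x : V).
Hypothesis Llin : \forall y \near x, forall c a b,
  L y (c *: a + b) = c * L y a + L y b.

Lemma linear_sum_coord (l : 'rV[R]_n -> R) : (forall c a b, l (c *: a + b) = c * l a + l b) ->
  forall w, l w = \sum_j w ord0 j * l (stdb j).
Proof.
move=> ll w; pose lM := GRing.isLinear.Build _ _ _ _ l ll.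
pose l' : {linear _ -> _} := HB.pack l lM.
rewrite {1}(rV_sum w) -[LHS]/(l' _) linear_sum /=; apply: eq_bigr => j _.
by rewrite -[LHS]/(l' _) linearZ.
Qed.

Let E : \forall y \near x, \sum_j Y y ord0 j * L y (stdb j) = L y (Y y).
Proof. by apply: filterS Llin => y Ly; rewrite (linear_sum_coord Ly). Qed.

(** A tensor field in a chart is a family L of linear maps, known to be smooth on
    fixed arguments only; expanding the argument in the standard basis gives
    the case of a moving argument.  The linearity of L y is needed for y near x
    only, where a field given in a chart makes sense. *)
Lemma smooth_at_moving : (forall a, smooth_at (fun y => L y a) x) ->
  smooth_at Y x -> smooth_at (fun y => L y (Y y)) x.
Proof.
move=> HL /smooth_at_coordP HY; apply: smooth_at_near E _.
by apply: smooth_at_sum => j _; exact: smooth_atM.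
Qed.

Lemma differentiable_moving : (forall a, differentiable (fun y => L y a) x) ->
  differentiable Y x -> differentiable (fun y => L y (Y y)) x.
Proof.
move=> HL /differentiable_coordP HY; apply: near_eq_differentiable E _.
have -> : (fun y => \sum_j Y y ord0 j * L y (stdb j)) =
   \sum_j (fun y => Y y ord0 j * L y (stdb j)).
  by apply/funext => y; rewrite fct_sumE.
by apply: differentiable_sum => j; exact: differentiableM.
Qed.

Lemma derive_moving v : (forall a, differentiable (fun y => L y a) x) ->
  differentiable Y x -> 'D_v (fun y => L y (Y y)) x =
    'D_v (fun y => L y (Y x)) x + L x ('D_v Y x).
Proof.
move=> HL HY; have HYj := (differentiable_coordP _ _).1 HY.
have dj j : derivable (fun y => Y y ord0 j * L y (stdb j)) x v.
  by apply: diff_derivable; exact: differentiableM.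
have dj0 j : derivable (fun y => Y x ord0 j * L y (stdb j)) x v.
  by apply: diff_derivable; apply: differentiableM => //; exact: differentiable_cst.
rewrite -(near_eq_derive _ E).
have -> : 'D_v (fun y => L y (Y x)) x =
          'D_v (fun y => \sum_j Y x ord0 j * L y (stdb j)) x.
  by apply: near_eq_derive; apply: filterS Llin => y Ly; exact: linear_sum_coord.
have sumE (F : 'I_n -> V -> R) : (fun y => \sum_j F j y) = \sum_j F j.
  by apply/funext => y; rewrite fct_sumE.
rewrite !sumE (derive_sum dj) (derive_sum dj0).
rewrite (linear_sum_coord (nbhs_singleton Llin)) -big_split /=.
apply: eq_bigr => j _; rewrite derive_coord // !deriveM; do ?exact: diff_derivable.
rewrite /GRing.scale /= (derive_cst (Y x ord0 j)) mulr0 addr0.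
by congr (_ + _); rewrite mulrC.
Qed.

End MovingArgument.

(** * Smoothness of solutions of linear equations, symmetry of second derivatives *)

Section SmoothSolve.
Context {R : realType} {V : normedModType R} {n : nat}.

Lemma gram_formE (g : 'rV[R]_n -> 'rV[R]_n -> R) : inner_product g ->
  forall u v, g u v = (u *m gram g *m v^T) ord0 ord0.
Proof.
move=> [gl gs _] u v.
have gr c a b w : g w (c *: a + b) = c * g w a + g w b by rewrite gs gl !(gs w).
rewrite (linear_sum_coord (l := fun a => g a v)); last by move=> *; rewrite gl.
rewrite [RHS]mxE.
under [RHS]eq_bigr do rewrite !mxE mulr_suml.
rewrite [RHS]exchange_big; apply: eq_bigr => i _ /=.
rewrite (linear_sum_coord (l := fun a => g (stdb i) a)) // mulr_sumr.
apply: eq_bigr => j _; rewrite !mxE /=; ring.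
Qed.

Lemma gram_unit (g : 'rV[R]_n -> 'rV[R]_n -> R) : inner_product g ->
  gram g \in unitmx.
Proof.
move=> ig; rewrite unitmxE unitfE; apply/negP => /det0P[v v0 vg].
by have [_ _ /(_ _ v0)] := ig; rewrite gram_formE // vg mul0mx mxE ltxx.
Qed.

Lemma inner_product_inj (g : V -> V -> R) a b : inner_product g ->
  (forall w, g a w = g b w) -> a = b.
Proof.
move=> [gl gs gp] E; apply/eqP; rewrite -subr_eq0; apply/negP => /negP ab.
have := gp _ ab; have := gl (-1) b a (a - b).
by rewrite scaleN1r [- b + a]addrC => ->; rewrite mulN1r E addNr ltxx.
Qed.

Lemma smooth_at_det m (A : V -> 'M[R]_m) x :
  (forall i j, smooth_at (fun y => A y i j) x) -> smooth_at (fun y => \det (A y)) x.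
Proof.
move=> HA; apply: smooth_at_sum => s _; apply: smooth_atM; first exact: smooth_at_cst.
exact: smooth_at_prod.
Qed.

Lemma smooth_at_invmx (A : V -> 'M[R]_n) x i j : A x \in unitmx ->
  (forall i j, smooth_at (fun y => A y i j) x) -> smooth_at (fun y => invmx (A y) i j) x.
Proof.
move=> Ax HA; have dA := smooth_at_det HA.
have d0 : \det (A x) != 0 by move: Ax; rewrite unitmxE unitfE.
have n0 : \forall y \near x, A y \in unitmx.
  have := near_neq0 (differentiable_continuous (smooth_at_differentiable dA)) d0.
  by apply: filterS => y; rewrite unitmxE unitfE.
have : smooth_at (fun y => (\det (A y))^-1 * ((-1) ^+ (j + i) *
    \det (row' j (col' i (A y))))) x.
  apply: smooth_atM; first exact: smooth_atV.
  apply: smooth_atM; first exact: smooth_at_cst.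
  apply: smooth_at_det => a b; apply: smooth_at_ext (HA (lift j a) (lift i b)) => y.
  by rewrite !mxE.
apply: smooth_at_near; apply: filterS n0 => y Ay.
by rewrite /invmx Ay !mxE.
Qed.

(** Cramer's rule: the inverse of the Gram matrix is a smooth function of its
    entries. *)
Lemma smooth_at_solve (g : V -> 'rV[R]_n -> 'rV[R]_n -> R) (Y : V -> 'rV[R]_n) x :
  (\forall y \near x, inner_product (g y)) ->
  (forall a b, smooth_at (fun y => g y a b) x) ->
  (forall a, smooth_at (fun y => g y (Y y) a) x) -> smooth_at Y x.
Proof.
move=> ig sg sh; apply/smooth_at_coordP => j.
have : smooth_at (fun y => \sum_i g y (Y y) (stdb i) * invmx (gram (g y)) i j) x.
  apply: smooth_at_sum => i _; apply: smooth_atM => //; apply: smooth_at_invmx.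
    exact: gram_unit (nbhs_singleton ig).
  by move=> a b; apply: smooth_at_ext (sg (stdb a) (stdb b)) => y; rewrite mxE.
apply: smooth_at_near; apply: filterS ig => y ig.
rewrite -[in RHS](mulmxK (gram_unit ig) (Y y)) [RHS]mxE.
apply: eq_bigr => i _; congr (_ * _); rewrite mxE.
have [gl _ _] := ig.
rewrite (linear_sum_coord (l := fun a => g y a (stdb i))); last by move=> *; rewrite gl.
by apply: eq_bigr => k _; rewrite !mxE.
Qed.

End SmoothSolve.

Section Schwarz.
Context {R : realType} {n : nat}.
Implicit Types (f : 'rV[R]_n -> R) (x y u v : 'rV[R]_n).

Lemma is_derive_line f y u (a : R) : differentiable f (a *: u + y) ->
  is_derive a 1 (fun t => f (t *: u + y)) ('D_u f (a *: u + y)).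
Proof.
move=> df.
have dl : differentiable (fun t : R => t *: u + y) a.
  by apply: (@differentiableD _ _ _ (fun t : R => t *: u) (fun=> y)).
have dlE : 'D_1 (fun t : R => t *: u + y) a = u.
  rewrite deriveD ?derive_cst ?addr0; [|exact: diff_derivable|exact: derivable_cst].
  by rewrite deriveE // diff_val scale1r.
apply: DeriveDef; last by rewrite (derive_comp _ dl df) dlE.
by apply: diff_derivable; apply: (differentiable_comp dl).
Qed.

Lemma mean_value_line f y u (s : R) : 0 < s ->
  (forall a, 0 <= a <= s -> differentiable f (a *: u + y)) ->
  exists2 a, 0 <= a <= s & f (s *: u + y) - f y = s * 'D_u f (a *: u + y).
Proof.
move=> s0 df.
have D a : 0 <= a <= s -> is_derive a 1 (fun t => f (t *: u + y)) ('D_u f (a *: u + y)).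
  by move=> /df; exact: is_derive_line.
have [|||a] := @MVT R (fun t => f (t *: u + y)) (fun a => 'D_u f (a *: u + y)) 0 s.
- by [].
- by move=> a; rewrite in_itv /= => /andP[a0 as_]; apply: D; rewrite !ltW.
- apply: continuous_in_subspaceT => a; rewrite inE /= in_itv /= => /D Da.
  by apply: differentiable_continuous; apply/derivable1_diffP.
rewrite in_itv /= => /andP[a0 as_]; rewrite scale0r add0r subr0 => E.
by exists a; rewrite ?(ltW a0) ?(ltW as_) // E mulrC.
Qed.

(** The mean value theorem, used first along u for the increment of f in the
    direction v, then along v for ['D_u f]. *)
Lemma second_difference f x u v (s : R) : 0 < s ->
  (forall a b, 0 <= a <= s -> 0 <= b <= s -> differentiable f (a *: u + b *: v + x)) ->
  (forall a b, 0 <= a <= s -> 0 <= b <= s ->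
     differentiable ('D_u f) (a *: u + b *: v + x)) ->
  exists a b, [/\ 0 <= a <= s, 0 <= b <= s &
    f (s *: u + s *: v + x) - f (s *: u + x) - f (s *: v + x) + f x =
    s * (s * 'D_v ('D_u f) (a *: u + b *: v + x))].
Proof.
move=> s0 d1 d2.
have s00 : 0 <= (0 : R) <= s by apply/andP; split => //; exact: ltW.
have ss : 0 <= s <= s by apply/andP; split => //; exact: ltW.
have shE (w y : 'rV[R]_n) a : differentiable f (a *: u + (w + y)) ->
    differentiable (fun z => f (z + w)) (a *: u + y) /\
    'D_u (fun z => f (z + w)) (a *: u + y) = 'D_u f (a *: u + (w + y)).
  rewrite (_ : a *: u + (w + y) = a *: u + y + w); last by rewrite (addrC w) addrA.
  move=> df.
  have dl : differentiable (fun z => z + w) (a *: u + y).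
    by apply: (@differentiableD _ _ _ id (fun=> w)).
  split; first exact: (differentiable_comp dl).
  rewrite (derive_comp _ dl df); congr ('D_(_) f _).
  rewrite (deriveD (f := id) (g := fun=> w)); [|exact: derivable_id|exact: derivable_cst].
  by rewrite derive_id derive_cst addr0.
pose h z := f (z + s *: v) - f z.
have dh a : 0 <= a <= s -> differentiable h (a *: u + x) /\
   'D_u h (a *: u + x) = 'D_u f (a *: u + s *: v + x) - 'D_u f (a *: u + x).
  move=> ha; have /shE[da Da] : differentiable f (a *: u + (s *: v + x)).
    by rewrite addrA; exact: d1.
  have db : differentiable f (a *: u + x).
    by have := d1 _ _ ha s00; rewrite scale0r addr0.
  split; first exact: differentiableB.
  rewrite (deriveB (f := fun z => f (z + s *: v))) ?Da ?addrA //; exact: diff_derivable.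
have [a ha E1] := mean_value_line s0 (fun a ha => (dh a ha).1).
have [|b hb E2] := @mean_value_line ('D_u f) (a *: u + x) v s s0.
  by move=> b hb; rewrite addrA (addrC (b *: v)); exact: d2.
exists a, b; split => //.
have -> : a *: u + b *: v + x = b *: v + (a *: u + x).
  by rewrite addrA (addrC (b *: v)).
rewrite -E2 (_ : s *: v + (a *: u + x) = a *: u + s *: v + x); last first.
  by rewrite addrA (addrC (s *: v)).
by rewrite -(dh a ha).2 -E1 /h (addrAC (s *: u) x) (addrC x (s *: v)); ring.
Qed.

(** The second difference of f is symmetric in u and v, and after division by s^2
    it is close to both mixed derivatives. *)
Lemma schwarz f x u v : smooth_at f x -> 'D_u ('D_v f) x = 'D_v ('D_u f) x.
Proof.
move=> Hf.
have Huv := smooth_at_differentiable (smooth_at_derive u (smooth_at_derive v Hf)).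
have Hvu := smooth_at_differentiable (smooth_at_derive v (smooth_at_derive u Hf)).
have df := smooth_at_near_differentiable Hf.
have du := smooth_at_near_differentiable (smooth_at_derive u Hf).
have dv := smooth_at_near_differentiable (smooth_at_derive v Hf).
apply/eqP; rewrite -subr_eq0 -normr_le0; apply/ler_addgt0Pl => e e0; rewrite addr0.
have e20 : 0 < e / 2 by rewrite divr_gt0.
have := differentiable_continuous Huv => /cvgrPdist_lt/(_ _ e20) cuv.
have := differentiable_continuous Hvu => /cvgrPdist_lt/(_ _ e20) cvu.
have /nbhs_ballP[r /= r0 Br] : \forall y \near x, [/\ differentiable f y,
    differentiable ('D_u f) y, differentiable ('D_v f) y,
    `|'D_u ('D_v f) x - 'D_u ('D_v f) y| < e / 2 &
    `|'D_v ('D_u f) x - 'D_v ('D_u f) y| < e / 2].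
  apply: filterS (filterI (filterI df du) (filterI dv (filterI cuv cvu))).
  move=> y [[d1 d2] [d3 [c1 c2]]]; exact (And5 d1 d2 d3 c1 c2).
(* small enough for the parallelogram to stay in the ball of radius r *)
pose s := r / 2 / (`|u| + `|v| + 1).
have uv0 : 0 < `|u| + `|v| + 1 by rewrite ltr_wpDl // addr_ge0.
have s0 : 0 < s by rewrite !divr_gt0.
have box a b : 0 <= a <= s -> 0 <= b <= s -> ball x r (a *: u + b *: v + x).
  move=> /andP[a0 as_] /andP[b0 bs].
  rewrite -ball_normE /= opprD addrCA subrr addr0 normrN.
  apply: le_lt_trans (ler_normD _ _) _; rewrite !normrZ !ger0_norm //.
  apply: (@le_lt_trans _ _ (s * (`|u| + `|v| + 1))).
    by rewrite !mulrDr mulr1 ler_wpDr ?(ltW s0) // lerD // ler_wpM2r.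
  by rewrite /s divfK ?gt_eqF // ltr_pdivrMr // ltr_pMr // ltr1n.
have boxC a b : 0 <= a <= s -> 0 <= b <= s -> ball x r (b *: v + a *: u + x).
  by rewrite (addrC (b *: v)); exact: box.
have [||a [b [ha hb E1]]] := @second_difference f x u v s s0.
- by move=> a b ha hb; case: (Br _ (box _ _ ha hb)).
- by move=> a b ha hb; case: (Br _ (box _ _ ha hb)).
have [||b' [a' [hb' ha' E2]]] := @second_difference f x v u s s0.
- by move=> b' a' hb' ha'; case: (Br _ (boxC _ _ ha' hb')).
- by move=> b' a' hb' ha'; case: (Br _ (boxC _ _ ha' hb')).
pose q := b' *: v + a' *: u + x.
have E : 'D_v ('D_u f) (a *: u + b *: v + x) = 'D_u ('D_v f) q.
  apply: (mulfI (lt0r_neq0 s0)); apply: (mulfI (lt0r_neq0 s0)).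
  apply: etrans (esym E1) _; apply: etrans _ E2.
  by rewrite (addrC (s *: v) (s *: u)); congr (_ + _); exact: addrAC.
have [_ _ _ _ B1] := Br _ (box _ _ ha hb).
have [_ _ _ B2 _] := Br _ (boxC _ _ ha' hb').
rewrite (splitr e); apply: le_trans (ler_distD ('D_u ('D_v f) q) _ _) _.
apply: lerD; first exact: ltW B2.
have : `|'D_u ('D_v f) q - 'D_v ('D_u f) x| < e / 2 by case: _ / E; rewrite distrC; exact: B1.
exact: ltW.
Qed.

End Schwarz.

(** * Bump functions *)

Section Bump.
Context {R : realType}.

(** The powers of 1 / t make this family, which starts with e^(-1/t), stable under
    differentiation. *)
Definition flat (n : nat) (t : R) : R := if 0 < t then t ^- n * expR (- t^-1) else 0.

Lemma flatS n t : flat n t = t * flat n.+1 t.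
Proof.
rewrite /flat; case: ifPn => t0; last by rewrite mulr0.
by rewrite mulrA exprS invfM mulrA divff ?mul1r // gt_eqF.
Qed.

(** The term of degree n+1 of the exponential series at 1 / t is at most e^(1/t).
    This is what makes [flat n] differentiable at 0. *)
Lemma norm_flat_le n t : `|flat n t| <= n.+1`!%:R * `|t|.
Proof.
rewrite /flat; case: ifPn => t0; last by rewrite normr0 mulr_ge0.
have te0 : 0 <= t ^- n * expR (- t^-1).
  by rewrite mulr_ge0 ?expR_ge0 // invr_ge0 exprn_ge0 // ltW.
rewrite (ger0_norm te0).
rewrite gtr0_norm // expRN ler_pdivrMr ?expR_gt0 //.
have it0 : 0 <= t^-1 by rewrite invr_ge0 ltW.
have : (t^-1) ^+ n.+1 / n.+1`!%:R <= expR t^-1.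
  by apply: le_trans (expR_ge1Dxn n it0); rewrite lerDr.
have f0 : (0 : R) < n.+1`!%:R by rewrite ltr0n fact_gt0.
rewrite ler_pdivrMr // => H.
have := ler_wpM2l (ltW t0) H; rewrite exprS mulrA divff ?gt_eqF // mul1r exprVn.
by rewrite mulrCA => /le_trans; apply; rewrite mulrCA mulrA mulrC mulrA.
Qed.

Lemma is_derive_flat n (t : R) :
  is_derive t (1 : R) (flat n) (flat n.+2 t - n%:R * flat n.+1 t).
Proof.
have [t0|t0|->] := ltgtP t 0.
- have E : \forall s \near t, cst 0 s = flat n s.
    by near=> s; rewrite /flat ltNge ltW //; near: s; exact: lt_nbhsl.
  apply: near_eq_is_derive E _.
  by rewrite /flat !ltNge !ltW //= mulr0 subr0; exact: is_derive_cst.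
- have E : \forall s \near t, s ^- n * expR (- s^-1) = flat n s.
    by near=> s; rewrite /flat ifT //; near: s; exact: lt_nbhsr.
  apply: near_eq_is_derive E _; rewrite /flat t0.
  have tn0 : t != 0 by rewrite gt_eqF.
  have dV : is_derive t 1 (fun s : R => s^-1) (- t ^- 2).
    have := @is_deriveV R id t 1 1 tn0 (is_derive_id _ _).
    by rewrite /GRing.scale /= mulr1.
  have dE : is_derive t 1 (fun s : R => expR (- s^-1)) (t ^- 2 * expR (- t^-1)).
    have dN := is_deriveN dV.
    have := @is_derive1_comp R expR (fun s => - s^-1) t _ _ (is_derive_expR _) dN.
    by rewrite opprK mulrC.
  have dX : is_derive t 1 (fun s : R => s ^- n) (- (n%:R * t ^- n.+1)).
    have dn : is_derive t 1 (fun s : R => s ^+ n) (n%:R * t ^+ n.-1).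
      by apply: DeriveDef; rewrite ?exp_derive ?scaler1 //; exact: exprn_derivable.
    have := @is_deriveV R (fun s => s ^+ n) t _ 1 (expf_neq0 n tn0) dn.
    move=> D; apply: (is_derive_eq D); rewrite /GRing.scale /=.
    case: n {D dn} => [|n] /=; first by rewrite !mul0r mulr0 oppr0.
    by rewrite !exprS; field; rewrite tn0 expf_neq0.
  apply: (is_derive_eq (is_deriveM dX dE)).
  rewrite /GRing.scale /= !exprS; field; by rewrite tn0 expf_neq0.
- have -> : flat n.+2 0 - n%:R * flat n.+1 0 = 0 by rewrite /flat ltxx mulr0 subr0.
  have C : (fun h : R => h^-1 *: (flat n (h *: 1 + 0) - flat n 0)) @ 0^' --> (0 : R).
    apply/cvgrPdist_lt => e e0; near=> h.
    have h0 : h != 0 by near: h; exact: nbhs_dnbhs_neq.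
    rewrite {2}/flat ltxx !addr0 subr0 /GRing.scale /= mulr1 sub0r normrN.
    rewrite flatS mulrA mulVf // mul1r; apply: le_lt_trans (norm_flat_le _ _) _.
    rewrite mulrC -ltr_pdivlMr ?ltr0n ?fact_gt0 //; near: h.
    by apply: dnbhs0_lt; rewrite divr_gt0 // ltr0n fact_gt0.
  apply: DeriveDef; first by apply/cvg_ex; exists 0.
  exact: cvg_lim.
Unshelve. all: by end_near. Qed.

Lemma smooth_at_flat (V : normedModType R) n (q : V -> R) x :
  smooth_at q x -> smooth_at (fun y => flat n (q y)) x.
Proof.
move=> Hq k; elim: k n => [|k IH] n.
  apply/smooth_at_order0; apply: filterS (smooth_at_near_differentiable Hq) => y dq.
  apply: (differentiable_comp dq (g := flat n)); apply/derivable1_diffP.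
  by have [] := is_derive_flat n (q y).
apply/smooth_at_orderS; split.
  apply: filterS (smooth_at_near_differentiable Hq) => y dq.
  apply: (differentiable_comp dq (g := flat n)); apply/derivable1_diffP.
  by have [] := is_derive_flat n (q y).
move=> v.
have H : smooth_at_order k (fun y => 'D_v q y * (flat n.+2 (q y) +
    (- n%:R) * flat n.+1 (q y))) x.
  apply: smooth_at_orderM; first exact: smooth_at_derive Hq k.
  apply: smooth_at_orderD; first exact: IH.
  by apply: smooth_at_orderM; [exact: smooth_at_cst|exact: IH].
apply: smooth_at_order_near H.
apply: filterS (smooth_at_near_differentiable Hq) => y dq.
have [df fE] := is_derive_flat n (q y).
move/derivable1_diffP in df.
rewrite [RHS]deriveE; last exact: (differentiable_comp dq).
rewrite (diff_comp dq df) /= -(deriveE _ dq) -[X in 'd _ _ X]mulr1.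
by rewrite -[X in 'd _ _ X]/(_ *: 1) linearZ /= -deriveE // fE mulNr.
Qed.

(** The bump is [flat 0] of r^2 - |y - x|^2 for the Euclidean norm, normalised at
    x; it vanishes where the norm of row vectors, a maximum, is at least r. *)
Lemma smooth_bump n (x : 'rV[R]_n) (r : R) : 0 < r -> exists b : 'rV[R]_n -> R,
  [/\ forall y, smooth_at b y, b x = 1 & forall y, r <= `|x - y| -> b y = 0].
Proof.
move=> r0; pose q (y : 'rV[R]_n) := r ^+ 2 - \sum_j (y ord0 j - x ord0 j) ^+ 2.
have qx : q x = r ^+ 2.
  by rewrite /q big1 ?subr0 // => j _; rewrite subrr expr0n.
have f0 : flat 0 (r ^+ 2) != 0.
  by rewrite /flat exprn_gt0 // mulf_neq0 // ?invr_neq0 ?oner_neq0 ?gt_eqF ?expR_gt0.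
exists (fun y => (flat 0 (r ^+ 2))^-1 * flat 0 (q y)); split => [y||y].
- apply: smooth_atM; first exact: smooth_at_cst.
  apply: smooth_at_flat; apply: smooth_atB; first exact: smooth_at_cst.
  apply: smooth_at_sum => j _.
  have P : smooth_at (fun y : 'rV[R]_n => y ord0 j - x ord0 j) y.
    apply: smooth_atB; last exact: smooth_at_cst.
    exact: ((smooth_at_coordP _ _).1 (smooth_at_id y) j).
  by apply: smooth_at_ext (smooth_atM P P) => z; rewrite expr2.
- by rewrite qx mulVf.
- move=> H; rewrite {2}/flat; case: ifPn => [q0|]; last by rewrite mulr0.
  suff : `|x - y| < r by rewrite ltNge H.
  rewrite [`|_|]mx_normrE; apply: bigmax_lt => // -[i j] _ /=.
  rewrite !mxE ord1 -(ltr_pXn2r (ltn0Sn 1)) ?nnegrE ?(ltW r0) //.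
  rewrite real_normK ?num_real // -sqrrN opprB; apply: le_lt_trans; last first.
    by rewrite -subr_gt0; exact: q0.
  by rewrite (bigD1 j) //= lerDl; apply: sumr_ge0 => k _; exact: sqr_ge0.
Qed.

End Bump.

(** * Charts and tangent maps *)

Section SmoothOnAt.
Context {R : realType} {V W : normedModType R}.

Lemma smooth_on_at (U : set V) (f : V -> W) x : (\forall y \near x, U y) ->
  smooth_on U f -> smooth_at f x.
Proof. by move=> Ux H k s _; apply: filterS Ux => y Uy; exact: H. Qed.

Lemma smooth_at_on (U : set V) (f : V -> W) :
  (forall x, U x -> smooth_at f x) -> smooth_on U f.
Proof. by move=> H s x Ux; have /nbhs_singleton := H x Ux (size s) s (leqnn _). Qed.

End SmoothOnAt.

Section ChartPoints.
Context {R : realType} {n : nat} {M : manifold R n}.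
Implicit Types (c : chart R n M) (p : M).

Lemma atlas_chart_at p : atlas (chart_at p).
Proof. exact: (projT2 (cid (atlas_cover p))).1. Qed.

Lemma cdom_chart_at p : cdom (chart_at p) p.
Proof. exact: (projT2 (cid (atlas_cover p))).2. Qed.

Lemma near_cdom c p : cdom c p -> \forall q \near p, cdom c q.
Proof. by move=> cp; apply: open_nbhs_nbhs; split => //; exact: cdom_open. Qed.

Lemma near_cparam c p (P : set M) : cdom c p -> (\forall q \near p, P q) ->
  \forall y \near ccoord c p, P (cparam c y).
Proof.
move=> cp Pp; apply: (cparam_continuous cp).
by rewrite ccoordK.
Qed.

Lemma near_ccoordK c p : cdom c p ->
  \forall y \near ccoord c p, ccoord c (cparam c y) = y.
Proof.
move=> cp; have : \forall y \near ccoord c p, (ccoord c @` cdom c) y.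
  by apply: open_nbhs_nbhs; split; [exact: cimg_open|exists p].
by apply: filterS => y [q cq <-]; rewrite ccoordK.
Qed.

End ChartPoints.

#[global] Hint Resolve atlas_chart_at cdom_chart_at : core.

Section LocalRepresentation.
Context {R : realType}.

Definition local_rep m n (M : manifold R m) (M' : manifold R n) (F : M -> M')
    (c : chart R m M) (c' : chart R n M') : 'rV[R]_m -> 'rV[R]_n :=
  ccoord c' \o F \o cparam c.

Lemma near_overlap m n (M : manifold R m) (M' : manifold R n) (F : M -> M')
    (c : chart R m M) (c' : chart R n M') (p : M) :
  {for p, continuous F} -> cdom c p -> cdom c' (F p) ->
  \forall y \near ccoord c p, overlap F c c' y.
Proof.
move=> cF cp cFp.
have D : \forall q \near p, cdom c q /\ cdom c' (F q).
  by apply: filterI; [exact: near_cdom|apply: cF; exact: near_cdom].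
apply: filterS2 (near_cparam cp D) (near_ccoordK cp) => y [cy cFy] yE.
by exists (cparam c y).
Qed.

Lemma smooth_at_transition n (M : manifold R n) (c c' : chart R n M) (p : M) :
  atlas c -> atlas c' -> cdom c p -> cdom c' p ->
  smooth_at (local_rep idfun c c') (ccoord c p).
Proof.
move=> ac ac' cp c'p; apply: smooth_on_at (atlas_compatible ac ac').
exact: (near_overlap (F := @idfun M)).
Qed.

Lemma smooth_at_local_rep m n (M : manifold R m) (M' : manifold R n) (F : M -> M')
    (c : chart R m M) (c' : chart R n M') (p : M) : smooth_map F ->
  atlas c -> atlas c' -> cdom c p -> cdom c' (F p) ->
  smooth_at (local_rep F c c') (ccoord c p).
Proof.
move=> [cF sF] ac ac' cp c'p; apply: smooth_on_at (sF _ _ ac ac').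
exact: (near_overlap (cF p) cp c'p).
Qed.

Lemma smooth_map_id n (M : manifold R n) : smooth_map (@idfun M).
Proof.
split=> [x|c c' ac ac']; first exact: cvg_id.
apply: smooth_at_on => x [p [cp c'p] <-]; exact: smooth_at_transition.
Qed.

Lemma near_local_rep_comp m n k (M : manifold R m) (M' : manifold R n)
    (M'' : manifold R k) (F : M -> M') (G : M' -> M'') (c : chart R m M)
    (c' : chart R n M') (c'' : chart R k M'') (p : M) :
  {for p, continuous F} -> cdom c p -> cdom c' (F p) ->
  \forall y \near ccoord c p,
    local_rep G c' c'' (local_rep F c c' y) = local_rep (G \o F) c c'' y.
Proof.
move=> cF cp cFp.
have D : \forall q \near p, cdom c' (F q) by apply: cF; exact: near_cdom.
by apply: filterS (near_cparam cp D) => y cy; rewrite /local_rep /= ccoordK.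
Qed.

Lemma local_rep_coord m n (M : manifold R m) (M' : manifold R n) (F : M -> M')
    (c : chart R m M) (c' : chart R n M') (p : M) : cdom c p ->
  local_rep F c c' (ccoord c p) = ccoord c' (F p).
Proof. by move=> cp; rewrite /local_rep /= ccoordK. Qed.

Lemma diff_local_rep_comp m n k (M : manifold R m) (M' : manifold R n)
    (M'' : manifold R k) (F : M -> M') (G : M' -> M'') (c : chart R m M)
    (c' : chart R n M') (c'' : chart R k M'') (p : M) u :
  smooth_map F -> smooth_map G ->
  atlas c -> atlas c' -> atlas c'' -> cdom c p -> cdom c' (F p) ->
  cdom c'' (G (F p)) ->
  'd (local_rep (G \o F) c c'') (ccoord c p) u =
  'd (local_rep G c' c'') (ccoord c' (F p)) ('d (local_rep F c c') (ccoord c p) u).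
Proof.
move=> sF sG ac ac' ac'' cp cFp cGp.
have dF := smooth_at_differentiable (smooth_at_local_rep sF ac ac' cp cFp).
have dG : differentiable (local_rep G c' c'') (local_rep F c c' (ccoord c p)).
  rewrite local_rep_coord //.
  exact: smooth_at_differentiable (smooth_at_local_rep sG ac' ac'' cFp cGp).
rewrite -(near_eq_diff u (near_local_rep_comp G c'' (sF.1 p) cp cFp)); last first.
  exact: (differentiable_comp dF dG).
by rewrite (diff_comp dF dG) local_rep_coord.
Qed.

Lemma diff_local_rep_changel m n (M : manifold R m) (M' : manifold R n)
    (F : M -> M') (c0 c : chart R m M) (c' : chart R n M') (p : M) u :
  smooth_map F -> atlas c0 -> atlas c -> atlas c' -> cdom c0 p -> cdom c p ->
  cdom c' (F p) ->
  'd (local_rep F c0 c') (ccoord c0 p) u =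
  'd (local_rep F c c') (ccoord c p) ('d (local_rep idfun c0 c) (ccoord c0 p) u).
Proof.
move=> sF ac0 ac ac' c0p cp cFp.
exact: (diff_local_rep_comp u (smooth_map_id M) sF ac0 ac ac' c0p cp cFp).
Qed.

Lemma diff_local_rep_changer m n (M : manifold R m) (M' : manifold R n)
    (F : M -> M') (c : chart R m M) (c0 c' : chart R n M') (p : M) u :
  smooth_map F -> atlas c -> atlas c0 -> atlas c' -> cdom c p -> cdom c0 (F p) ->
  cdom c' (F p) ->
  'd (local_rep F c c') (ccoord c p) u =
  'd (local_rep idfun c0 c') (ccoord c0 (F p)) ('d (local_rep F c c0) (ccoord c p) u).
Proof.
move=> sF ac ac0 ac' cp c0p cFp.
exact: (diff_local_rep_comp u sF (smooth_map_id M') ac ac0 ac' cp c0p cFp).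
Qed.

Lemma diff_local_rep_id n (M : manifold R n) (c : chart R n M) (p : M) u :
  cdom c p -> 'd (local_rep idfun c c) (ccoord c p) u = u.
Proof.
move=> cp.
have E : \forall y \near ccoord c p, id y = local_rep idfun c c y.
  by apply: filterS (near_ccoordK cp) => y yE; rewrite /local_rep /= yE.
rewrite -(near_eq_diff u E) ?diff_val //.
Qed.

End LocalRepresentation.

Section TangentCharts.
Context {R : realType}.

Lemma to_chartE n (M : manifold R n) (c : chart R n M) (p : M) (v : tangent p) :
  to_chart c v = 'd (local_rep idfun (chart_at p) c) (coord_at p) v.
Proof. by []. Qed.

Lemma of_chartE n (M : manifold R n) (c : chart R n M) (p : M) w :
  of_chart c p w = 'd (local_rep idfun c (chart_at p)) (ccoord c p) w.
Proof. by []. Qed.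

Lemma to_chart_at n (M : manifold R n) (p : M) (v : tangent p) :
  to_chart (chart_at p) v = v.
Proof. by rewrite to_chartE diff_local_rep_id. Qed.

Lemma of_chart_at n (M : manifold R n) (p : M) w : of_chart (chart_at p) p w = w.
Proof. by rewrite of_chartE diff_local_rep_id. Qed.

Lemma of_chartK n (M : manifold R n) (c : chart R n M) (p : M) w :
  atlas c -> cdom c p -> to_chart c (of_chart c p w) = w.
Proof.
move=> ac cp; rewrite to_chartE of_chartE -[RHS](diff_local_rep_id w cp).
exact: esym (diff_local_rep_changel w (smooth_map_id M) _ _ _ _ _ _).
Qed.

Lemma to_chartK n (M : manifold R n) (c : chart R n M) (p : M) (v : tangent p) :
  atlas c -> cdom c p -> of_chart c p (to_chart c v) = v.
Proof.
move=> ac cp; rewrite to_chartE of_chartE.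
rewrite -[RHS](diff_local_rep_id v (cdom_chart_at p)).
exact: esym (diff_local_rep_changel v (smooth_map_id M) _ _ _ _ _ _).
Qed.

Lemma to_chart_tangent_map m n (M : manifold R m) (M' : manifold R n) (F : M -> M')
    (c : chart R m M) (c' : chart R n M') (p : M) (u : tangent p) :
  smooth_map F -> atlas c -> atlas c' -> cdom c p -> cdom c' (F p) ->
  to_chart c' (tangent_map F u) = 'd (local_rep F c c') (ccoord c p) (to_chart c u).
Proof.
move=> sF ac ac' cp cFp; rewrite !to_chartE /tangent_map.
apply: etrans (esym _) (diff_local_rep_changel u sF _ _ _ _ _ _) => //.
exact: (diff_local_rep_changer u sF).
Qed.

Lemma tangent_map_id n (M : manifold R n) (p : M) (u : tangent p) :
  tangent_map idfun u = u.
Proof. exact: to_chart_at. Qed.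

End TangentCharts.

(** * Extension of a tangent vector to a vector field *)

Section Extension.
Context {R : realType}.

Lemma smooth_atZ (V : normedModType R) n (k : V -> R) (Y : V -> 'rV[R]_n) x :
  smooth_at k x -> smooth_at Y x -> smooth_at (fun y => k y *: Y y) x.
Proof.
move=> Hk /smooth_at_coordP HY; apply/smooth_at_coordP => j.
by apply: smooth_at_ext (smooth_atM Hk (HY j)) => y; rewrite mxE.
Qed.

Lemma to_chart_of_chart n (M : manifold R n) (c c' : chart R n M) (p : M) w :
  atlas c -> atlas c' -> cdom c p -> cdom c' p ->
  to_chart c' (of_chart c p w) = 'D_w (local_rep idfun c c') (ccoord c p).
Proof.
move=> ac ac' cp cp'; rewrite to_chartE of_chartE.
rewrite -(diff_local_rep_changel w (smooth_map_id M)) // deriveE //.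
exact: smooth_at_differentiable (smooth_at_transition _ _ _ _).
Qed.

Lemma to_chart0 n (M : manifold R n) (c : chart R n M) (p : M) :
  to_chart c (0 : tangent p) = 0.
Proof. by rewrite to_chartE linear0. Qed.

Lemma to_chartZ n (M : manifold R n) (c : chart R n M) (p : M) a (v : tangent p) :
  to_chart c (a *: v : tangent p) = a *: to_chart c v.
Proof. by rewrite to_chartE linearZ. Qed.

(** A coordinate field multiplied by a bump function and extended by 0. *)
Lemma extend_tangent_vector n (M : manifold R n) (p : M) (u : tangent p) :
  exists X : vector_field M, smooth_vector_field X /\ X p = u.
Proof.
pose c := chart_at p; pose x0 := ccoord c p.
have cp : cdom c p by exact: cdom_chart_at.
have ac : atlas c by exact: atlas_chart_at.
have /nbhs_ballP[r /= r0 Br] : \forall y \near x0, (ccoord c @` cdom c) y.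
  by apply: open_nbhs_nbhs; split; [exact: cimg_open|exists p].
have r20 : 0 < r / 2 by rewrite divr_gt0.
have [b [sb bx0 b0]] := smooth_bump x0 r20.
pose X : vector_field M := fun q =>
  if `[< cdom c q >] then b (ccoord c q) *: of_chart c q u else 0.
exists X; split; last first.
  by rewrite /X asboolT // -/x0 bx0 scale1r of_chart_at.
pose D := closed_ball x0 (r / 2).
have DB y : D y -> exists2 q, cdom c q & ccoord c q = y.
  rewrite /D closed_ballE // /closed_ball_ /= => Dy; apply: Br.
  rewrite -ball_normE /=; apply: le_lt_trans Dy _.
  by rewrite ltr_pdivrMr // ltr_pMr // ltr1n.
have cD : compact D.
  apply: bounded_closed_compact; last exact: closed_ball_closed.
  exists (`|x0| + r / 2); split; first exact: num_real.
  move=> s sr y; rewrite /D closed_ballE // /closed_ball_ /= => Dy.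
  apply: ltW; apply: le_lt_trans sr.
  have := ler_normB x0 (x0 - y); rewrite opprB addrC subrK => /le_trans; apply.
  by rewrite lerD2l.
(* The support is compact, hence closed in the Hausdorff space M: the field is
   smooth, being 0, near the points outside of it. *)
have clK : closed (cparam c @` D).
  apply: compact_closed; first exact: manifold_hausdorff.
  apply: continuous_compact => //; apply: continuous_in_subspaceT => y.
  rewrite inE => /DB[q cq <-]; exact: cparam_continuous.
have X0 q : cdom c q -> ~ (cparam c @` D) q -> b (ccoord c q) = 0.
  move=> cq nK; apply: b0; rewrite leNgt; apply/negP => lt.
  apply: nK; exists (ccoord c q); last by rewrite ccoordK.
  by rewrite /D closed_ballE //; exact: ltW.
move=> c1 c2 ac1 ac2; apply: smooth_at_on => x [q [cq1 cq2] <-{x}].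
have [cq|ncq] := pselect (cdom c q).
  have T1 := smooth_at_transition ac1 ac cq1 cq.
  have T2 := smooth_at_transition ac ac2 cq cq2.
  have E1 : local_rep idfun c1 c (ccoord c1 q) = ccoord c q by exact: local_rep_coord.
  have H : smooth_at (fun y => b (local_rep idfun c1 c y) *:
      'D_u (local_rep idfun c c2) (local_rep idfun c1 c y)) (ccoord c1 q).
    apply: smooth_atZ; first exact: (smooth_at_scalar_comp T1).
    apply: (smooth_at_comp (f := 'D_u (local_rep idfun c c2)) T1).
    by rewrite E1; exact: smooth_at_derive.
  apply: smooth_at_near H.
  have N : \forall q' \near q, [/\ cdom c1 q', cdom c q' & cdom c2 q'].
    by apply: filterS3 (near_cdom cq1) (near_cdom cq) (near_cdom cq2).
  apply: filterS2 (near_cparam cq1 N) (near_ccoordK cq1) => y [c1y cy c2y] yE.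
  rewrite /field_in_charts /X asboolT // to_chartZ to_chart_of_chart //.
have nK : ~ (cparam c @` D) q.
  by move=> [y /DB[q' cq' <-]]; rewrite ccoordK // => qq'; rewrite -qq' in ncq.
have N : \forall q' \near q, ~ (cparam c @` D) q'.
  by apply: open_nbhs_nbhs; split => //; exact: closed_openC.
apply: smooth_at_near (smooth_at_cst 0 _).
apply: filterS (near_cparam cq1 N) => y nKy.
rewrite /field_in_charts /X; case: asboolP => [cy|_]; last by rewrite to_chart0.
by rewrite X0 // scale0r to_chart0.
Qed.

End Extension.

(** * Alternating forms as functions of lists *)

Section ListForms.
Context {R : comNzRingType} {T : Type}.
Implicit Types (A B : seq T -> R) (s w : seq T) (x y : T).

Definition antisym k A := forall s1 x y s2, (size s1 + size s2).+2 = k ->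
  A (s1 ++ x :: y :: s2) = - A (s1 ++ y :: x :: s2).

Definition ins j x s := take j s ++ x :: drop j s.

Lemma antisym_cons k A x : antisym k.+1 A -> antisym k (fun s => A (x :: s)).
Proof. by move=> HA s1 y z s2 e; apply: (HA (x :: s1)); rewrite /= addSn e. Qed.

Lemma antisym_ins k A j x s : antisym k A -> (size s).+1 = k -> (j <= size s)%N ->
  A (ins j x s) = (-1) ^+ j * A (x :: s).
Proof.
elim: j k A s => [|j IH] k A s HA sk js; first by rewrite /ins take0 drop0 mul1r.
case: s sk js => [//|y s] sk js; case: k HA sk => [//|k] HA [sk].
rewrite -[ins _ _ _]/(y :: ins j x s).
rewrite (IH k (fun s => A (y :: s))) //; last exact: antisym_cons.
by rewrite (HA [::] y x s) /= ?sk // exprS mulrN mulN1r mulNr.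
Qed.

(** The signed sum of A over the permutations of s, by recursion on the place of
    the first entry.  Lists avoid the dependency of ['I_k -> V] on k, which the
    recursions below change. *)
Fixpoint alt_sum n A s : R :=
  if n is n'.+1 then
    if s is x :: s' then \sum_(j < n) (-1) ^+ j * alt_sum n' (fun w => A (ins j x w)) s'
    else 0
  else A [::].

Definition tensor k A B s := A (take k s) * B (drop k s).

(** The signed sum of A (s1) B (s2) over the ways to deal s into two sublists of
    lengths k and l: the first entry goes to A, or jumps over the k arguments
    of A to go to B. *)
Fixpoint shuffle k l A B s : R :=
  if s is x :: s' then
    (if k is k'.+1 then shuffle k' l (fun w => A (x :: w)) B s' else 0) +
    (-1) ^+ k * (if l is l'.+1 then shuffle k l' A (fun w => B (x :: w)) s' else 0)
  else A [::] * B [::].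

Lemma eq_alt_sum n A B s : size s = n -> (forall w, size w = n -> A w = B w) ->
  alt_sum n A s = alt_sum n B s.
Proof.
elim: n A B s => [|n IH] A B [|x s] //=; first by move=> _; apply.
move=> [sn] AB; apply: eq_bigr => j _; congr (_ * _); apply: IH => // w wn; apply: AB.
by rewrite /ins size_cat /= addnS -size_cat cat_take_drop wn.
Qed.

Lemma alt_sumZ n (c : R) A s : alt_sum n (fun w => c * A w) s = c * alt_sum n A s.
Proof.
elim: n A s => [|n IH] A [|x s] //=; first by rewrite mulr0.
by rewrite mulr_sumr; apply: eq_bigr => j _; rewrite (IH (fun w => _)) mulrCA.
Qed.

(** Every shuffle accounts for k! l! permutations, which is the normalisation
    of the wedge product. *)
Lemma alt_sum_tensor k l A B s : antisym k A -> antisym l B -> size s = (k + l)%N ->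
  alt_sum (k + l) (tensor k A B) s = (k`! * l`!)%:R * shuffle k l A B s.
Proof.
move=> HA HB; suff H n : (k + l)%N = n -> size s = n ->
    alt_sum n (tensor k A B) s = (k`! * l`!)%:R * shuffle k l A B s.
  by move=> ss; exact: H.
elim: n k l A B s HA HB => [|n IH] k l A B s HA HB kln.
  move: kln => /eqP; rewrite addn_eq0 => /andP[/eqP-> /eqP->] /size0nil ->.
  by rewrite /= /tensor fact0 mul1n mul1r.
case: s => [//|x s] /= [sn].
pose L := if k is k'.+1 then shuffle k' l (fun w => A (x :: w)) B s else 0.
pose Q := if l is l'.+1 then shuffle k l' A (fun w => B (x :: w)) s else 0.
rewrite -/L -/Q mulrDr.
have HL (j : 'I_n.+1) : (j < k)%N ->
    (-1) ^+ j * alt_sum n (fun w => tensor k A B (ins j x w)) s =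
    (k.-1`! * l`!)%:R * L.
  move=> jk; rewrite /L; case: k kln HA jk {L Q} => [//|k] [kln] HA jk.
  rewrite (eq_alt_sum (B := fun w => (-1) ^+ j * tensor k (fun w => A (x :: w)) B w)) //.
    rewrite alt_sumZ mulrA -expr2 sqrr_sign mul1r (IH k l) //.
    exact: antisym_cons.
  have jk' : (j <= k)%N by [].
  have kn : (k <= n)%N by rewrite -kln leq_addr.
  move=> w wn; have js : size (take j w) = j.
    by rewrite size_takel // wn -ltnS.
  rewrite /tensor mulrA; congr (_ * B _).
    rewrite -(antisym_ins (j := j) x (s := take k w) HA) ?size_takel ?wn //.
    congr A; rewrite /ins take_cat js ltnNge (leqW jk') /= subSn //=.
    by rewrite take_drop subnK // take_takel.
  by rewrite /ins drop_cat js ltnNge (leqW jk') /= subSn //= drop_drop subnK.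
have HQ (j : 'I_n.+1) : (k <= j)%N ->
    (-1) ^+ j * alt_sum n (fun w => tensor k A B (ins j x w)) s =
    (-1) ^+ k * (k`! * l.-1`!)%:R * Q.
  move=> kj; rewrite /Q; case: l kln HB {L Q HL} => [|l] kln HB.
    by have := leq_trans (ltn_ord j) (eq_leq (esym kln)); rewrite addn0 ltnNge kj.
  have {}kln : (k + l)%N = n by move: kln; rewrite addnS => -[].
  have jkl : (j - k <= l)%N by rewrite leq_subLR kln -ltnS.
  rewrite (eq_alt_sum (B := fun w => (-1) ^+ (j - k) * tensor k A (fun w => B (x :: w)) w)) //.
    rewrite alt_sumZ (IH k l) //; last exact: antisym_cons.
    rewrite !mulrA; congr (_ * _ * _).
    by rewrite -{1}(subnKC kj) exprD -mulrA -expr2 sqrr_sign mulr1.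
  have js w : size w = n -> size (take j w) = j.
    by move=> wn; rewrite size_takel // wn -ltnS.
  move=> w wn; rewrite /tensor mulrCA; congr (A _ * _).
    rewrite /ins take_cat js //; case: ltngtP kj => // [kj _|<- _].
      by rewrite take_takel // ltnW.
    by rewrite subnn take0 cats0.
  rewrite -(antisym_ins (j := j - k) x (s := drop k w) HB); last 2 first.
  - by rewrite size_drop wn -kln addKn.
  - by rewrite size_drop wn leq_sub2r // -ltnS.
  congr B; rewrite /ins drop_drop subnK // take_drop subnK //.
  rewrite drop_cat js //; case: ltngtP kj => // kj _; rewrite kj.
  by rewrite subnn drop0 (@drop_oversize _ j (take j w)) ?js.
rewrite (eq_bigr (fun j : 'I_n.+1 => if (j < k)%N then (k.-1`! * l`!)%:R * L
    else (-1) ^+ k * (k`! * l.-1`!)%:R * Q)); last first.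
  by move=> j _; case: ltnP => [/HL|/HQ].
rewrite -(big_mkord xpredT (fun j => if (j < k)%N then _ else _)).
rewrite (@big_cat_nat _ _ _ k) //=; last by rewrite -kln leq_addr.
congr (_ + _).
  rewrite (eq_big_nat _ _ (F2 := fun=> (k.-1`! * l`!)%:R * L)); last by move=> j /andP[_ ->].
  rewrite sumr_const_nat subn0 -mulr_natl.
  by rewrite /L; case: (k) => [|k']; rewrite ?mulr0 // factS !natrM; ring.
rewrite (eq_big_nat _ _ (F2 := fun=> (-1) ^+ k * (k`! * l.-1`!)%:R * Q)); last first.
  by move=> j /andP[kj _]; rewrite ltnNge kj.
rewrite sumr_const_nat -kln addKn -mulr_natl.
rewrite /Q; case: (l) => [|l']; first by rewrite !mulr0.
by rewrite factS !natrM; ring.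
Qed.

End ListForms.

Section WedgeShuffle.
Context {R : realType} {V : lmodType R}.

Definition lform k (a : ('I_k -> V) -> R) (s : seq V) : R :=
  a (fun i => nth 0 s i).

Definition swap_alternates k (a : ('I_k -> V) -> R) :=
  forall v i j, i != j -> a (fun l => v (tperm i j l)) = - a v.

Lemma dfwithE (I : eqType) (T : Type) (f : I -> T) i x j :
  dfwith f i x j = if j == i then x else f j.
Proof.
have [->|ji] := eqVneq j i; first exact: dfwithin.
by apply: dfwithout; rewrite eq_sym.
Qed.

Lemma alternating_form_swap k (a : ('I_k -> V) -> R) :
  alternating_form a -> swap_alternates a.
Proof.
move=> [al a0] v i j ij.
pose w x y l : V := if l == j then y else if l == i then x else v l.
pose f x y := a (w x y).
have Dr x y z : f x (y + z) = f x y + f x z.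
  have := al (w x 0) j 1 y z; rewrite scale1r mul1r.
  have E y' : dfwith (w x 0) j y' = w x y'.
    by apply/funext => l; rewrite dfwithE /w; case: eqP.
  by rewrite !E.
have Dl x y z : f (x + y) z = f x z + f y z.
  have := al (w 0 z) i 1 x y; rewrite scale1r mul1r.
  have E y' : dfwith (w 0 z) i y' = w y' z.
    apply/funext => l; rewrite dfwithE /w.
    by have [->|] := eqVneq l i; rewrite ?(negPf ij).
  by rewrite !E.
have f0 x : f x x = 0.
  by apply: (a0 _ i j) => //; rewrite /w !eqxx; case: ifP.
have fS x y : f x y = - f y x.
  apply/eqP; rewrite -subr_eq0 opprK; have := f0 (x + y).
  by rewrite Dl !Dr !f0 add0r addr0 => ->.
have -> : a v = f (v i) (v j).
  by congr a; apply/funext => l; rewrite /w; case: eqP => [->|_] //; case: eqP => [->|].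
rewrite -fS; congr a; apply/funext => l; rewrite /w.
have [->|lj] := eqVneq l j; first by rewrite tpermR.
have [->|li] := eqVneq l i; first by rewrite tpermL.
by rewrite tpermD // eq_sym.
Qed.

Lemma wedge_swap k l (a : ('I_k -> V) -> R) (b : ('I_l -> V) -> R) :
  swap_alternates (wedge a b).
Proof.
move=> v i j ij; rewrite /wedge -mulrN -sumrN; congr (_ * _).
rewrite (reindex_inj (mulIg (tperm i j))) /=; apply: eq_bigr => s _.
rewrite odd_permM odd_tperm ij addbT signrN !mulNr; congr (- (_ * a _ * b _));
  by apply/funext => m; rewrite permM tpermK.
Qed.

Lemma lform_antisym k (a : ('I_k -> V) -> R) : swap_alternates a -> antisym k (lform a).
Proof.
move=> sa s1 x y s2 sk; have lt1 : (size s1 < k)%N by rewrite -sk ltnS leqW ?leq_addr.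
have lt2 : ((size s1).+1 < k)%N by rewrite -sk !ltnS leq_addr.
rewrite /lform -(sa _ (Ordinal lt1) (Ordinal lt2)); last by rewrite -val_eqE /= ltn_eqF.
congr a; apply/funext => i; rewrite !nth_cat.
case: tpermP => [->|->|] /=.
- by rewrite !ltnn subnn [(_.+1 < _)%N]ltnNge leqnSn /= subSnn.
- by rewrite !ltnn subnn [(_.+1 < _)%N]ltnNge leqnSn /= subSnn.
move=> /eqP; rewrite -val_eqE /= => i1 /eqP; rewrite -val_eqE /= => i2.
case: ltngtP i1 => // i1 _; case: (nat_of_ord i - size s1)%N (subnK (ltnW i1)) => [|[|m]] // E.
  by move: i1; rewrite -E ltnn.
by move: i2; rewrite -E eqxx.
Qed.

Lemma codom_ins n (v : 'I_n.+1 -> V) (j : 'I_n.+1) (s : 'S_n) :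
  codom (fun i => v (lift_perm j ord0 s i)) =
  ins j (v ord0) (codom (fun i => v (lift ord0 (s i)))).
Proof.
have szw : size (codom (fun i => v (lift ord0 (s i)))) = n by rewrite size_codom card_ord.
have jn : (j <= n)%N by rewrite -ltnS.
have st : size (take j (codom (fun i => v (lift ord0 (s i))))) = j by rewrite size_takel // szw.
have nthC m (w : 'I_m -> V) (i : 'I_m) : nth 0 (codom w) i = w i.
  by rewrite (nth_map i) ?size_enum_ord // nth_ord_enum.
apply: (@eq_from_nth _ 0).
  by rewrite /ins size_cat /= addnS -size_cat cat_take_drop szw size_codom card_ord.
rewrite size_codom card_ord => i i_n; rewrite (nthC _ _ (Ordinal i_n)) nth_cat st.
case: (unliftP j (Ordinal i_n)) => [i'|] E; rewrite E.
  rewrite lift_perm_lift; have /= -> := congr1 val E; rewrite /bump.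
  case: (leqP j i') => [ji|ij] /=.
    rewrite ?add1n ltnNge leqW //= subSn //= nth_drop subnKC //.
    by rewrite nthC.
  by rewrite ?add0n ij nth_take // nthC.
by rewrite lift_perm_id; have /= -> := congr1 val E; rewrite ltnn subnn.
Qed.

(** A permutation of n+1 letters amounts to the place of the first one and a
    permutation of the others ([lift_perm]). *)
Lemma sum_perm_alt_sum n (A : seq V -> R) (v : 'I_n -> V) :
  \sum_(s : 'S_n) (-1) ^+ odd_perm s * A (codom (fun i => v (s i))) =
  alt_sum n A (codom v).
Proof.
elim: n A v => [|n IH] A v.
  rewrite (big_pred1 1%g) => [|s]; last by apply/esym/eqP/permP => -[].
  by rewrite odd_perm1 mul1r /=; congr A; apply/size0nil; rewrite size_codom card_ord.
have inj : injective (fun p : 'I_n.+1 * 'S_n => lift_perm p.1 ord0 p.2).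
  move=> [j s] [j' s'] /= E.
  have jj' : j = j'.
    apply: (@perm_inj _ (lift_perm j ord0 s)); rewrite lift_perm_id E lift_perm_id //.
  move: E; rewrite -jj' => E; congr pair; apply/permP => i.
  by have := congr1 (fun t : 'S_n.+1 => t (lift j i)) E; rewrite !lift_perm_lift => /lift_inj.
have bij : bijective (fun p : 'I_n.+1 * 'S_n => lift_perm p.1 ord0 p.2).
  by apply: inj_card_bij => //; rewrite card_prod !card_Sn card_ord factS.
rewrite (reindex _ (onW_bij _ bij)) /=.
rewrite -(pair_bigA _ (fun j s => (-1) ^+ odd_perm (lift_perm j ord0 s) *
   A (codom (fun i => v (lift_perm j ord0 s i))))) /=.
have -> : codom v = v ord0 :: codom (fun i => v (lift ord0 i)).
  by rewrite /codom /image_mem enum_ordSl /= -map_comp.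
rewrite /=; apply: eq_bigr => j _.
rewrite -(IH (fun w => A (ins j (v ord0) w))) mulr_sumr; apply: eq_bigr => s _.
by rewrite codom_ins odd_lift_perm addbF signr_addb signr_odd mulrA.
Qed.

(** This replaces the (k + l)! terms of the wedge product by a number of terms
    small enough for a computation by cases. *)
Lemma wedge_shuffle k l (a : ('I_k -> V) -> R) (b : ('I_l -> V) -> R) v :
  swap_alternates a -> swap_alternates b ->
  wedge a b v = shuffle k l (lform a) (lform b) (codom v).
Proof.
move=> sa sb; rewrite /wedge.
have nthC m (w : 'I_m -> V) (i : 'I_m) : nth 0 (codom w) i = w i.
  by rewrite (nth_map i) ?size_enum_ord // nth_ord_enum.
rewrite (eq_bigr (fun s : 'S_(k + l) => (-1) ^+ odd_perm s *
    tensor k (lform a) (lform b) (codom (fun i => v (s i))))); last first.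
  move=> s _; rewrite -mulrA; congr (_ * _); congr (a _ * b _); apply/funext => i.
    by rewrite nth_take //; have := nthC _ (fun i => v (s i)) (lshift l i).
  by rewrite nth_drop; have := nthC _ (fun i => v (s i)) (rshift k i).
rewrite sum_perm_alt_sum alt_sum_tensor ?size_codom ?card_ord //; try exact: lform_antisym.
by rewrite mulKf // pnatr_eq0 muln_eq0 negb_or -!lt0n !fact_gt0.
Qed.

End WedgeShuffle.

(** * Components of the model form *)

Section G2Tables.

(** Components take the values 0, 1 and -1 only, tabulated as 0, 1 and 2. *)
Definition int_code (z : int) : nat := match z with Posz n => n | Negz _ => 2 end.
Definition code_int (n : nat) : int := match n with 0%N => 0 | 1%N => 1 | _ => -1 end.

Definition forall7 (P : nat -> bool) := all P (iota 0 7).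

Lemma forall7P (P : nat -> bool) : reflect (forall a, (a < 7)%N -> P a) (forall7 P).
Proof.
apply: (iffP allP) => H a; first by move=> a7; apply: H; rewrite mem_iota.
by rewrite mem_iota; apply: H.
Qed.

Definition det3 (i j k a b c : nat) : int :=
  let d (x y : nat) : int := (x == y)%:R in
  d a i * d b j * d c k - d a i * d c j * d b k
  - d b i * d a j * d c k + d c i * d a j * d b k
  + d b i * d c j * d a k - d c i * d b j * d a k.

(** [phi0] with coordinates numbered from 0. *)
Definition phi_coef (a b c : nat) : int :=
  det3 0 1 2 a b c - det3 0 5 6 a b c - det3 4 1 6 a b c - det3 4 5 2 a b c
  + det3 3 0 4 a b c + det3 3 1 5 a b c + det3 3 2 6 a b c.

Definition phi_rows : seq (seq (seq nat)) := Eval vm_compute in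
  [seq [seq [seq int_code (phi_coef a b c)
     | c <- iota 0 7] | b <- iota 0 7] | a <- iota 0 7].

Definition phi_tab (a b c : nat) : int :=
  code_int (nth 0%N (nth [::] (nth [::] phi_rows a) b) c).

Lemma phi_tab_check : forall7 (fun a => forall7 (fun b => forall7 (fun c =>
  phi_tab a b c == phi_coef a b c))).
Proof. by vm_compute. Qed.

Lemma phi_tabE a b c : (a < 7)%N -> (b < 7)%N -> (c < 7)%N -> phi_tab a b c = phi_coef a b c.
Proof.
have := phi_tab_check => /forall7P H /H /forall7P{}H /H /forall7P{}H /H.
by move=> /eqP.
Qed.

Definition phi_list (s : seq nat) : int := phi_tab (nth 0 s 0) (nth 0 s 1) (nth 0 s 2).

(** The component of (e_a _| phi) /\ (e_b _| phi) /\ phi, from which the metric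
    is defined. *)
Definition metric_coef (a b : nat) : int :=
  shuffle 4 3 (shuffle 2 2 (fun s => phi_list (a :: s)) (fun s => phi_list (b :: s)))
    phi_list (iota 0 7).

Lemma metric_coef_check : forall7 (fun a => forall7 (fun b =>
  metric_coef a b == 6 *+ (a == b))).
Proof. by vm_compute. Qed.

Lemma metric_coefE a b : (a < 7)%N -> (b < 7)%N -> metric_coef a b = 6 *+ (a == b).
Proof.
have := metric_coef_check => /forall7P H /H /forall7P{}H /H.
by move=> /eqP.
Qed.

(** The components of phi (a, b, c x d) - g (a, c) g (b, d) + g (a, d) g (b, c). *)
Definition psi_sum (a b c d : nat) : int :=
  foldr (fun k s => phi_tab a b k * phi_tab c d k + s) 0 (iota 0 7)
  - (a == c)%:R * (b == d)%:R + (a == d)%:R * (b == c)%:R.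

Definition psi_rows : seq (seq (seq (seq nat))) := Eval vm_compute in
  [seq [seq [seq [seq int_code (psi_sum a b c d)
     | d <- iota 0 7] | c <- iota 0 7] | b <- iota 0 7] | a <- iota 0 7].

Definition psi_tab (a b c d : nat) : int :=
  code_int (nth 0%N (nth [::] (nth [::] (nth [::] psi_rows a) b) c) d).

Lemma psi_tab_check : forall7 (fun a => forall7 (fun b => forall7 (fun c => forall7 (fun d =>
  [&& psi_tab a b c d == psi_sum a b c d, psi_tab a b c d == - psi_tab b a c d,
      psi_tab a b c d == - psi_tab a c b d & psi_tab a b c d == - psi_tab a b d c])))).
Proof. by vm_compute. Qed.

Lemma psi_tabE a b c d : (a < 7)%N -> (b < 7)%N -> (c < 7)%N -> (d < 7)%N ->
  [/\ psi_tab a b c d = psi_sum a b c d, psi_tab a b c d = - psi_tab b a c d,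
      psi_tab a b c d = - psi_tab a c b d & psi_tab a b c d = - psi_tab a b d c].
Proof.
have := psi_tab_check => /forall7P H /H /forall7P{}H /H /forall7P{}H /H /forall7P{}H /H.
by move=> /and4P[/eqP-> /eqP-> /eqP-> /eqP->].
Qed.

End G2Tables.

Section LinearMaps.
Context {R : realType} {V W : lmodType R}.

Definition lin (l : V -> W) := forall c a b, l (c *: a + b) = c *: l a + l b.

Variable l : V -> W.
Hypothesis ll : lin l.

Lemma lin_0 : l 0 = 0.
Proof. by have := ll (-1) 0 0; rewrite scaler0 addr0 scaleN1r addNr. Qed.

Lemma lin_D u v : l (u + v) = l u + l v.
Proof. by have := ll 1 u v; rewrite !scale1r. Qed.

Lemma lin_Z c u : l (c *: u) = c *: l u.
Proof. by have := ll c u 0; rewrite lin_0 !addr0. Qed.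

Lemma lin_N u : l (- u) = - l u.
Proof. by rewrite -scaleN1r lin_Z scaleN1r. Qed.

End LinearMaps.

Section VectorLists.
Context {R : realType} {V : lmodType R}.

Definition vec3 (a b c : V) : 'I_3 -> V := fcons a (fcons b (fun=> c)).
Definition vec4 (a b c d : V) : 'I_4 -> V := fcons a (vec3 b c d).
Definition vec5 (a b c d e : V) : 'I_5 -> V := fcons a (vec4 b c d e).

Lemma fcons0 k (u : V) (v : 'I_k -> V) : fcons u v ord0 = u.
Proof. by rewrite /fcons unlift_none. Qed.

Lemma fconsS k (u : V) (v : 'I_k -> V) i : fcons u v (lift ord0 i) = v i.
Proof. by rewrite /fcons liftK. Qed.

Lemma fcons_lift0 k (u : V) (v : 'I_k -> V) : (fun j => fcons u v (lift ord0 j)) = v.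
Proof. by apply/funext => j; rewrite fconsS. Qed.

Lemma fcons_liftS k (u : V) (v : 'I_k.+1 -> V) i :
  (fun j => fcons u v (lift (lift ord0 i) j)) = fcons u (fun j => v (lift i j)).
Proof.
apply/funext => j; case: (unliftP ord0 j) => [j'|] ->; last first.
  rewrite fcons0 (_ : lift (lift ord0 i) ord0 = ord0) ?fcons0 //.
  by apply: val_inj.
rewrite fconsS (_ : lift (lift ord0 i) (lift ord0 j') = lift ord0 (lift i j')) ?fconsS //.
by apply: val_inj; rewrite /= /bump /= !add1n ltnS addnS.
Qed.

Lemma fcons_eta k (v : 'I_k.+1 -> V) : v = fcons (v ord0) (fun j => v (lift ord0 j)).
Proof.
apply/funext => i; case: (unliftP ord0 i) => [j|] ->; first by rewrite fconsS.
by rewrite fcons0.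
Qed.

Lemma fcons_alternating k (a : ('I_k.+1 -> V) -> R) u : alternating_form a ->
  alternating_form (fun v => a (fcons u v)).
Proof.
move=> [al a0]; split=> [v i c x y|v i j ij vij].
  have E z : fcons u (dfwith v i z) = dfwith (fcons u v) (lift ord0 i) z.
    apply/funext => l; rewrite dfwithE; case: (unliftP ord0 l) => [l'|] ->.
      by rewrite !fconsS dfwithE (inj_eq lift_inj).
    by rewrite !fcons0 (negPf (neq_lift _ _)).
  by rewrite !E al.
apply: (a0 _ (lift ord0 i) (lift ord0 j)); first by rewrite (inj_eq lift_inj).
by rewrite !fconsS.
Qed.

Lemma fcons_linear k (a : ('I_k.+1 -> V) -> R) v : alternating_form a ->
  forall c x y, a (fcons (c *: x + y) v) = c * a (fcons x v) + a (fcons y v).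
Proof.
move=> [al _] c x y.
have E z : fcons z v = dfwith (fcons 0 v) ord0 z.
  apply/funext => l; rewrite dfwithE; case: (unliftP ord0 l) => [l'|] ->.
    by rewrite !fconsS eq_sym (negPf (neq_lift _ _)).
  by rewrite fcons0 eqxx.
by rewrite (E (c *: x + y)) (E x) (E y) al.
Qed.

Lemma fcons_swap k (a : ('I_k.+2 -> V) -> R) v x y : alternating_form a ->
  a (fcons x (fcons y v)) = - a (fcons y (fcons x v)).
Proof.
move=> aa; pose f x y := a (fcons x (fcons y v)).
have Dr z z1 z2 : f z (z1 + z2) = f z z1 + f z z2.
  have := fcons_linear v (fcons_alternating z aa) 1 z1 z2.
  by rewrite scale1r mul1r.
have Dl z z1 z2 : f (z1 + z2) z = f z1 z + f z2 z.
  by have := fcons_linear (fcons z v) aa 1 z1 z2; rewrite scale1r mul1r.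
have f0 z : f z z = 0.
  by apply: (aa.2 _ ord0 (lift ord0 ord0)); rewrite ?neq_lift // fconsS !fcons0.
apply/eqP; rewrite -subr_eq0 opprK; apply/eqP; have := f0 (x + y).
by rewrite Dl !Dr !f0 add0r addr0.
Qed.

End VectorLists.

(** * The model form on the standard basis *)

Section ModelTable.
Context {R : realType}.
Local Notation V := 'rV[R]_7.

Lemma codom_fcons k (u : V) (v : 'I_k -> V) : codom (fcons u v) = u :: codom v.
Proof.
rewrite /codom /image_mem enum_ordSl /= fcons0 -map_comp; congr cons.
by apply: eq_map => i /=; rewrite fconsS.
Qed.

Lemma codom_vec1 (u : V) : codom (fun _ : 'I_1 => u) = [:: u].
Proof. by rewrite /codom /image_mem enum_ordSl /= enum_ord0. Qed.

Lemma codom_vec3 (a b c : V) : codom (vec3 a b c) = [:: a; b; c].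
Proof. by rewrite !codom_fcons codom_vec1. Qed.

Lemma codom_nth k (s : seq V) : size s = k -> codom (fun i : 'I_k => nth 0 s i) = s.
Proof.
move=> sk; apply: (@eq_from_nth _ 0); first by rewrite size_codom card_ord.
rewrite size_codom card_ord => i ik; rewrite (nth_map (Ordinal ik)) ?size_enum_ord //.
by rewrite nth_enum_ord.
Qed.

Lemma dx_swap i : swap_alternates (@dx R i).
Proof. by move=> v a b; rewrite !ord1 eqxx. Qed.

Lemma dx3E i j k (a b c : V) : dx3 i j k (vec3 a b c) =
  let d (x : V) y : R := x ord0 (inord y.-1) in
  d a i * d b j * d c k - d a i * d c j * d b k
  - d b i * d a j * d c k + d c i * d a j * d b k
  + d b i * d c j * d a k - d c i * d b j * d a k.
Proof.
rewrite /dx3 wedge_shuffle; [|exact: wedge_swap|exact: dx_swap].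
rewrite codom_vec3.
have W (x y : V) : lform (wedge (dx i) (dx j)) [:: x; y] =
    x ord0 (inord i.-1) * y ord0 (inord j.-1) - y ord0 (inord i.-1) * x ord0 (inord j.-1).
  rewrite /lform wedge_shuffle; [|exact: dx_swap|exact: dx_swap].
  by rewrite codom_nth //= /lform /dx /=; ring.
by rewrite /= !W /lform /dx /=; ring.
Qed.

Definition std (a : nat) : V := stdb (inord a).

Lemma std_coord a i : (a < 7)%N -> (i < 7)%N -> std a ord0 (inord i) = (a == i)%:R.
Proof.
move=> a7 i7; rewrite /std /stdb mxE eqxx /= eq_sym; congr (nat_of_bool _)%:R.
by rewrite -val_eqE /= !inordK.
Qed.

Lemma phi0_std a b c : (a < 7)%N -> (b < 7)%N -> (c < 7)%N ->
  phi0 (vec3 (std a) (std b) (std c)) = (phi_tab a b c)%:~R.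
Proof.
move=> a7 b7 c7; rewrite phi_tabE //.
have E i j k : (i.-1 < 7)%N -> (j.-1 < 7)%N -> (k.-1 < 7)%N ->
    dx3 i j k (vec3 (std a) (std b) (std c)) = (det3 i.-1 j.-1 k.-1 a b c)%:~R.
  move=> i7 j7 k7; rewrite dx3E /= !std_coord // /det3.
  by rewrite !(rmorphB, rmorphD, rmorphM, rmorph_nat).
have E' i j k : [&& i < 7, j < 7 & k < 7]%N ->
    (det3 i j k a b c)%:~R = dx3 i.+1 j.+1 k.+1 (vec3 (std a) (std b) (std c)).
  by move=> /and3P[i7 j7 k7]; rewrite E.
rewrite /phi0 /phi_coef; move: (det3) E' => D E'.
rewrite rmorphD rmorphD rmorphD rmorphB rmorphB rmorphB.
by rewrite -!E'.
Qed.

End ModelTable.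

Section ShuffleMorphism.
Context {R : realType} {V : Type}.

(** Components of a wedge product in a frame f are computed from those of its
    factors. *)
Lemma shuffle_intr (f : nat -> V) k l (A B : seq V -> R) (A' B' : seq nat -> int) s :
  size s = (k + l)%N -> all (fun a => a < 7)%N s ->
  (forall t, size t = k -> all (fun a => a < 7)%N t -> A (map f t) = (A' t)%:~R) ->
  (forall t, size t = l -> all (fun a => a < 7)%N t -> B (map f t) = (B' t)%:~R) ->
  shuffle k l A B (map f s) = (shuffle k l A' B' s)%:~R.
Proof.
elim: s k l A B A' B' => [|a s IH] k l A B A' B'.
  move=> /esym/eqP; rewrite addn_eq0 => /andP[/eqP-> /eqP->] _ HA HB.
  by rewrite /= intrM -(HA [::]) // -(HB [::]).
move=> /= sk /andP[a7 s7] HA HB; rewrite intrD intrM rmorphXn rmorphN1; congr (_ + _ * _).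
  case: k sk HA => [//|k] [sk] HA; apply: IH => // t tk t7.
  by rewrite -(HA (a :: t)) //= ?tk // a7.
case: l sk HB => [//|l] sk HB; apply: IH => //.
  by move: sk; rewrite addnS => -[].
by move=> t tk t7; rewrite -(HB (a :: t)) //= ?tk // a7.
Qed.

End ShuffleMorphism.

(** * The metric of a G2 structure at a point *)

Section PointwiseMetric.
Context {R : realType}.
Local Notation V := 'rV[R]_7.
Implicit Types (f : nat -> V).

Definition orthonormal7 (g : V -> V -> R) f := forall a b, (a < 7)%N -> (b < 7)%N ->
  g (f a) (f b) = (a == b)%:R.

Definition G2_components (phi : V -> V -> V -> R) f :=
  forall a b c, (a < 7)%N -> (b < 7)%N -> (c < 7)%N ->
  phi (f a) (f b) (f c) = (phi_tab a b c)%:~R.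

Lemma fcons_form0 k (a : ('I_k.+1 -> V) -> R) v : alternating_form a ->
  a (fcons 0 v) = 0.
Proof.
move=> aa; have := fcons_linear v aa 1 0 0; rewrite scale1r addr0 mul1r; lra.
Qed.

Lemma alternating_form_scale k (a : ('I_k -> V) -> R) m v : alternating_form a ->
  a (fun i => m *: v i) = m ^+ k * a v.
Proof.
elim: k a v => [|k IH] a v aa.
  by rewrite expr0 mul1r; congr a; apply/funext => -[].
rewrite (fcons_eta v) (fcons_eta (fun i => m *: _)) fcons0.
under [X in fcons _ X]funext do rewrite fconsS.
rewrite -[m *: _]addr0 fcons_linear // fcons_form0 // addr0.
rewrite (IH (fun w => a (fcons (v ord0) w))) ?exprS ?mulrA //.
exact: fcons_alternating.
Qed.

Lemma lform_vec3 (a : ('I_3 -> V) -> R) x y z : lform a [:: x; y; z] = a (vec3 x y z).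
Proof.
congr a; apply/funext => i; rewrite /vec3.
case: (unliftP ord0 i) => [j|] -> /=; last by rewrite fcons0.
rewrite fconsS; case: (unliftP ord0 j) => [l|] -> /=; last by rewrite fcons0.
by rewrite fconsS ord1.
Qed.

Lemma lform_contraction k (u : V) (a : ('I_k.+1 -> V) -> R) (s : seq V) :
  lform (Defs.contraction u a) s = lform a (u :: s).
Proof.
congr a; apply/funext => i.
by case: (unliftP ord0 i) => [j|] -> /=; rewrite ?fcons0 ?fconsS.
Qed.

(** The frame is the inverse image of the standard basis.  The formula for the
    metric makes it orthogonal, with vectors of a common square length L such
    that L vol (f) = -1.  For m = L^(-1/2) the frame m f is orthonormal, so that
    |m^7 vol (f)| = 1; as vol (f) = - m^2 this reads m^9 = 1. *)
Lemma G2_metric_pointwise (phi : ('I_3 -> V) -> R) (vol : ('I_7 -> V) -> R)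
    (g : V -> V -> R) (rho : {linear V -> V}) :
  alternating_form phi -> alternating_form vol -> inner_product g ->
  bijective rho -> (forall v, phi v = phi0 (fun i => rho (v i))) ->
  (forall e : 'I_7 -> V, Defs.orthonormal g e -> `|vol e| = 1) ->
  (forall u v w, g u v * vol w =
     - 6^-1 * wedge (wedge (Defs.contraction u phi) (Defs.contraction v phi)) phi w) ->
  exists f : nat -> V, [/\ orthonormal7 g f,
    G2_components (fun x y z => phi (vec3 x y z)) f & vol (fun i : 'I_7 => f i) = -1].
Proof.
move=> ap av [gl gs gp] [ri riK rK] phiE volE gE.
pose f a := ri (std a).
have fphi : G2_components (fun x y z => phi (vec3 x y z)) f.
  move=> a b c a7 b7 c7; rewrite phiE -phi0_std //; congr phi0; apply/funext => i; rewrite /vec3.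
  case: (unliftP ord0 i) => [j|] ->; last by rewrite !fcons0 rK.
  rewrite !fconsS; case: (unliftP ord0 j) => [l|] ->; last by rewrite !fcons0 rK.
  by rewrite !fconsS rK.
have sp := alternating_form_swap ap.
have sc u := alternating_form_swap (fcons_alternating u ap).
have lphi (s : seq nat) : size s = 3%N -> all (fun a => a < 7)%N s ->
    lform phi (map f s) = (phi_list s)%:~R.
  case: s => [|a [|b [|c []]]] //= _ /and4P[a7 b7 c7 _].
  by rewrite lform_vec3 fphi.
pose fi (i : 'I_7) := f i.
have fiE : codom fi = map f (iota 0 7).
  by rewrite -val_enum_ord -map_comp.
have W a b : (a < 7)%N -> (b < 7)%N ->
    wedge (wedge (Defs.contraction (f a) phi) (Defs.contraction (f b) phi)) phi fi =
    (metric_coef a b)%:~R.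
  move=> a7 b7; rewrite (@wedge_shuffle _ _ 4 3) //; last exact: (@wedge_swap _ _ 2 2).
  rewrite fiE; apply: shuffle_intr => // s s4 s7.
  rewrite /lform (@wedge_shuffle _ _ 2 2) //; [|exact: sc|exact: sc].
  rewrite codom_nth ?size_map //; apply: shuffle_intr => // t t2 t7.
    by rewrite lform_contraction -(lphi (a :: t)) //= ?t2 // a7.
  by rewrite lform_contraction -(lphi (b :: t)) //= ?t2 // b7.
have gf a b : (a < 7)%N -> (b < 7)%N -> g (f a) (f b) * vol fi = - (a == b)%:R.
  move=> a7 b7; rewrite gE W // metric_coefE //.
  by case: eqP => _; rewrite ?mulr1n ?mulr0n ?mulr0 ?oppr0 //; field.
pose L := g (f 0%N) (f 0%N).
have Lv : L * vol fi = -1 by rewrite gf // eqxx.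
have v0 : vol fi != 0.
  by apply/eqP => v0; move/eqP: Lv; rewrite v0 mulr0 eq_sym oppr_eq0 oner_eq0.
have L0 : 0 < L.
  apply: gp; apply/eqP => f0; move/eqP: Lv; rewrite /L f0.
  have := gl 0 0 0 0; rewrite scale0r addr0 mul0r add0r => _.
  have -> : g 0 0 = 0 by have := gl 1 0 0 0; rewrite scale1r addr0 mul1r; lra.
  by rewrite mul0r eq_sym oppr_eq0 oner_eq0.
have gfL a b : (a < 7)%N -> (b < 7)%N -> g (f a) (f b) = (a == b)%:R * L.
  move=> a7 b7; apply: (mulIf v0); rewrite gf // -mulrA Lv; ring.
pose m := (Num.sqrt L)^-1.
have s0 : 0 < Num.sqrt L by rewrite sqrtr_gt0.
have m0 : 0 < m by rewrite invr_gt0.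
have mL : m ^+ 2 * L = 1.
  rewrite /m exprVn sqr_sqrtr ?(ltW L0) // mulVf //; exact: lt0r_neq0.
have gr c u v w : g w (c *: u + v) = c * g w u + g w v by rewrite gs gl !(gs w).
have g0 w : g w 0 = 0.
  by have := gr 1 0 0 w; rewrite scale1r addr0 mul1r; lra.
have oe : Defs.orthonormal g (fun i => m *: fi i).
  move=> i j; rewrite -[m *: fi i]addr0 -[m *: fi j]addr0 gl gr !(gs 0) !g0 !addr0.
  by rewrite gfL // mulrCA !mulrA -expr2 mulrAC mL mul1r -val_eqE.
have := volE _ oe; rewrite alternating_form_scale // => nv.
have vm : vol fi = - m ^+ 2.
  by apply: (mulfI (lt0r_neq0 L0)); rewrite Lv mulrN mulrC mL.
have m1 : m = 1.
  apply/eqP; rewrite -(@pexpr_eq1 _ _ 9) ?(ltW m0) //; apply/eqP.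
  rewrite -[RHS]nv vm mulrN normrN -exprD ger0_norm //.
  by rewrite exprn_ge0 // ltW.
exists f; split => //; last by rewrite -/fi vm m1 expr1n.
move=> a b a7 b7; rewrite gfL //; move: mL; rewrite m1 expr1n mul1r => ->.
by rewrite mulr1.
Qed.

End PointwiseMetric.

(** * The Hodge star in an orthonormal frame *)

Section Sum7.

(** Contrary to [\sum_(i < 7)], this unfolds by conversion. *)
Definition sum7 (W : nmodType) (F : nat -> W) : W :=
  F 0%N + (F 1%N + (F 2%N + (F 3%N + (F 4%N + (F 5%N + F 6%N))))).

Lemma big7 (W : nmodType) (F : nat -> W) : \sum_(a < 7) F a = sum7 F.
Proof. by rewrite !big_ord_recl big_ord0 addr0. Qed.

Lemma sum7_intr (R : pzRingType) (F : nat -> int) :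
  (sum7 F)%:~R = sum7 (fun a => (F a)%:~R : R).
Proof. by rewrite -!big7 rmorph_sum. Qed.

Lemma eq_sum7 (W : nmodType) (F G : nat -> W) : (forall a, (a < 7)%N -> F a = G a) ->
  sum7 F = sum7 G.
Proof. by move=> FG; rewrite -!big7; apply: eq_bigr => a _; exact: FG. Qed.

End Sum7.

Section Frames.
Context {R : realType}.
Local Notation V := 'rV[R]_7.
Variables (g : V -> V -> R) (f : nat -> V).
Hypotheses (ig : inner_product g) (og : orthonormal7 g f).

Let P : 'M[R]_7 := \matrix_(a < 7) f a.

(** The matrix P of an orthonormal frame satisfies P G P^T = 1. *)
Lemma frame_inverse_gram : P^T *m P *m gram g = 1%:M.
Proof.
rewrite -mulmxA; apply: mulmx1C; apply/matrixP => a b; rewrite mxE.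
transitivity (g (f a) (f b)); last by rewrite og // mxE.
rewrite gram_formE //; rewrite mxE; apply: eq_bigr => i _; congr (_ * _); last by rewrite !mxE.
by rewrite !mxE; apply: eq_bigr => j _; rewrite !mxE.
Qed.

Lemma invmx_gram i j : invmx (gram g) i j = sum7 (fun a => f a ord0 i * f a ord0 j).
Proof.
have -> : invmx (gram g) = P^T *m P.
  by rewrite -[LHS]mul1mx -frame_inverse_gram mulmxK // gram_unit.
by rewrite mxE -big7; apply: eq_bigr => a _; rewrite !mxE.
Qed.

Lemma frame_expand v : v = sum7 (fun a => g v (f a) *: f a).
Proof.
rewrite -[LHS]mulmx1 -(mulmx1C frame_inverse_gram) mulmxA mulmxA mulmx_sum_row -big7.
apply: eq_bigr => a _; congr (_ *: _); last by apply/rowP => i; rewrite !mxE.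
rewrite gram_formE // !mxE; apply: eq_bigr => i _; rewrite !mxE //.
Qed.

Lemma frame_ext (l l' : V -> R) : lin l -> lin l' ->
  (forall a, (a < 7)%N -> l (f a) = l' (f a)) -> l =1 l'.
Proof.
move=> ll ll' E v.
have L (h : V -> R) : lin h -> h v = sum7 (fun a => g v (f a) * h (f a)).
  move=> lh; have hD := lin_D lh; have hZ := lin_Z lh.
  by rewrite {1}(frame_expand v) /sum7 !hD !hZ.
by rewrite !L //; apply: eq_sum7 => a a7; rewrite E.
Qed.

(** Contraction with the inverse metric is summation over an orthonormal frame;
    the Hodge star of a three-form contracts three times. *)
Lemma sum_invmx_gram (l l' : V -> R) : lin l -> lin l' ->
  \sum_i \sum_j invmx (gram g) i j * (l (stdb i) * l' (stdb j)) =
  sum7 (fun a => l (f a) * l' (f a)).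
Proof.
move=> ll ll'; rewrite -big7.
under eq_bigr => i _ do under eq_bigr => j _ do
  rewrite invmx_gram -big7 mulr_suml.
under eq_bigr => i _ do rewrite exchange_big /=.
rewrite exchange_big /=; apply: eq_bigr => a _.
rewrite [in RHS](linear_sum_coord ll) [X in _ = _ * X](linear_sum_coord ll') mulr_suml.
apply: eq_bigr => i _; rewrite mulr_sumr; apply: eq_bigr => j _; ring.
Qed.

Lemma sum_ffun3 (F : {ffun 'I_3 -> 'I_7} -> R) :
  \sum_s F s = \sum_a \sum_b \sum_c F [ffun i => tnth [tuple a; b; c] i].
Proof.
rewrite pair_bigA pair_bigA /=.
rewrite (reindex (fun p : 'I_7 * 'I_7 * 'I_7 => [ffun i => tnth [tuple p.1.1; p.1.2; p.2] i])) //=.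
exists (fun s : {ffun 'I_3 -> 'I_7} => (s (inord 0), s (inord 1), s (inord 2))) => [[[a b] c] _|s _].
  by rewrite !ffunE !(tnth_nth a) !inordK.
apply/ffunP => i; rewrite ffunE (tnth_nth (s i)) /=.
case: i => [[|[|[|//]]] i3] /=; congr (s _); apply: val_inj; rewrite /= inordK //.
Qed.

Lemma codom_inj k (v w : 'I_k -> V) : codom v = codom w -> v = w.
Proof.
move=> E; apply/funext => i.
have nthC (u : 'I_k -> V) : u i = nth 0 (codom u) i.
  by rewrite (nth_map i) ?size_enum_ord // nth_ord_enum.
by rewrite nthC E -nthC.
Qed.

Definition vec7 (a b c : V) (v : 'I_4 -> V) : 'I_7 -> V := fcons a (fcons b (fcons c v)).

Lemma fcat_vec7 (u : 'I_3 -> V) (v : 'I_4 -> V) :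
  fcat u v = vec7 (u (inord 0)) (u (inord 1)) (u (inord 2)) v.
Proof.
apply: codom_inj; rewrite !codom_fcons; apply: (@eq_from_nth _ 0).
  by rewrite /= !size_codom !card_ord.
rewrite size_codom card_ord => i i7.
rewrite (nth_map (Ordinal i7)) ?size_enum_ord // (nth_ord_enum _ (Ordinal i7)) /fcat.
case: splitP => j; rewrite [nat_of_ord _]/= => ->.
  by case: j => [[|[|[|//]]] j3] /=; congr u; apply: val_inj; rewrite /= inordK.
by rewrite /= add0n (nth_map j) ?size_enum_ord // nth_ord_enum.
Qed.

Lemma fcons_lin k (a : ('I_k.+1 -> V) -> R) v : alternating_form a ->
  lin (fun x => a (fcons x v)).
Proof. by move=> aa c x y; rewrite fcons_linear. Qed.

Lemma fcons2_lin k (a : ('I_k.+2 -> V) -> R) u v : alternating_form a ->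
  lin (fun x => a (fcons u (fcons x v))).
Proof.
by move=> aa; apply: (@fcons_lin _ (fun z => a (fcons u z))); exact: fcons_alternating.
Qed.

Lemma fcons3_lin k (a : ('I_k.+3 -> V) -> R) u v w : alternating_form a ->
  lin (fun x => a (fcons u (fcons w (fcons x v)))).
Proof.
move=> aa; apply: (@fcons2_lin _ (fun z => a (fcons u z))).
exact: fcons_alternating.
Qed.

Lemma vec3_lin3 (a : ('I_3 -> V) -> R) u v : alternating_form a ->
  lin (fun x => a (vec3 u v x)).
Proof.
move=> aa.
have E x : vec3 u v x = fcons u (fcons v (fcons x (fun i : 'I_0 => 0))).
  by apply: codom_inj; rewrite !codom_fcons codom_vec1 /codom /image_mem enum_ord0.
by move=> c x y; rewrite !E (fcons3_lin _ _ _ aa).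
Qed.

Lemma hodge_star_frame (phi : ('I_3 -> V) -> R) (vol : ('I_7 -> V) -> R) v :
  alternating_form phi -> alternating_form vol ->
  @hodge_star R 7 3 4 g vol phi v = 6^-1 * sum7 (fun a => sum7 (fun b => sum7 (fun c =>
    phi (vec3 (f a) (f b) (f c)) * vol (vec7 (f a) (f b) (f c) v)))).
Proof.
move=> ap av; rewrite /hodge_star (_ : 3`!%:R = 6) //; congr (_ * _).
pose G i j := invmx (gram g) i j.
pose phi3 x y z := phi (vec3 x y z); pose vol3 x y z := vol (vec7 x y z v).
transitivity (\sum_a \sum_a' G a a' * \sum_b \sum_b' G b b' * \sum_c \sum_c' G c c' *
   (phi3 (stdb a) (stdb b) (stdb c) * vol3 (stdb a') (stdb b') (stdb c'))).
  rewrite sum_ffun3; apply: eq_bigr => a _.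
  transitivity (\sum_b \sum_c \sum_a' \sum_b' \sum_c' G a a' * (G b b' * (G c c' *
     (phi3 (stdb a) (stdb b) (stdb c) * vol3 (stdb a') (stdb b') (stdb c'))))).
    apply: eq_bigr => b _; apply: eq_bigr => c _; rewrite sum_ffun3.
    apply: eq_bigr => a' _; apply: eq_bigr => b' _; apply: eq_bigr => c' _.
    rewrite !big_ord_recl big_ord0 !ffunE /= mulr1 -!mulrA fcat_vec7.
    rewrite /G /phi3 /vol3 !ffunE !(tnth_nth a) /= !inordK //; do 4!congr (_ * _).
    congr phi; apply: codom_inj; rewrite codom_vec3 /codom /image_mem.
    by rewrite !enum_ordSl enum_ord0 /= !ffunE !(tnth_nth a).
  under eq_bigr => b _ do rewrite exchange_big /=.
  rewrite exchange_big /=; apply: eq_bigr => a' _.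
  rewrite mulr_sumr; apply: eq_bigr => b _; rewrite exchange_big /= mulr_sumr.
  apply: eq_bigr => b' _; rewrite !mulr_sumr; apply: eq_bigr => c _.
  by rewrite !mulr_sumr; apply: eq_bigr => c' _.
have l3 x y : lin (phi3 x y) by exact: vec3_lin3.
have l2 x z : lin (fun y => phi3 x y z) by exact: fcons2_lin.
have l1 y z : lin (fun x => phi3 x y z) by exact: fcons_lin.
have k3 x y : lin (vol3 x y) by exact: fcons3_lin.
have k2 x z : lin (fun y => vol3 x y z) by exact: fcons2_lin.
have k1 y z : lin (fun x => vol3 x y z) by exact: fcons_lin.
transitivity (\sum_a \sum_a' G a a' * \sum_b \sum_b' G b b' * sum7 (fun c =>
   phi3 (stdb a) (stdb b) (f c) * vol3 (stdb a') (stdb b') (f c))).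
  apply: eq_bigr => a _; apply: eq_bigr => a' _; congr (_ * _).
  apply: eq_bigr => b _; apply: eq_bigr => b' _; congr (_ * _).
  exact: (sum_invmx_gram (l3 _ _) (k3 _ _)).
transitivity (\sum_a \sum_a' G a a' * sum7 (fun c => sum7 (fun b =>
   phi3 (stdb a) (f b) (f c) * vol3 (stdb a') (f b) (f c)))).
  apply: eq_bigr => a _; apply: eq_bigr => a' _; congr (_ * _).
  transitivity (\sum_(c < 7) \sum_b \sum_b' G b b' *
     (phi3 (stdb a) (stdb b) (f c) * vol3 (stdb a') (stdb b') (f c))).
    rewrite [RHS]exchange_big /=; apply: eq_bigr => b _.
    rewrite [RHS]exchange_big /=; apply: eq_bigr => b' _.
    by rewrite -big7 mulr_sumr.
  rewrite -[RHS]big7; apply: eq_bigr => c _.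
  exact: (sum_invmx_gram (l2 _ _) (k2 _ _)).
transitivity (sum7 (fun c => sum7 (fun b => sum7 (fun a =>
   phi3 (f a) (f b) (f c) * vol3 (f a) (f b) (f c))))).
  transitivity (\sum_(c < 7) \sum_(b < 7) \sum_a \sum_a' G a a' *
     (phi3 (stdb a) (f b) (f c) * vol3 (stdb a') (f b) (f c))).
    under [RHS]eq_bigr => c _ do rewrite exchange_big /=.
    rewrite [RHS]exchange_big /=; apply: eq_bigr => a _.
    under [RHS]eq_bigr => c _ do rewrite exchange_big /=.
    rewrite [RHS]exchange_big /=; apply: eq_bigr => a' _.
    rewrite -big7 mulr_sumr; apply: eq_bigr => c _.
    by rewrite -big7 mulr_sumr.
  rewrite -[RHS]big7; apply: eq_bigr => c _.
  rewrite -[RHS]big7; apply: eq_bigr => b _.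
  exact: (sum_invmx_gram (l1 _ _) (k1 _ _)).
pose F a b c := phi3 (f a) (f b) (f c) * vol3 (f a) (f b) (f c).
have S3 (H : nat -> nat -> nat -> R) : sum7 (fun a => sum7 (fun b => sum7 (fun c => H a b c))) =
    \sum_(a < 7) \sum_(b < 7) \sum_(c < 7) H a b c.
  rewrite -big7; apply: eq_bigr => a _; rewrite -big7; apply: eq_bigr => b _.
  by rewrite -big7.
rewrite (S3 (fun c b a => F a b c)) (S3 F).
under [RHS]eq_bigr => a _ do rewrite exchange_big /=.
rewrite [RHS]exchange_big /=; apply: eq_bigr => c _.
by rewrite [RHS]exchange_big.
Qed.

End Frames.

(** * The four-form psi in a frame *)

Section VolumeOnLists.

(** The sign of s as a permutation of m, ..., m + n - 1, found by moving these
    entries to the front one after another. *)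
Fixpoint perm_sign n m (s : seq nat) : int :=
  if n is n'.+1 then (-1) ^+ index m s * perm_sign n' m.+1 (rem m s) else 1.

Lemma antisym_perm (R : realType) (T : Type) (f : nat -> T) n m (A : seq T -> R) s :
  antisym n A -> perm_eq s (iota m n) ->
  A (map f s) = (perm_sign n m s)%:~R * A (map f (iota m n)).
Proof.
elim: n m A s => [|n IH] m A s aA sm.
  by rewrite (perm_nilP sm) mul1r.
have ms : m \in s by rewrite (perm_mem sm) mem_head.
have sE : s = ins (index m s) m (rem m s).
  rewrite /ins remE.
  have il : (index m s < size s)%N by rewrite index_mem.
  rewrite take_size_cat ?drop_size_cat ?size_takel ?(ltnW il) //.
  by rewrite -{1}(cat_take_drop (index m s) s) (drop_nth 0%N il) nth_index.
have rE : perm_eq (rem m s) (iota m.+1 n).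
  by rewrite -(perm_cons m) -(permPl (perm_to_rem ms)).
have sr : size (rem m s) = n by rewrite (perm_size rE) size_iota.
rewrite {1}sE /ins map_cat /= map_take map_drop.
have -> : take (index m s) (map f (rem m s)) ++ f m :: drop (index m s) (map f (rem m s)) =
   ins (index m s) (f m) (map f (rem m s)) by [].
have is_ : (index m s <= n)%N.
  by rewrite -ltnS -[n.+1](size_iota m) -(perm_size sm) index_mem.
rewrite (antisym_ins _ aA) ?size_map ?sr // (IH m.+1 (fun w => A (f m :: w))) //.
  by rewrite intrM rmorphXn rmorphN1 mulrA.
exact: antisym_cons.
Qed.

Definition vol_list (s : seq nat) : int := if uniq s then perm_sign 7 0 s else 0.

Lemma lform_vol (R : realType) (vol : ('I_7 -> 'rV[R]_7) -> R) (f : nat -> 'rV[R]_7) s :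
  alternating_form vol -> size s = 7%N -> all (fun a => a < 7)%N s ->
  lform vol (map f s) = (vol_list s)%:~R * vol (fun i : 'I_7 => f i).
Proof.
move=> av s7 sl7; rewrite /vol_list; case: ifPn => [us|].
  have [_ se] : (size s = size (iota 0 7)) * (s =i iota 0 7).
    apply: uniq_min_size => //; last by rewrite s7.
    by move=> a /(allP sl7); rewrite mem_iota.
  rewrite (antisym_perm f (A := lform vol) (n := 7) (m := 0)).
  - congr (_ * vol _); apply/funext => i; rewrite (nth_map 0%N) ?size_iota //.
    by rewrite nth_iota.
  - exact/lform_antisym/alternating_form_swap.
  - by apply: uniq_perm => //; exact: iota_uniq.
move=> /(uniqPn 0%N)[i [j [ij js sij]]].
have j7 : (j < 7)%N by rewrite -s7.
have i7 := ltn_trans ij j7.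
rewrite mul0r; apply: (av.2 _ (Ordinal i7) (Ordinal j7)).
  by rewrite -val_eqE /= ltn_eqF.
by rewrite /= !(nth_map 0%N) ?s7 // sij.
Qed.

Definition hodge_sum p q r s : int :=
  sum7 (fun a => sum7 (fun b => sum7 (fun c =>
    if phi_tab a b c == 0 then 0 else phi_tab a b c * vol_list [:: a; b; c; p; q; r; s]))).

(** By skewness in the first two and in the last two indices, the ordered pairs
    suffice. *)
Lemma hodge_check : forall7 (fun p => forall7 (fun q => (p < q)%N ==>
  forall7 (fun r => forall7 (fun s => (r < s)%N ==>
    (hodge_sum p q r s == 6 * psi_tab p q r s))))).
Proof. by vm_compute. Qed.

Lemma hodge_sumE p q r s : (p < 7)%N -> (q < 7)%N -> (r < 7)%N -> (s < 7)%N ->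
  (p < q)%N -> (r < s)%N -> hodge_sum p q r s = 6 * psi_tab p q r s.
Proof.
have := hodge_check => /forall7P H /H /forall7P{}H /H + + + pq; rewrite pq /=.
by move=> /forall7P{}H /H /forall7P{}H /H + rs; rewrite rs /= => /eqP.
Qed.

End VolumeOnLists.

Section HodgeOnFrame.
Context {R : realType}.
Local Notation V := 'rV[R]_7.

Lemma alternating_form_sum7 k (a : nat -> ('I_k -> V) -> R) :
  (forall i, alternating_form (a i)) -> alternating_form (fun v => sum7 (fun i => a i v)).
Proof.
move=> H; split=> [v i c x y|v i j ij vij].
  rewrite -!big7 mulr_sumr -big_split /=; apply: eq_bigr => l _.
  by have [-> _] := H l.
by rewrite -big7 big1 // => l _; have [_ a0] := H l; exact: (a0 _ _ _ ij vij).
Qed.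

Lemma alternating_formZ k (a : ('I_k -> V) -> R) c :
  alternating_form a -> alternating_form (fun v => c * a v).
Proof.
move=> [al a0]; split=> [v i d x y|v i j ij vij]; last by rewrite (a0 _ _ _ ij) ?mulr0.
by rewrite al; ring.
Qed.

Lemma vec4_swapl (a : ('I_4 -> V) -> R) x y z w : alternating_form a ->
  a (vec4 x y z w) = - a (vec4 y x z w).
Proof. exact: fcons_swap. Qed.

Lemma fun1_fcons (u : V) : (fun _ : 'I_1 => u) = fcons u (fun _ : 'I_0 => 0).
Proof. by apply/funext => i; rewrite ord1 fcons0. Qed.

Lemma vec4_swapr (a : ('I_4 -> V) -> R) x y z w : alternating_form a ->
  a (vec4 x y z w) = - a (vec4 x y w z).
Proof.
move=> aa; rewrite /vec4 /vec3 !fun1_fcons.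
apply: (@fcons_swap _ _ _ (fun v => a (fcons x (fcons y v)))).
apply: (@fcons_alternating _ _ _ (fun v => a (fcons x v))).
exact: fcons_alternating.
Qed.

Lemma vec4_swapm (a : ('I_4 -> V) -> R) x y z w : alternating_form a ->
  a (vec4 x y z w) = - a (vec4 x z y w).
Proof.
move=> aa; rewrite /vec4 /vec3.
apply: (@fcons_swap _ _ _ (fun v => a (fcons x v))).
exact: fcons_alternating.
Qed.

Lemma lform_vec7 (a : ('I_7 -> V) -> R) x1 x2 x3 x4 x5 x6 x7 :
  lform a [:: x1; x2; x3; x4; x5; x6; x7] = a (vec7 x1 x2 x3 (vec4 x4 x5 x6 x7)).
Proof.
congr a; apply: codom_inj; rewrite codom_nth //.
by rewrite !codom_fcons codom_vec1.
Qed.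

Variables (g : V -> V -> R) (f : nat -> V).
Hypotheses (ig : inner_product g) (og : orthonormal7 g f).
Variables (phi : ('I_3 -> V) -> R) (vol : ('I_7 -> V) -> R).
Hypotheses (ap : alternating_form phi) (av : alternating_form vol).
Hypothesis phif : G2_components (fun x y z => phi (vec3 x y z)) f.
Hypothesis volf : vol (fun i : 'I_7 => f i) = -1.

Local Notation star := (@hodge_star R 7 3 4 g vol phi).

Lemma hodge_star_alternating : alternating_form star.
Proof.
have -> : star = fun v => 6^-1 * sum7 (fun a => sum7 (fun b => sum7 (fun c =>
    phi (vec3 (f a) (f b) (f c)) * vol (vec7 (f a) (f b) (f c) v)))).
  by apply/funext => v; exact: (hodge_star_frame ig og).
apply: alternating_formZ; do 3!apply: alternating_form_sum7 => ?.
apply: alternating_formZ.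
apply: (@fcons_alternating _ _ _ (fun v => vol (fcons _ (fcons _ v)))).
apply: (@fcons_alternating _ _ _ (fun v => vol (fcons _ v))).
exact: fcons_alternating.
Qed.

(** The sign comes from vol (f) = -1. *)
Lemma hodge_star_on_frame p q r s : (p < 7)%N -> (q < 7)%N -> (r < 7)%N -> (s < 7)%N ->
  star (vec4 (f p) (f q) (f r) (f s)) = - (psi_tab p q r s)%:~R.
Proof.
have main p' q' r' s' : (p' < 7)%N -> (q' < 7)%N -> (r' < 7)%N -> (s' < 7)%N ->
    (p' < q')%N -> (r' < s')%N ->
    star (vec4 (f p') (f q') (f r') (f s')) = - (psi_tab p' q' r' s')%:~R.
  move=> p7 q7 r7 s7 pq rs; rewrite (hodge_star_frame ig og) //.
  rewrite (_ : sum7 _ = - (hodge_sum p' q' r' s')%:~R).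
    by rewrite hodge_sumE // intrM; field.
  rewrite /hodge_sum sum7_intr -!big7 -sumrN; apply: eq_bigr => a _.
  rewrite sum7_intr -!big7 -sumrN; apply: eq_bigr => b _.
  rewrite sum7_intr -!big7 -sumrN; apply: eq_bigr => c _.
  rewrite phif // -lform_vec7.
  have /= -> := @lform_vol _ vol f [:: nat_of_ord a; nat_of_ord b; nat_of_ord c; p'; q'; r'; s'] av erefl.
    rewrite volf; case: eqP => [->|_]; rewrite ?mul0r ?oppr0 // intrM; ring.
  by rewrite !ltn_ord p7 q7 r7 s7.
have sa := hodge_star_alternating.
have D (x : R) : x = - x -> x = 0 by lra.
have tab := psi_tabE.
have DZ (x : int) : x = - x -> x = 0 by move=> /eqP; rewrite -addr_eq0 -mulr2n mulrn_eq0 => /eqP.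
move=> p7 q7 r7 s7; have [T0 T1 T2 T3] := tab _ _ _ _ p7 q7 r7 s7.
have pp r' s' : (r' < 7)%N -> (s' < 7)%N ->
    star (vec4 (f p) (f p) (f r') (f s')) = - (psi_tab p p r' s')%:~R.
  move=> r'7 s'7; have [_ /DZ -> _ _] := tab _ _ _ _ p7 p7 r'7 s'7.
  by rewrite mulr0z oppr0 (D _ (vec4_swapl _ _ _ _ sa)).
case: (ltngtP r s) => rs.
- case: (ltngtP p q) => pq; [exact: main| |by rewrite -pq; exact: pp].
  by rewrite vec4_swapl // main // T1 rmorphN.
- rewrite vec4_swapr // T3 rmorphN; congr (- _).
  case: (ltngtP p q) => pq; [exact: main| |by rewrite -pq; exact: pp].
  have [_ -> _ _] := tab _ _ _ _ p7 q7 s7 r7.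
  by rewrite vec4_swapl // main // rmorphN.
- have [_ _ _ T] := tab _ _ _ _ p7 q7 s7 s7.
  by rewrite rs (DZ _ T) mulr0z oppr0 (D _ (vec4_swapr _ _ _ _ sa)).
Qed.

End HodgeOnFrame.

(** * The intrinsic torsion of a nearly G2 structure *)

Section Act.
Context {R : realType}.

(** The product c x, arranged to reduce to 0, x or - x for the coefficients that
    occur: the sums over the tables become linear expressions with few terms. *)
Definition act (c : int) (x : R) : R :=
  match c with Posz 0 => 0 | Posz 1 => x | Negz 0 => - x | _ => c%:~R * x end.

Lemma actE c x : act c x = c%:~R * x.
Proof. by case: c => [[|[|n]]|[|n]] //=; rewrite ?mul0r ?mul1r ?mulN1r. Qed.

Lemma actN c x : act (- c) x = - act c x.
Proof. by rewrite !actE rmorphN mulNr. Qed.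

End Act.

Ltac eval_act :=
  repeat match goal with |- context [act ?c ?x] =>
    let v := eval vm_compute in c in
    let z := eval cbv [act] in (act v x) in change (act c x) with z
  end.

(** The equations E say that the three-form b is a variation of phi that keeps the
    metric.  Such variations form the orbit of phi under the Lie algebra so(7);
    as g2, of dimension 14 in dimension 21, acts trivially, the orbit has
    dimension 7, and it consists of the contractions of psi with vectors. *)
Section So7.
Context {R : realType}.
Variable b : nat -> nat -> nat -> R.
Hypotheses (A1 : forall i j k, b i j k = - b j i k) (A2 : forall i j k, b i j k = - b i k j).
Hypothesis E : forall i j k, (i < 7)%N -> (j < 7)%N -> (k < 7)%N ->
  sum7 (fun l => act (phi_tab i k l) (b i j l)) +
  sum7 (fun l => act (phi_tab i j l) (b i k l)) = 0.

(** The vector v with b = v _| psi; each entry is read off one component of b,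
    up to the sign of a component of psi. *)
Definition so7_rep (m : nat) : R :=
  match m with
  | 0%N => - b 1 3 6 | 1%N => b 0 3 6 | 2%N => - b 0 3 5 | 3%N => - b 0 1 6
  | 4%N => - b 0 1 5 | 5%N => b 0 1 4 | 6%N => b 0 1 3 | _ => 0
  end.

Let h i j k := sum7 (fun m => act (psi_tab m i j k) (so7_rep m)).

Ltac sort_indices :=
  repeat match goal with
  | |- context [b ?i ?j ?k] =>
    let c := eval vm_compute in (j < i)%N in
    match c with true => rewrite (A1 i j k) end
  | |- context [b ?i ?j ?k] =>
    let c := eval vm_compute in (k < j)%N in
    match c with true => rewrite (A2 i j k) end
  end.

Ltac case_rep := rewrite /h /sum7; eval_act; rewrite /so7_rep; lra.
Ltac case_from e :=
  move: e; rewrite /h /sum7; eval_act; rewrite /so7_rep; sort_indices; lra.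

Lemma so7_sorted i j k : (i < j)%N -> (j < k)%N -> (k < 7)%N -> b i j k = h i j k.
Proof.
move=> ij jk k7; case: k k7 jk => [|[|[|[|[|[|[|//]]]]]]] _;
  case: j ij => [|[|[|[|[|[|//]]]]]]; case: i => [|[|[|[|[|//]]]]] //= _ _.
- case_from (@E 0 1 1 isT isT isT).
- case_rep.
- case_from (@E 0 1 3 isT isT isT).
- case_from (@E 1 0 3 isT isT isT).
- case_rep.
- case_from (@E 0 1 4 isT isT isT).
- case_from (@E 1 0 4 isT isT isT).
- case_from (@E 0 3 3 isT isT isT).
- case_from (@E 3 0 1 isT isT isT).
- case_from (@E 3 0 2 isT isT isT).
- case_rep.
- case_from (@E 0 1 5 isT isT isT).
- case_from (@E 1 0 5 isT isT isT).
- case_rep.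
- case_from (@E 1 3 3 isT isT isT).
- case_from (@E 3 1 2 isT isT isT).
- case_from (@E 0 3 5 isT isT isT).
- case_from (@E 1 3 4 isT isT isT).
- case_from (@E 2 4 4 isT isT isT).
- case_from (@E 3 0 5 isT isT isT).
- case_rep.
- case_from (@E 0 1 6 isT isT isT).
- case_from (@E 1 0 6 isT isT isT).
- case_rep.
- case_rep.
- case_from (@E 2 3 3 isT isT isT).
- case_from (@E 0 3 6 isT isT isT).
- case_from (@E 1 4 4 isT isT isT).
- case_from (@E 6 1 2 isT isT isT).
- case_from (@E 4 0 6 isT isT isT).
- case_from (@E 0 5 5 isT isT isT).
- case_from (@E 5 0 1 isT isT isT).
- case_from (@E 6 0 2 isT isT isT).
- case_from (@E 5 0 3 isT isT isT).
- case_from (@E 6 0 4 isT isT isT).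
Qed.

Lemma so7E i j k : (i < 7)%N -> (j < 7)%N -> (k < 7)%N -> b i j k = h i j k.
Proof.
have D (x : R) : x = - x -> x = 0 by lra.
have S1 i' j' k' : (i' < 7)%N -> (j' < 7)%N -> (k' < 7)%N -> h i' j' k' = - h j' i' k'.
  move=> i7 j7 k7; rewrite /h -!big7 -sumrN; apply: eq_bigr => m _.
  have [_ _ -> _] := psi_tabE (ltn_ord m) i7 j7 k7; exact: actN.
have S2 i' j' k' : (i' < 7)%N -> (j' < 7)%N -> (k' < 7)%N -> h i' j' k' = - h i' k' j'.
  move=> i7 j7 k7; rewrite /h -!big7 -sumrN; apply: eq_bigr => m _.
  have [_ _ _ ->] := psi_tabE (ltn_ord m) i7 j7 k7; exact: actN.
have H1 i' j' k' : (i' < 7)%N -> (j' < 7)%N -> (k' < 7)%N -> (j' < k')%N ->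
    b i' j' k' = h i' j' k'.
  move=> i7 j7 k7 jk; case: (ltngtP i' j') => ij.
  - exact: so7_sorted.
  - rewrite A1 S1 //; congr (- _); case: (ltngtP i' k') => ik; first exact: so7_sorted.
      by rewrite A2 S2 //; congr (- _); exact: so7_sorted.
    by rewrite ik (D _ (A2 j' k' k')) (D _ (S2 _ _ _ j7 k7 k7)).
  by rewrite ij (D _ (A1 j' j' k')) (D _ (S1 _ _ _ j7 j7 k7)).
move=> i7 j7 k7; case: (ltngtP j k) => jk; first exact: H1.
  by rewrite A2 S2 //; congr (- _); exact: H1.
by rewrite jk (D _ (A2 i k k)) (D _ (S2 _ _ _ i7 k7 k7)).
Qed.

End So7.

Section G2Algebra.
Context {R : realType}.
Local Notation V := 'rV[R]_7.
Variables (g : V -> V -> R) (f : nat -> V) (phi : V -> V -> V -> R) (B : V -> V -> V).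
Hypotheses (ig : inner_product g) (og : orthonormal7 g f).
Hypotheses (phi1 : forall b c, lin (fun a => phi a b c : R^o)).
Hypotheses (phi12 : forall a b c, phi a b c = - phi b a c)
           (phi23 : forall a b c, phi a b c = - phi a c b).
Hypothesis phif : G2_components phi f.
Hypothesis BE : forall u v w, g (B u v) w = phi u v w.

Definition psi4 a b c d := phi a b (B c d) - g a c * g b d + g a d * g b c.

Lemma inner_lin1 w : lin (fun a => g a w : R^o).
Proof. by case: ig => gl _ _ c a b; rewrite gl. Qed.

Lemma inner_lin2 w : lin (g w : V -> R^o).
Proof. by case: ig => gl gs _ c a b; rewrite !(gs w) gl. Qed.

Lemma phi2_lin a c : lin (fun b => phi a b c : R^o).
Proof. by move=> k x y; rewrite phi12 phi1 opprD -scalerN -!phi12. Qed.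

Lemma phi3_lin a b : lin (phi a b : V -> R^o).
Proof. by move=> k x y; rewrite phi23 phi2_lin opprD -scalerN -!phi23. Qed.

Lemma B_lin1 v : lin (fun u => B u v).
Proof.
by move=> c x y; apply: (inner_product_inj ig) => w; rewrite inner_lin1 !BE phi1.
Qed.

Lemma B_skew u v : B u v = - B v u.
Proof.
apply: (inner_product_inj ig) => w; rewrite -scaleN1r -[_ *: _]addr0 (inner_lin1 w (-1)) !BE.
rewrite phi12 scaleN1r; have := inner_lin1 w 1 0 0; rewrite !scale1r addr0 => g0.
by rewrite (_ : g 0 w = 0) ?addr0 //; move: g0; lra.
Qed.

Lemma linD (W : lmodType R) (l l' : V -> W) : lin l -> lin l' -> lin (fun x => l x + l' x).
Proof. by move=> ll ll' c x y; rewrite ll ll' scalerDr addrACA. Qed.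

Lemma linN (W : lmodType R) (l : V -> W) : lin l -> lin (fun x => - l x).
Proof. by move=> ll c x y; rewrite ll opprD scalerN. Qed.

Lemma linMl (l : V -> R) (c : R) : lin (l : V -> R^o) -> lin (fun x => c * l x : R^o).
Proof. by move=> ll d x y; rewrite ll mulrDr /GRing.scale /= mulrCA. Qed.

Lemma linMr (l : V -> R) (c : R) : lin (l : V -> R^o) -> lin (fun x => l x * c : R^o).
Proof. by move=> ll d x y; rewrite ll mulrDl /GRing.scale /= mulrA. Qed.

Lemma lin_comp (l : V -> R^o) (h : V -> V) : lin l -> lin h -> lin (fun x => l (h x)).
Proof. by move=> ll lh c x y; rewrite lh ll. Qed.

Lemma B_lin2 u : lin (B u).
Proof. by move=> c x y; rewrite B_skew B_lin1 opprD -scalerN -!B_skew. Qed.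

Definition lin4 (Q : V -> V -> V -> V -> R) :=
  [/\ forall b c d, lin (fun a => Q a b c d : R^o),
      forall a c d, lin (fun b => Q a b c d : R^o),
      forall a b d, lin (fun c => Q a b c d : R^o) &
      forall a b c, lin (fun d => Q a b c d : R^o)].

Lemma frame_ext4 (Q Q' : V -> V -> V -> V -> R) : lin4 Q -> lin4 Q' ->
  (forall a b c d, (a < 7)%N -> (b < 7)%N -> (c < 7)%N -> (d < 7)%N ->
     Q (f a) (f b) (f c) (f d) = Q' (f a) (f b) (f c) (f d)) ->
  forall a b c d, Q a b c d = Q' a b c d.
Proof.
move=> [Q1 Q2 Q3 Q4] [Q1' Q2' Q3' Q4'] E a b c d.
apply: (frame_ext ig og (Q1 b c d) (Q1' b c d)) => i i7.
apply: (frame_ext ig og (Q2 (f i) c d) (Q2' (f i) c d)) => j j7.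
apply: (frame_ext ig og (Q3 (f i) (f j) d) (Q3' (f i) (f j) d)) => k k7.
apply: (frame_ext ig og (Q4 (f i) (f j) (f k)) (Q4' (f i) (f j) (f k))) => l l7.
exact: E.
Qed.

Lemma psi4_lin : lin4 psi4.
Proof.
split=> *; (apply: linD; first apply: linD).
- exact: phi1.
- by apply: linN; apply: linMr; exact: inner_lin1.
- by apply: linMr; exact: inner_lin1.
- exact: phi2_lin.
- by apply: linN; apply: linMl; exact: inner_lin1.
- by apply: linMl; exact: inner_lin1.
- by apply: lin_comp; [exact: phi3_lin|exact: B_lin1].
- by apply: linN; apply: linMr; exact: inner_lin2.
- by apply: linMl; exact: inner_lin2.
- by apply: lin_comp; [exact: phi3_lin|exact: B_lin2].
- by apply: linN; apply: linMl; exact: inner_lin2.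
- by apply: linMr; exact: inner_lin2.
Qed.

Lemma lin_B_frame (l : V -> R) i j : (i < 7)%N -> (j < 7)%N -> lin (l : V -> R^o) ->
  l (B (f i) (f j)) = sum7 (fun k => (phi_tab i j k)%:~R * l (f k)).
Proof.
move=> i7 j7 ll; have hD := lin_D ll; have hZ := lin_Z ll.
rewrite {1}(frame_expand ig og (B (f i) (f j))) /sum7 !hD !hZ -/(sum7 _).
by do ?congr (_ + _); rewrite BE phif.
Qed.

Lemma psi4_frame a b c d : (a < 7)%N -> (b < 7)%N -> (c < 7)%N -> (d < 7)%N ->
  psi4 (f a) (f b) (f c) (f d) = (psi_tab a b c d)%:~R.
Proof.
move=> a7 b7 c7 d7; have [-> _ _ _] := psi_tabE a7 b7 c7 d7.
rewrite /psi4 (lin_B_frame c7 d7 (phi3_lin _ _)) !og //.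
rewrite /psi_sum intrD rmorphB !intrM !rmorph_nat; congr (_ - _ + _).
rewrite /sum7 /= !intrD !intrM mulr0z addr0.
by rewrite !phif // !(mulrC (phi_tab c d _)%:~R).
by rewrite rmorphM !rmorph_nat.
Qed.

(** Skewness fails for general three-forms; it is the identity
    a x (a x b) = g (a, b) a - g (a, a) b of the G2 cross product, and is read
    off the table. *)
Lemma psi4_alternating : [/\ forall a b c d, psi4 a b c d = - psi4 b a c d,
  forall a b c d, psi4 a b c d = - psi4 a c b d &
  forall a b c d, psi4 a b c d = - psi4 a b d c].
Proof.
have [l1 l2 l3 l4] := psi4_lin.
have T := psi_tabE.
split.
- apply: (frame_ext4 (Q' := fun a b c d => - psi4 b a c d) psi4_lin).
    by split=> *; apply: linN.
  move=> i j k l i7 j7 k7 l7.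
  by rewrite !psi4_frame // -rmorphN; have [_ <- _ _] := T _ _ _ _ i7 j7 k7 l7.
- apply: (frame_ext4 (Q' := fun a b c d => - psi4 a c b d) psi4_lin).
    by split=> *; apply: linN.
  move=> i j k l i7 j7 k7 l7.
  by rewrite !psi4_frame // -rmorphN; have [_ _ <- _] := T _ _ _ _ i7 j7 k7 l7.
- apply: (frame_ext4 (Q' := fun a b c d => - psi4 a b d c) psi4_lin).
    by split=> *; apply: linN.
  move=> i j k l i7 j7 k7 l7.
  by rewrite !psi4_frame // -rmorphN; have [_ _ _ <-] := T _ _ _ _ i7 j7 k7 l7.
Qed.

Variables (beta : V -> V -> V -> V -> R) (tau : R).
Hypothesis beta_lin : lin4 beta.
Hypotheses (beta12 : forall u a b c, beta u a b c = - beta u b a c)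
           (beta23 : forall u a b c, beta u a b c = - beta u a c b).
Hypothesis beta_metric : forall u a b c,
  beta u a b (B a c) + beta u a c (B a b) = 0.
Hypothesis beta_dphi : forall a b c d,
  beta a b c d - beta b a c d + beta c a b d - beta d a b c = tau * psi4 a b c d.

Let N u a b c d := beta u a b (B c d) + beta u c d (B a b).

Hypothesis beta_dpsi : forall a b c d e,
  N a b c d e - N b a c d e + N c a b d e - N d a b c e + N e a b c d = 0.

(** The endomorphism T with beta (u; a, b, c) = psi (T u, a, b, c). *)
Let T r m := so7_rep (fun i j k => beta (f r) (f i) (f j) (f k)) m.

Let betaE r i j k : (i < 7)%N -> (j < 7)%N -> (k < 7)%N ->
  beta (f r) (f i) (f j) (f k) = sum7 (fun m => act (psi_tab m i j k) (T r m)).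
Proof.
apply: (so7E (b := fun i j k => beta (f r) (f i) (f j) (f k))) => // i' j' k' i7 j7 k7.
have [_ _ _ l4] := beta_lin.
have := beta_metric (f r) (f i') (f j') (f k').
rewrite !(lin_B_frame _ _ (l4 _ _ _)) // => H; rewrite -[RHS]H.
by congr (_ + _); apply: eq_sum7 => l _; rewrite actE.
Qed.

(** The components of the derivative of psi, given that T is zero except for one
    entry equal to 1 in column m. *)
Definition psi_deriv_tab m j k l n : int :=
  sum7 (fun q => phi_tab l n q * psi_tab m j k q + phi_tab j k q * psi_tab m l n q).

Let NE i j k l n : (j < 7)%N -> (k < 7)%N -> (l < 7)%N -> (n < 7)%N ->
  N (f i) (f j) (f k) (f l) (f n) = sum7 (fun m => act (psi_deriv_tab m j k l n) (T i m)).
Proof.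
move=> j7 k7 l7 n7; have [_ _ _ l4] := beta_lin.
rewrite /N !(lin_B_frame _ _ (l4 _ _ _)) //.
transitivity (\sum_(m < 7) \sum_(q < 7) ((phi_tab l n q)%:~R * ((psi_tab m j k q)%:~R * T i m)
   + (phi_tab j k q)%:~R * ((psi_tab m l n q)%:~R * T i m))).
  rewrite exchange_big /= -!big7 -big_split /=; apply: eq_bigr => q _.
  rewrite !betaE // -!big7 !mulr_sumr -big_split /=; apply: eq_bigr => m _.
  by rewrite !actE.
rewrite -big7; apply: eq_bigr => m _; rewrite actE /psi_deriv_tab sum7_intr -big7 mulr_suml.
by apply: eq_bigr => q _; rewrite intrD !intrM; ring.
Qed.

Let Q i j k l : [&& i < 7, j < 7, k < 7 & l < 7]%N ->
  sum7 (fun m => act (psi_tab m j k l) (T i m)) - sum7 (fun m => act (psi_tab m i k l) (T j m))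
  + sum7 (fun m => act (psi_tab m i j l) (T k m)) - sum7 (fun m => act (psi_tab m i j k) (T l m))
  = act (psi_tab i j k l) tau.
Proof.
by move=> /and4P[i7 j7 k7 l7]; rewrite -!betaE // beta_dphi psi4_frame // actE mulrC.
Qed.

Let P i j k l n : [&& i < 7, j < 7, k < 7, l < 7 & n < 7]%N ->
  sum7 (fun m => act (psi_deriv_tab m j k l n) (T i m))
  - sum7 (fun m => act (psi_deriv_tab m i k l n) (T j m))
  + sum7 (fun m => act (psi_deriv_tab m i j l n) (T k m))
  - sum7 (fun m => act (psi_deriv_tab m i j k n) (T l m))
  + sum7 (fun m => act (psi_deriv_tab m i j k l) (T n m)) = 0.
Proof. by move=> /and5P[i7 j7 k7 l7 n7]; rewrite -!NE. Qed.

Ltac solve_block := by rewrite /sum7; eval_act; do !split; lra.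

(** The equations of d phi and d psi split into small blocks.  For each k there is
    one block for the T i m such that {i, m, k} is a line of the Fano plane
    (that is, the component i m k of phi is nonzero), and one block is left for
    the diagonal. *)
Lemma torsion_scalar i m : (i < 7)%N -> (m < 7)%N -> T i m = (i == m)%:R * (tau / 4).
Proof.
have : T 1 2 = 0 /\ T 2 1 = 0 /\ T 3 4 = 0 /\ T 4 3 = 0 /\ T 5 6 = 0 /\ T 6 5 = 0.
  move: (@Q 0 1 3 5 isT) (@Q 0 1 4 6 isT) (@Q 0 2 3 6 isT) (@Q 0 2 4 5 isT)
    (@P 0 1 2 3 4 isT) (@P 0 1 2 5 6 isT) (@P 0 3 4 5 6 isT).
  solve_block.
have : T 0 2 = 0 /\ T 2 0 = 0 /\ T 3 5 = 0 /\ T 4 6 = 0 /\ T 5 3 = 0 /\ T 6 4 = 0.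
  move: (@Q 0 1 3 4 isT) (@Q 0 1 5 6 isT) (@Q 1 2 3 6 isT) (@Q 1 2 4 5 isT)
    (@P 0 1 2 3 5 isT) (@P 0 1 2 4 6 isT) (@P 1 3 4 5 6 isT).
  solve_block.
have : T 0 1 = 0 /\ T 1 0 = 0 /\ T 3 6 = 0 /\ T 4 5 = 0 /\ T 5 4 = 0 /\ T 6 3 = 0.
  move: (@Q 0 2 3 4 isT) (@Q 0 2 5 6 isT) (@Q 1 2 3 5 isT) (@Q 1 2 4 6 isT)
    (@P 0 1 2 3 6 isT) (@P 0 1 2 4 5 isT) (@P 2 3 4 5 6 isT).
  solve_block.
have : T 0 4 = 0 /\ T 1 5 = 0 /\ T 2 6 = 0 /\ T 4 0 = 0 /\ T 5 1 = 0 /\ T 6 2 = 0.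
  move: (@Q 0 1 2 3 isT) (@Q 0 3 5 6 isT) (@Q 1 3 4 6 isT) (@Q 2 3 4 5 isT)
    (@P 0 1 3 4 5 isT) (@P 0 2 3 4 6 isT) (@P 1 2 3 5 6 isT).
  solve_block.
have : T 0 3 = 0 /\ T 1 6 = 0 /\ T 2 5 = 0 /\ T 3 0 = 0 /\ T 5 2 = 0 /\ T 6 1 = 0.
  move: (@Q 0 1 2 4 isT) (@Q 0 4 5 6 isT) (@Q 1 3 4 5 isT) (@Q 2 3 4 6 isT)
    (@P 0 1 3 4 6 isT) (@P 0 2 3 4 5 isT) (@P 1 2 4 5 6 isT).
  solve_block.
have : T 0 6 = 0 /\ T 1 3 = 0 /\ T 2 4 = 0 /\ T 3 1 = 0 /\ T 4 2 = 0 /\ T 6 0 = 0.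
  move: (@Q 0 1 2 5 isT) (@Q 0 3 4 5 isT) (@Q 1 4 5 6 isT) (@Q 2 3 5 6 isT)
    (@P 0 1 3 5 6 isT) (@P 0 2 4 5 6 isT) (@P 1 2 3 4 5 isT).
  solve_block.
have : T 0 5 = 0 /\ T 1 4 = 0 /\ T 2 3 = 0 /\ T 3 2 = 0 /\ T 4 1 = 0 /\ T 5 0 = 0.
  move: (@Q 0 1 2 6 isT) (@Q 0 3 4 6 isT) (@Q 1 3 5 6 isT) (@Q 2 4 5 6 isT)
    (@P 0 1 4 5 6 isT) (@P 0 2 3 5 6 isT) (@P 1 2 3 4 6 isT).
  solve_block.
have : T 0 0 = tau / 4 /\ T 1 1 = tau / 4 /\ T 2 2 = tau / 4 /\ T 3 3 = tau / 4 /\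
    T 4 4 = tau / 4 /\ T 5 5 = tau / 4 /\ T 6 6 = tau / 4.
  move: (@Q 0 1 3 6 isT) (@Q 0 1 4 5 isT) (@Q 0 2 3 5 isT) (@Q 0 2 4 6 isT)
    (@Q 1 2 3 4 isT) (@Q 1 2 5 6 isT) (@Q 3 4 5 6 isT).
  solve_block.
move=> [d0 [d1 [d2 [d3 [d4 [d5 d6]]]]]].
do 7!move=> [? [? [? [? [? ?]]]]].
by case: i => [|[|[|[|[|[|[|//]]]]]]] _; case: m => [|[|[|[|[|[|[|//]]]]]]] _;
  rewrite [_ == _]/= ?mul0r ?mul1r; assumption.
Qed.

(** As T = tau / 4, the tensor beta is tau / 4 times psi. *)
Lemma nearly_G2_skew_torsion u w z : beta u u w z = 0.
Proof.
have [l1 l2 l3 l4] := psi4_lin.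
have [s1 _ _] := psi4_alternating.
have -> : beta u u w z = tau / 4 * psi4 u u w z.
  apply: (frame_ext4 (Q' := fun a b c d => tau / 4 * psi4 a b c d) beta_lin).
    by split=> *; apply: linMl.
  move=> a b c d a7 b7 c7 d7.
  rewrite betaE // psi4_frame // -big7 (bigD1 (Ordinal a7)) // big1 => [|m ma].
    transitivity (act (psi_tab a b c d) (T a a) + 0); first by [].
    by rewrite addr0 torsion_scalar // eqxx mul1r actE mulrC.
  rewrite torsion_scalar //.
  have -> : (a == m) = false by apply/negP => /eqP am; case/eqP: ma; apply: val_inj.
  by rewrite mul0r actE mulr0.
have := s1 u u w z; move: (psi4 _ _ _ _) => x xx.
have -> : x = 0 by lra.
by rewrite mulr0.
Qed.

End G2Algebra.

(** * Linear maps with differentiable coefficients *)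

Section Sharp.
Context {R : realType} {n : nat}.
Local Notation V := 'rV[R]_n.

Lemma lin_scalar (l : V -> R) : lin (l : V -> R^o) ->
  forall c a b, l (c *: a + b) = c * l a + l b.
Proof. by []. Qed.

Lemma sharpE (g : V -> V -> R) (l : V -> R) : inner_product g -> lin (l : V -> R^o) ->
  forall w, g (sharp g l) w = l w.
Proof.
move=> ig ll w; rewrite gram_formE // /sharp mulmxKV ?gram_unit //.
rewrite (linear_sum_coord ll) mxE; apply: eq_bigr => i _; rewrite !mxE mulrC //.
Qed.

End Sharp.

Section LinearDerivatives.
Context {R : realType} {m n : nat}.
Local Notation V := 'rV[R]_n.

Lemma lin_derive (F : 'rV[R]_m -> V -> R) (y u : 'rV[R]_m) :
  (\forall z \near y, lin (F z : V -> R^o)) -> (forall a, differentiable (fun z => F z a) y) ->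
  lin (fun a => 'D_u (fun z => F z a) y : R^o).
Proof.
move=> lF dF c a b.
rewrite (near_eq_derive (g := (c *: (fun z => F z a : R^o)) + (fun z => F z b : R^o))).
  rewrite deriveD; [|apply: derivableZ; exact: diff_derivable|exact: diff_derivable].
  by rewrite deriveZ //; exact: diff_derivable.
by apply: filterS lF => z lz; rewrite lz.
Qed.

Lemma lin_derive_dir (F : 'rV[R]_m -> R) (y : 'rV[R]_m) : differentiable F y ->
  lin (fun u => 'D_u F y : R^o).
Proof. by move=> dF c u v; rewrite deriveDr // deriveZr. Qed.

Lemma derive_near_opp (F G : 'rV[R]_m -> R) (y u : 'rV[R]_m) : differentiable G y ->
  (\forall z \near y, F z = - G z) -> 'D_u F y = - 'D_u G y.
Proof.
move=> dG FG; rewrite (near_eq_derive u FG).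
by rewrite (deriveN (f := G)) //; exact: diff_derivable.
Qed.

End LinearDerivatives.

(** * The Levi-Civita connection of a metric in a chart *)

Section LocalMetric.
Context {R : realType} {n : nat}.
Local Notation V := 'rV[R]_n.
Variables (G : V -> V -> V -> R) (y : V).
Hypotheses (iG : \forall z \near y, inner_product (G z))
           (dG : forall u v, differentiable (fun z => G z u v) y).

Definition gamma (u v : V) : V := sharp (G y) (fun w => 2^-1 *
  ('D_u (fun z => G z v w) y + 'D_v (fun z => G z u w) y - 'D_w (fun z => G z u v) y)).

Let G1 w : \forall z \near y, lin (fun a => G z a w : R^o).
Proof. by apply: filterS iG => z [gl _ _] c a b; rewrite gl. Qed.

Let G2 w : \forall z \near y, lin (fun a => G z w a : R^o).
Proof. by apply: filterS iG => z [gl gs _] c a b; rewrite !(gs w) gl. Qed.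

Lemma derive_metric_sym u v w : 'D_u (fun z => G z v w) y = 'D_u (fun z => G z w v) y.
Proof. by apply: near_eq_derive; apply: filterS iG => z [_ gs _]. Qed.

Lemma gammaE u v w : G y (gamma u v) w = 2^-1 *
  ('D_u (fun z => G z v w) y + 'D_v (fun z => G z u w) y - 'D_w (fun z => G z u v) y).
Proof.
apply: (sharpE (nbhs_singleton iG)) => c a b.
rewrite (lin_derive u (G2 v)) // (lin_derive v (G2 u)) // (lin_derive_dir (dG u v)).
by rewrite /GRing.scale /=; ring.
Qed.

Lemma gamma_sym u v : gamma u v = gamma v u.
Proof.
apply: (inner_product_inj (nbhs_singleton iG)) => w; rewrite !gammaE.
by rewrite (derive_metric_sym w u v); congr (_ * (_ - _)); rewrite addrC.
Qed.

(** Koszul's formula for the Christoffel symbols, added to itself with v and w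
    exchanged. *)
Lemma gamma_metric u v w :
  'D_u (fun z => G z v w) y = G y (gamma u v) w + G y v (gamma u w).
Proof.
have [_ gs _] := nbhs_singleton iG.
rewrite (gs v) !gammaE (derive_metric_sym v u w) (derive_metric_sym w u v).
rewrite (derive_metric_sym u w v); lra.
Qed.

Lemma gamma_lin u : lin (gamma u).
Proof.
move=> c a b; apply: (inner_product_inj (nbhs_singleton iG)) => w.
rewrite (lin_scalar (nbhs_singleton (G1 w))) !gammaE.
rewrite (lin_derive u (G1 w)) // (lin_derive_dir (dG u w)) (lin_derive w (G2 u)) //.
by rewrite /GRing.scale /=; ring.
Qed.

End LocalMetric.

(** * Nearly G2 structures in a chart *)

Section LocalNearlyG2.
Context {R : realType}.
Local Notation V := 'rV[R]_7.
Variables (G : V -> V -> V -> R) (phi : V -> V -> V -> V -> R) (y : V).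
Hypotheses (iG : \forall z \near y, inner_product (G z))
           (sG : forall u v, smooth_at (fun z => G z u v) y).
Hypotheses (phi1 : \forall z \near y, forall b c, lin (fun a => phi z a b c : R^o))
           (phi12 : \forall z \near y, forall a b c, phi z a b c = - phi z b a c)
           (phi23 : \forall z \near y, forall a b c, phi z a b c = - phi z a c b).
Hypothesis sphi : forall a b c, smooth_at (fun z => phi z a b c) y.
Hypothesis frame : \forall z \near y, exists f, orthonormal7 (G z) f /\ G2_components (phi z) f.

Definition cross z u v := sharp (G z) (phi z u v).

Let dG u v : differentiable (fun z => G z u v) y.
Proof. exact: smooth_at_differentiable. Qed.

Let dphi a b c : differentiable (fun z => phi z a b c) y.
Proof. exact: smooth_at_differentiable. Qed.

Let iGy := nbhs_singleton iG.
Let phi1y := nbhs_singleton phi1.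
Let phi12y := nbhs_singleton phi12.
Let phi23y := nbhs_singleton phi23.

Let phi3 : \forall z \near y, forall a b, lin (phi z a b : V -> R^o).
Proof.
apply: filterS3 phi1 phi12 phi23 => z p1 p12 p23 a b; exact: phi3_lin.
Qed.

Let phi2 : \forall z \near y, forall a c, lin (fun b => phi z a b c : R^o).
Proof. by apply: filterS2 phi1 phi12 => z p1 p12 a c; exact: phi2_lin. Qed.

Lemma crossE : \forall z \near y, forall u v w, G z (cross z u v) w = phi z u v w.
Proof. by apply: filterS2 iG phi3 => z iz pz u v w; rewrite sharpE. Qed.

Let BE := nbhs_singleton crossE.

Lemma smooth_at_cross u v : smooth_at (fun z => cross z u v) y.
Proof.
apply: (smooth_at_solve iG sG) => w; apply: smooth_at_near (sphi u v w).
by apply: filterS crossE => z ->.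
Qed.

Let Psi z := psi4 (G z) (phi z) (cross z).
Let Gam := gamma G y.

Definition nabla_phi u a b c := 'D_u (fun z => phi z a b c) y
  - phi y (Gam u a) b c - phi y a (Gam u b) c - phi y a b (Gam u c).

Let B := cross y.
Let N u a b c d := nabla_phi u a b (B c d) + nabla_phi u c d (B a b).

Let GamP u : lin (Gam u) := gamma_lin iG dG u.

Let phi_cross a b v : phi y a b v = G y (B a b) v.
Proof. by rewrite BE. Qed.

(** [N u] is the covariant derivative of psi.  The derivative of the cross product
    that Leibniz's rule introduces is eliminated with the derivative of
    g (c x d, a x b) = phi (c, d, a x b). *)
Lemma derive_Psi u a b c d : 'D_u (fun z => Psi z a b c d) y = N u a b c d
  + Psi y (Gam u a) b c d + Psi y a (Gam u b) c d + Psi y a b (Gam u c) d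
  + Psi y a b c (Gam u d).
Proof.
have dB c' d' : differentiable (fun z => cross z c' d') y.
  exact: smooth_at_differentiable (smooth_at_cross _ _).
have L : \forall z \near y, forall c' x x', phi z a b (c' *: x + x') =
    c' * phi z a b x + phi z a b x'.
  by apply: filterS phi3 => z lz c' x x'; rewrite lz.
have LG w : \forall z \near y, forall c' x x', G z (c' *: x + x') w = c' * G z x w + G z x' w.
  by apply: filterS iG => z [gl _ _] c' x x'; rewrite gl.
have [_ gs _] := iGy.
have d1 : differentiable (fun z => phi z a b (cross z c d)) y.
  exact: (differentiable_moving L).
have E1 := derive_moving L u (fun x => dphi a b x) (dB c d).
have E2 : 'D_u (fun z => phi z c d (B a b)) y =
    'D_u (fun z => G z (B c d) (B a b)) y + G y ('D_u (fun z => cross z c d) y) (B a b).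
  rewrite -(derive_moving (LG (B a b)) u (fun x => dG x _) (dB c d)).
  by apply: near_eq_derive; apply: filterS crossE => z ->.
have dGG : differentiable (fun z => G z a c * G z b d) y by exact: differentiableM.
have dGG' : differentiable (fun z => G z a d * G z b c) y by exact: differentiableM.
have E : 'D_u (fun z => Psi z a b c d) y = 'D_u (fun z => phi z a b (cross z c d)) y
   - 'D_u (fun z => G z a c * G z b d) y + 'D_u (fun z => G z a d * G z b c) y.
  rewrite (deriveD (f := (fun z => phi z a b (cross z c d)) - (fun z => G z a c * G z b d))
     (g := fun z => G z a d * G z b c)).
  - by rewrite deriveB //; exact: diff_derivable.
  - by apply: derivableB; exact: diff_derivable.
  - exact: diff_derivable.
have M u1 u2 v1 v2 : 'D_u (fun z => G z u1 u2 * G z v1 v2) y =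
    G y u1 u2 * (G y (Gam u v1) v2 + G y v1 (Gam u v2)) +
    G y v1 v2 * (G y (Gam u u1) u2 + G y u1 (Gam u u2)).
  rewrite (deriveM (f := fun z => G z u1 u2) (g := fun z => G z v1 v2)) //;
    [|exact: diff_derivable|exact: diff_derivable].
  by rewrite /GRing.scale /= !(gamma_metric iG dG).
rewrite E E1 !M phi_cross gs.
have -> : G y ('D_u (fun z => cross z c d) y) (B a b) =
  'D_u (fun z => phi z c d (B a b)) y - 'D_u (fun z => G z (B c d) (B a b)) y.
  by rewrite E2 addrC addKr.
rewrite (gamma_metric iG dG) /N /nabla_phi /Psi /psi4 -/B -/Gam.
rewrite (phi_cross a b (Gam u _)) (phi_cross c d (Gam u _)).
rewrite (gs (B c d) (Gam u (B a b))) (gs (B a b) (Gam u _)).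
rewrite (phi_cross _ _ (B a b)) (phi_cross _ _ (B a b)).
rewrite (phi_cross a b (cross y (Gam u c) d)) (phi_cross a b (cross y c (Gam u d))).
rewrite (gs (B (Gam u c) d)) (gs (B c (Gam u d))).
rewrite /B; move: (G y) (cross y) (Gam) => g h k; ring.
Qed.

Let Gam_sym u v : Gam u v = Gam v u.
Proof. exact: gamma_sym. Qed.

Lemma Psi_alternating : \forall z \near y, [/\ forall a b c d, Psi z a b c d = - Psi z b a c d,
  forall a b c d, Psi z a b c d = - Psi z a c b d &
  forall a b c d, Psi z a b c d = - Psi z a b d c].
Proof.
have H1 : \forall z \near y, inner_product (G z) /\
    (exists f, orthonormal7 (G z) f /\ G2_components (phi z) f).
  by apply: filterS2 iG frame.
have H2 : \forall z \near y, (forall a b c, phi z a b c = - phi z b a c) /\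
    (forall a b c, phi z a b c = - phi z a c b).
  by apply: filterS2 phi12 phi23.
have H3 : \forall z \near y, (forall b c, lin (fun a => phi z a b c : R^o)) /\
    (forall u v w, G z (cross z u v) w = phi z u v w).
  by apply: filterS2 phi1 crossE.
apply: filterS3 H1 H2 H3 => z [iz [f [og fc]]] [p12 p23] [p1 Bz].
exact: (psi4_alternating iz og p1 p12 p23 fc Bz).
Qed.

Let Psi12 := let: And3 h _ _ := nbhs_singleton Psi_alternating in h.
Let Psi23 := let: And3 _ h _ := nbhs_singleton Psi_alternating in h.
Let Psi34 := let: And3 _ _ h := nbhs_singleton Psi_alternating in h.

Lemma smooth_at_Psi a b c d : smooth_at (fun z => Psi z a b c d) y.
Proof.
apply: smooth_atD; last exact: smooth_atM.
apply: smooth_atB; last exact: smooth_atM.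
have L : \forall z \near y, forall c' x x', phi z a b (c' *: x + x') =
    c' * phi z a b x + phi z a b x'.
  by apply: filterS phi3 => z lz c' x x'; rewrite lz.
apply: (smooth_at_moving L) => //; exact: smooth_at_cross.
Qed.

Let dPsi a b c d : differentiable (fun z => Psi z a b c d) y.
Proof. exact: smooth_at_differentiable (smooth_at_Psi _ _ _ _). Qed.

(** The covariant derivative of a skew tensor is skew. *)
Lemma N_swap12 u a b c d : N u a b c d = - N u b a c d.
Proof.
have D : 'D_u (fun z => Psi z a b c d) y = - 'D_u (fun z => Psi z b a c d) y.
  apply: derive_near_opp; first exact: dPsi.
  by apply: filterS Psi_alternating => z [h _ _]; exact: h.
move: D; rewrite !derive_Psi (Psi12 (Gam u a)) (Psi12 a (Gam u b)).
rewrite (Psi12 a b (Gam u c)) (Psi12 a b c (Gam u d)).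
move: (Psi y) (N) (Gam) => P n g; lra.
Qed.

Lemma N_swap23 u a b c d : N u a b c d = - N u a c b d.
Proof.
have D : 'D_u (fun z => Psi z a b c d) y = - 'D_u (fun z => Psi z a c b d) y.
  apply: derive_near_opp; first exact: dPsi.
  by apply: filterS Psi_alternating => z [_ h _]; exact: h.
move: D; rewrite !derive_Psi (Psi23 (Gam u a) b) (Psi23 a (Gam u b)).
rewrite (Psi23 a b (Gam u c)) (Psi23 a b c (Gam u d)).
move: (Psi y) (N) (Gam) => P n g; lra.
Qed.

Lemma nabla_phi_lin : lin4 nabla_phi.
Proof.
have GamL v : lin (fun u => Gam u v) by move=> k x x'; rewrite !(Gam_sym _ v) (GamP v).
split=> *; (apply: linD; first apply: linD; first apply: linD).
- exact: lin_derive_dir.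
- by apply: linN; apply: (lin_comp (phi1y _ _)).
- by apply: linN; apply: (lin_comp (nbhs_singleton phi2 _ _)).
- by apply: linN; apply: (lin_comp (nbhs_singleton phi3 _ _)).
- apply: (lin_derive _ (F := fun z a => phi z a _ _)) => //.
  by apply: filterS phi1 => z; exact.
- by apply: linN; apply: (lin_comp (phi1y _ _)); exact: GamP.
- by apply: linN; exact: phi1y.
- by apply: linN; exact: phi1y.
- apply: (lin_derive _ (F := fun z a => phi z _ a _)) => //.
  by apply: filterS phi2 => z; exact.
- by apply: linN; exact: (nbhs_singleton phi2).
- by apply: linN; apply: (lin_comp (nbhs_singleton phi2 _ _)); exact: GamP.
- by apply: linN; exact: (nbhs_singleton phi2).
- apply: (lin_derive _ (F := fun z a => phi z _ _ a)) => //.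
  by apply: filterS phi3 => z; exact.
- by apply: linN; exact: (nbhs_singleton phi3).
- by apply: linN; exact: (nbhs_singleton phi3).
- by apply: linN; apply: (lin_comp (nbhs_singleton phi3 _ _)); exact: GamP.
Qed.

Lemma nabla_phi12 u a b c : nabla_phi u a b c = - nabla_phi u b a c.
Proof.
rewrite /nabla_phi (derive_near_opp (G := fun z => phi z b a c)) //; last first.
  by apply: filterS phi12 => z; exact.
rewrite (phi12y (Gam u a)) (phi12y a (Gam u b)) (phi12y a b (Gam u c)); ring.
Qed.

Lemma nabla_phi23 u a b c : nabla_phi u a b c = - nabla_phi u a c b.
Proof.
rewrite /nabla_phi (derive_near_opp (G := fun z => phi z a c b)) //; last first.
  by apply: filterS phi23 => z; exact.
rewrite (phi23y (Gam u a)) (phi23y a (Gam u b)) (phi23y a b (Gam u c)); ring.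
Qed.

Variable tau : R.
Hypothesis dphi_tau : forall a b c d,
  'D_a (fun z => phi z b c d) y - 'D_b (fun z => phi z a c d) y
  + 'D_c (fun z => phi z a b d) y - 'D_d (fun z => phi z a b c) y
  = tau * psi4 (G y) (phi y) (cross y) a b c d.
Hypothesis dpsi_0 : forall a b c d e,
  'D_a (fun z => psi4 (G z) (phi z) (cross z) b c d e) y
  - 'D_b (fun z => psi4 (G z) (phi z) (cross z) a c d e) y
  + 'D_c (fun z => psi4 (G z) (phi z) (cross z) a b d e) y
  - 'D_d (fun z => psi4 (G z) (phi z) (cross z) a b c e) y
  + 'D_e (fun z => psi4 (G z) (phi z) (cross z) a b c d) y = 0.

(** The terms with Christoffel symbols cancel, since these are symmetric. *)
Lemma nabla_phi_dphi a b c d : nabla_phi a b c d - nabla_phi b a c d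
  + nabla_phi c a b d - nabla_phi d a b c = tau * psi4 (G y) (phi y) (cross y) a b c d.
Proof.
have P2 u v w : phi y u v w = - phi y v u w := phi12y u v w.
have P3 u v w : phi y u v w = phi y w u v by rewrite phi23y phi12y opprK.
rewrite -dphi_tau /nabla_phi.
rewrite (Gam_sym b a) (Gam_sym c a) (Gam_sym c b) (Gam_sym d a) (Gam_sym d b) (Gam_sym d c).
rewrite (P2 b (Gam _ _)) (P2 a (Gam _ _)) (P2 a (Gam _ _)).
rewrite (P3 _ _ (Gam _ _)) !(P3 _ _ (Gam _ _)).
ring.
Qed.

Lemma N_dpsi a b c d e :
  N a b c d e - N b a c d e + N c a b d e - N d a b c e + N e a b c d = 0.
Proof.
have := dpsi_0 a b c d e; rewrite -/(Psi _) !derive_Psi.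
have Q2 u v w x : Psi y v u w x = - Psi y u v w x := Psi12 v u w x.
have Q3 u v w x : Psi y v w u x = Psi y u v w x by rewrite Psi23 Psi12 opprK.
have Q4 u v w x : Psi y v w x u = - Psi y u v w x by rewrite Psi34 Psi23 Psi12 !opprK.
rewrite (Gam_sym b a) (Gam_sym c a) (Gam_sym c b) (Gam_sym d a) (Gam_sym d b) (Gam_sym d c).
rewrite (Gam_sym e a) (Gam_sym e b) (Gam_sym e c) (Gam_sym e d).
rewrite !(Q2 (Gam _ _)) !(Q3 (Gam _ _)) !(Q4 (Gam _ _)).
move: (Psi y) (N) (Gam) => P n g; lra.
Qed.

(** At y, [nabla_phi] satisfies the linear equations of the intrinsic torsion:
    [N_swap12] and [N_swap23] say that it comes from a variation of the frame,
    the rest is d phi = tau psi and d psi = 0. *)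
Lemma nabla_phi_skew u w z : nabla_phi u u w z = 0.
Proof.
have [f [og fc]] := nbhs_singleton frame.
apply: (nearly_G2_skew_torsion iGy og phi1y phi12y phi23y fc BE nabla_phi_lin
  nabla_phi12 nabla_phi23 _ nabla_phi_dphi N_dpsi) => u' a b c.
have D (x : R) : x = - x -> x = 0 by lra.
rewrite -[LHS]/(N u' a b a c) N_swap12; have := N_swap23 u' b a a c => /D ->.
by rewrite oppr0.
Qed.

End LocalNearlyG2.

(** * Tensors on a manifold in a chart *)

Section Transport.
Context {R : realType}.

Lemma of_chart_lin n (M : manifold R n) (c : chart R n M) (p : M) :
  lin (of_chart c p : 'rV[R]_n -> 'rV[R]_n).
Proof. by move=> k a b; rewrite !of_chartE linearP. Qed.

(** [metric_in_chart] with the point first: a family of inner products. *)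
Definition metric_rep n (M : manifold R n) (g : metric_field M) (c : chart R n M)
  (z u v : 'rV[R]_n) : R := metric_in_chart g c u v z.

Lemma metric_rep_inner n (M : manifold R n) (g : metric_field M) (c : chart R n M) z :
  riemannian_metric g -> atlas c -> cdom c (cparam c z) ->
  inner_product (metric_rep g c z).
Proof.
move=> [ig _] ac cz; have [gl gs gp] := ig (cparam c z).
split=> [k u v w|u v|u u0]; rewrite /metric_rep /metric_in_chart.
- by rewrite (of_chart_lin c) gl.
- exact: gs.
- apply: gp; apply/eqP => /(congr1 (@to_chart _ _ _ c _)); rewrite of_chartK //.
  by rewrite to_chart0 => /eqP; rewrite (negPf u0).
Qed.

Lemma near_metric_rep_inner n (M : manifold R n) (g : metric_field M) (c : chart R n M) p :
  riemannian_metric g -> atlas c -> cdom c p ->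
  \forall z \near ccoord c p, inner_product (metric_rep g c z).
Proof.
move=> rg ac cp; apply: filterS (near_cparam cp (near_cdom cp)) => z.
exact: metric_rep_inner.
Qed.

Lemma smooth_at_metric_rep n (M : manifold R n) (g : metric_field M) (c : chart R n M) p u v :
  riemannian_metric g -> atlas c -> cdom c p ->
  smooth_at (fun z => metric_rep g c z u v) (ccoord c p).
Proof.
move=> [_ sg] ac cp; apply: smooth_on_at (sg c u v ac).
have /= H := near_cparam cp (near_cdom cp).
apply: filterS2 H (near_ccoordK cp) => z cz zE; by exists (cparam c z).
Qed.

Lemma metric_rep_at n (M : manifold R n) (g : metric_field M) (p : M) :
  metric_rep g (chart_at p) (coord_at p) = g p.
Proof.
apply/funext => u; apply/funext => v; rewrite /metric_rep /metric_in_chart /coord_at.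
by rewrite ccoordK // !of_chart_at.
Qed.

Lemma metric_rep_to_chart n (M : manifold R n) (g : metric_field M) (c : chart R n M)
    z (u v : tangent (cparam c z)) : atlas c -> cdom c (cparam c z) ->
  metric_rep g c z (to_chart c u) (to_chart c v) = g (cparam c z) u v.
Proof. by move=> ac cz; rewrite /metric_rep /metric_in_chart !to_chartK. Qed.

End Transport.

Section NearlyG2Charts.
Context {R : realType} (M : manifold R 7) (phi : form_field M 3)
  (g : metric_field M) (vol : form_field M 7).
Hypotheses (hphi : G2_structure phi) (hg : G2_metric phi g vol)
  (hnG2 : nearly_G2 phi g vol).
Local Notation V := 'rV[R]_7.

Definition phi_rep (c : chart R 7 M) (z a b d : V) : R :=
  form_in_chart phi c (vec3 a b d) z.

Lemma codom_comp k (h : V -> V) (v : 'I_k -> V) : codom (fun i => h (v i)) = map h (codom v).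
Proof. by rewrite /codom /image_mem -map_comp. Qed.

Lemma map_vec3 (h : V -> V) a b d : (fun i => h (vec3 a b d i)) = vec3 (h a) (h b) (h d).
Proof. by apply: codom_inj; rewrite codom_comp !codom_fcons !codom_vec1. Qed.

Lemma map_vec4 (h : V -> V) a b d e :
  (fun i => h (vec4 a b d e i)) = vec4 (h a) (h b) (h d) (h e).
Proof. by apply: codom_inj; rewrite codom_comp !codom_fcons !codom_vec1. Qed.

Lemma phi_repE c z a b d : phi_rep c z a b d = @phi (cparam c z)
  (vec3 (of_chart c (cparam c z) a) (of_chart c (cparam c z) b) (of_chart c (cparam c z) d)).
Proof. by rewrite /phi_rep /form_in_chart map_vec3. Qed.

Lemma phi_alternating p : alternating_form (@phi p).
Proof. exact: hphi.1.1. Qed.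

Lemma phi_rep_lin c z b d : lin (fun a => phi_rep c z a b d : R^o).
Proof.
move=> k x x'; rewrite !phi_repE (of_chart_lin c).
exact: (fcons_linear _ (phi_alternating _)).
Qed.

Lemma phi_rep12 c z a b d : phi_rep c z a b d = - phi_rep c z b a d.
Proof. by rewrite !phi_repE; exact: (fcons_swap _ _ _ (phi_alternating _)). Qed.

Lemma phi_rep23 c z a b d : phi_rep c z a b d = - phi_rep c z a d b.
Proof.
rewrite !phi_repE /vec3 !fun1_fcons.
apply: (@fcons_swap _ _ _ (fun v => @phi _ (fcons _ v))).
exact: (fcons_alternating _ (phi_alternating _)).
Qed.

Lemma smooth_at_phi_rep c p a b d : atlas c -> cdom c p ->
  smooth_at (fun z => phi_rep c z a b d) (ccoord c p).
Proof.
move=> ac cp; apply: smooth_on_at (hphi.1.2 c (vec3 a b d) ac).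
apply: filterS2 (near_cparam cp (near_cdom cp)) (near_ccoordK cp) => z cz zE.
by exists (cparam c z).
Qed.

Lemma G2_point p : exists f : nat -> tangent p, [/\ orthonormal7 (@g p) f,
  G2_components (fun x y z => @phi p (vec3 x y z)) f & @vol p (fun i : 'I_7 => f i) = -1].
Proof.
have [[ig _] [[vola _] vol1] gE] := hg.
have [rho [rb rE]] := hphi.2 p.
exact: (G2_metric_pointwise (phi_alternating p) (vola p) (ig p) rb rE (vol1 p) (gE p)).
Qed.

Lemma G2_frame_rep c z : atlas c -> cdom c (cparam c z) ->
  exists f, [/\ orthonormal7 (metric_rep g c z) f, G2_components (phi_rep c z) f &
   forall i j k l, (i < 7)%N -> (j < 7)%N -> (k < 7)%N -> (l < 7)%N ->
     form_in_chart (G2_psi phi g vol) c (vec4 (f i) (f j) (f k) (f l)) z =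
     - (psi_tab i j k l)%:~R].
Proof.
move=> ac cz; have [f [of_ cf vf]] := G2_point (cparam c z).
exists (fun i => to_chart c (f i)); split.
- by move=> i j i7 j7; rewrite metric_rep_to_chart // of_.
- by move=> i j k i7 j7 k7; rewrite phi_repE !to_chartK //; exact: cf.
- move=> i j k l i7 j7 k7 l7.
  rewrite /form_in_chart map_vec4 !to_chartK //.
  have [[ig _] [[vola _] vol1] gE] := hg.
  exact: (hodge_star_on_frame (ig _) of_ (phi_alternating _) (vola _) cf vf i7 j7 k7 l7).
Qed.

Lemma alternating4_lin (a : ('I_4 -> V) -> R) (h : V -> V) : alternating_form a -> lin h ->
  lin4 (fun x y z w => a (vec4 (h x) (h y) (h z) (h w))).
Proof.
move=> aa lh.
have s12 x y z w : a (vec4 x y z w) = - a (vec4 y x z w) by exact: vec4_swapl.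
have s23 x y z w : a (vec4 x y z w) = - a (vec4 x z y w) by exact: vec4_swapm.
have s34 x y z w : a (vec4 x y z w) = - a (vec4 x y w z) by exact: vec4_swapr.
have l1 y z w : lin (fun x => a (vec4 (h x) y z w) : R^o).
  by move=> k x x'; rewrite lh; exact: fcons_linear.
split=> [y z w|x z w|x y w|x y z]; first exact: l1.
- by move=> k u v; rewrite !(s12 (h x)) l1 opprD scalerN.
- by move=> k u v; rewrite !(s23 (h x) (h y)) !(s12 (h x)) !opprK l1.
- by move=> k u v; rewrite !(s34 (h x) (h y) (h z)) !(s23 (h x) (h y)) !(s12 (h x)) !opprK l1 opprD scalerN.
Qed.

(** Both sides are multilinear and are compared on the frame. *)
Lemma G2_psi_rep c z a b d e : atlas c -> cdom c (cparam c z) ->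
  form_in_chart (G2_psi phi g vol) c (vec4 a b d e) z =
  - psi4 (metric_rep g c z) (phi_rep c z)
      (fun u v => sharp (metric_rep g c z) (phi_rep c z u v)) a b d e.
Proof.
move=> ac cz; have [f [of_ cf pf]] := G2_frame_rep ac cz.
have [rg [[vola _] vol1] gE] := hg.
have iz := metric_rep_inner rg ac cz.
have l1 := phi_rep_lin c z; have l3 := phi3_lin (@phi_rep_lin c z) (@phi_rep12 c z) (@phi_rep23 c z).
have BE u v w : metric_rep g c z (sharp (metric_rep g c z) (phi_rep c z u v)) w = phi_rep c z u v w.
  by rewrite sharpE.
have l4 := psi4_lin iz (@phi_rep_lin c z) (@phi_rep12 c z) (@phi_rep23 c z) BE.
have [ig _] := rg.
have [f0 [of0 cf0 vf0]] := G2_point (cparam c z).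
have aa : alternating_form (G2_psi phi g vol (p := cparam c z)).
  exact: (hodge_star_alternating (ig _) of0 (phi_alternating _) (vola _)).
apply: (frame_ext4 iz of_ (Q := fun a b d e => form_in_chart (G2_psi phi g vol) c (vec4 a b d e) z)
  (Q' := fun a b d e => - psi4 _ _ _ a b d e)).
- have -> : (fun a b d e => form_in_chart (G2_psi phi g vol) c (vec4 a b d e) z) =
     (fun a b d e => @G2_psi R M phi g vol (cparam c z) (vec4 (of_chart c (cparam c z) a)
       (of_chart c (cparam c z) b) (of_chart c (cparam c z) d) (of_chart c (cparam c z) e))).
    by do 4!apply/funext => ?; rewrite /form_in_chart map_vec4.
  exact: alternating4_lin aa (of_chart_lin _ _).
- by case: l4 => *; split=> *; apply: linN.
- move=> i j k l i7 j7 k7 l7.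
  by rewrite pf // (psi4_frame iz of_ (@phi_rep_lin c z) (@phi_rep12 c z) (@phi_rep23 c z) cf BE).
Qed.

Lemma ext_deriv_vec4 (w : form_field M 3) x a b d e :
  ext_deriv w (p := x) (vec4 a b d e) =
  'D_a (form_in_chart w (chart_at x) (vec3 b d e)) (coord_at x)
  - 'D_b (form_in_chart w (chart_at x) (vec3 a d e)) (coord_at x)
  + 'D_d (form_in_chart w (chart_at x) (vec3 a b e)) (coord_at x)
  - 'D_e (form_in_chart w (chart_at x) (vec3 a b d)) (coord_at x).
Proof.
rewrite /ext_deriv 4!big_ord_recl big_ord0 /vec4 /vec3 !fun1_fcons.
rewrite !(fcons_lift0, fcons_liftS) !(fconsS, fcons0).
move: ('D_a _ _) ('D_b _ _) ('D_d _ _) ('D_e _ _) => A B D E.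
by rewrite /= /bump /= !exprS expr0; ring.
Qed.

Lemma ext_deriv_vec5 (w : form_field M 4) x a b d e k :
  ext_deriv w (p := x) (vec5 a b d e k) =
  'D_a (form_in_chart w (chart_at x) (vec4 b d e k)) (coord_at x)
  - 'D_b (form_in_chart w (chart_at x) (vec4 a d e k)) (coord_at x)
  + 'D_d (form_in_chart w (chart_at x) (vec4 a b e k)) (coord_at x)
  - 'D_e (form_in_chart w (chart_at x) (vec4 a b d k)) (coord_at x)
  + 'D_k (form_in_chart w (chart_at x) (vec4 a b d e)) (coord_at x).
Proof.
rewrite /ext_deriv 5!big_ord_recl big_ord0 /vec5 /vec4 /vec3 !fun1_fcons.
rewrite !(fcons_lift0, fcons_liftS) !(fconsS, fcons0).
move: ('D_a _ _) ('D_b _ _) ('D_d _ _) ('D_e _ _) ('D_k _ _) => A B D E F.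
by rewrite /= /bump /= !exprS expr0; ring.
Qed.

Section AtAPoint.
Variable x : M.
Local Notation c := (chart_at x).
Local Notation y := (coord_at x).
Local Notation G := (metric_rep g c).
Local Notation Phi := (phi_rep c).

Let near_dom : \forall z \near y, cdom c (cparam c z).
Proof. exact: near_cparam (near_cdom _). Qed.

Lemma torsion_hyps : [/\ \forall z \near y, inner_product (G z),
  forall u v, smooth_at (fun z => G z u v) y,
  forall a b d, smooth_at (fun z => Phi z a b d) y &
  \forall z \near y, exists f, orthonormal7 (G z) f /\ G2_components (Phi z) f].
Proof.
have [rg _ _] := hg; split.
- exact: near_metric_rep_inner.
- by move=> u v; exact: smooth_at_metric_rep.
- by move=> a b d; exact: smooth_at_phi_rep.
- by apply: filterS near_dom => z cz; have [//|f [of_ cf _]] := @G2_frame_rep c z _ cz; exists f.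
Qed.

Lemma torsion_skew u w z : nabla_phi G Phi y u u w z = 0.
Proof.
have [iG sG sP fr] := torsion_hyps.
have [tau [dphiE dpsiE]] := hnG2.
have dpsi a b d e v : 'D_v (form_in_chart (G2_psi phi g vol) c (vec4 a b d e)) y =
    - 'D_v (fun z => psi4 (G z) (Phi z) (cross G Phi z) a b d e) y.
  apply: derive_near_opp.
    apply: smooth_at_differentiable; apply: smooth_at_Psi => //.
    - by apply: filterS near_dom => ? _ ? ?; exact: phi_rep_lin.
    - by apply: filterS near_dom => ? _ ? ? ?; exact: phi_rep12.
    - by apply: filterS near_dom => ? _ ? ? ?; exact: phi_rep23.
  by apply: filterS near_dom => z' cz; exact: G2_psi_rep.
apply: (@nabla_phi_skew _ G Phi y iG sG _ _ _ sP fr (- tau x)).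
- by apply: filterS near_dom => ? _ ? ?; exact: phi_rep_lin.
- by apply: filterS near_dom => ? _ ? ? ?; exact: phi_rep12.
- by apply: filterS near_dom => ? _ ? ? ?; exact: phi_rep23.
- move=> a b d e; have := dphiE x (vec4 a b d e).
  rewrite ext_deriv_vec4 => H; apply: etrans H _; rewrite mulNr -mulrN; congr (_ * _).
  rewrite -(G2_psi_rep a b d e (atlas_chart_at x)); last exact: nbhs_singleton near_dom.
  rewrite /form_in_chart map_vec4 /coord_at ccoordK // !of_chart_at //.
- move=> a b d e k; have := dpsiE x (vec5 a b d e k); rewrite ext_deriv_vec5 !dpsi.
  move: ('D_a _ _) ('D_b _ _) ('D_d _ _) ('D_e _ _) ('D_k _ _) => A B D E F; lra.
Qed.

End AtAPoint.

End NearlyG2Charts.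

(** * Maps into a Riemannian manifold, in charts *)

Section AlongMap.
Context {R : realType} {m n : nat}.
Local Notation U := 'rV[R]_m.
Local Notation V := 'rV[R]_n.
Variables (F : U -> V) (G : V -> V -> V -> R) (x : U).
Hypotheses (sF : smooth_at F x)
  (iG : \forall z \near F x, inner_product (G z))
  (sG : forall u v, smooth_at (fun z => G z u v) (F x)).

Let cF : {for x, continuous F}.
Proof. exact: differentiable_continuous (smooth_at_differentiable sF). Qed.

Let dF := smooth_at_differentiable sF.

Let iGF : \forall z \near x, inner_product (G (F z)).
Proof. exact: near_continuous cF iG. Qed.

Let G1 b : \forall z \near x, forall c a a', G (F z) (c *: a + a') b = c * G (F z) a b + G (F z) a' b.
Proof. by apply: filterS iGF => z [gl _ _] c a a'; rewrite gl. Qed.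

Let G2 (Y : U -> V) : \forall z \near x, forall c a a',
  G (F z) (Y z) (c *: a + a') = c * G (F z) (Y z) a + G (F z) (Y z) a'.
Proof. by apply: filterS iGF => z [gl gs _] c a a'; rewrite !(gs (Y z)) gl. Qed.

(** The covariant derivative at x, in the direction u, of a field Y along F. *)
Definition nabla (u : U) (Y : U -> V) : V := 'D_u Y x + gamma G (F x) ('D_u F x) (Y x).

Lemma smooth_at_metric_along (Y Z : U -> V) : smooth_at Y x -> smooth_at Z x ->
  smooth_at (fun z => G (F z) (Y z) (Z z)) x.
Proof.
move=> sY sZ; apply: (smooth_at_moving (G2 Y)) => // b.
apply: (smooth_at_moving (L := fun z a => G (F z) a b) (G1 b)) => // a.
exact: (smooth_at_scalar_comp sF (sG a b)).
Qed.

Lemma derive_metric_along u (Y Z : U -> V) : differentiable Y x -> differentiable Z x ->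
  'D_u (fun z => G (F z) (Y z) (Z z)) x = G (F x) (nabla u Y) (Z x) + G (F x) (Y x) (nabla u Z).
Proof.
move=> dY dZ.
have dG a b : differentiable (fun z => G z a b) (F x) by exact: smooth_at_differentiable.
have dGF a b : differentiable (fun z => G (F z) a b) x.
  exact: (differentiable_comp dF (dG a b)).
have dGY b : differentiable (fun z => G (F z) (Y z) b) x.
  exact: (differentiable_moving (L := fun z a => G (F z) a b) (G1 b)).
rewrite (derive_moving (G2 Y) u dGY dZ).
rewrite (derive_moving (L := fun z a => G (F z) a (Z x)) (G1 _) u (fun a => dGF a _) dY).
rewrite (derive_comp (f := fun z => G z (Y x) (Z x)) u dF (dG _ _)).
rewrite (gamma_metric iG dG).
have [gl gs _] := nbhs_singleton iG.
have D a b c : G (F x) (a + b) c = G (F x) a c + G (F x) b c.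
  by have := gl 1 a b c; rewrite scale1r mul1r.
rewrite /nabla !D (gs (Y x) (_ + _)) D (gs (Y x)) !(gs _ (Y x)).
move: (G (F x)) => g; ring.
Qed.

(** The second derivative of F as a map into a Riemannian manifold. *)
Definition fundamental_form u v := nabla u ('D_v F).

Lemma schwarz_vector u v : 'D_u ('D_v F) x = 'D_v ('D_u F) x.
Proof.
apply/rowP => j.
have sFj := (smooth_at_coordP _ _).1 sF j.
have E w : \forall z \near x, ('D_w F z) ord0 j = 'D_w (fun z => F z ord0 j) z.
  by apply: filterS (smooth_at_near_differentiable sF) => z dFz; rewrite derive_coord.
have dD w := smooth_at_differentiable (smooth_at_derive w sF).
apply: etrans (derive_coord u j (dD v)) _.
apply: etrans _ (esym (derive_coord v j (dD u))).
apply: etrans (near_eq_derive u (E v)) _.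
apply: etrans _ (esym (near_eq_derive v (E u))).
exact: schwarz.
Qed.

Lemma fundamental_form_sym u v : fundamental_form u v = fundamental_form v u.
Proof.
have dG a b : differentiable (fun z => G z a b) (F x) by exact: smooth_at_differentiable.
exact: (f_equal2 +%R (schwarz_vector u v) (gamma_sym iG dG ('D_u F x) ('D_v F x))).
Qed.

Lemma derive_lin_comp (l : V -> R) u (Y : U -> V) : lin (l : V -> R^o) -> differentiable Y x ->
  'D_u (fun z => l (Y z)) x = l ('D_u Y x).
Proof.
move=> ll dY.
have L : \forall z \near x, forall c a b, (fun _ : U => l) z (c *: a + b) = c * l a + l b.
  by near=> z; move=> c a b; rewrite ll.
rewrite (derive_moving L u (fun a => differentiable_cst (l a) x) dY).
by rewrite (derive_cst (l (Y x))) add0r.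
Unshelve. all: by end_near. Qed.

Variable g : U -> U -> U -> R.
Hypothesis gE : \forall z \near x, forall u v, g z u v = G (F z) ('D_u F z) ('D_v F z).
Hypothesis ig : \forall z \near x, inner_product (g z).

Let sD u : smooth_at ('D_u F) x.
Proof. exact: smooth_at_derive. Qed.

Lemma smooth_at_induced u v : smooth_at (fun z => g z u v) x.
Proof.
apply: smooth_at_near (smooth_at_metric_along (sD u) (sD v)).
by apply: filterS gE => z ->.
Qed.

Let dg u v : differentiable (fun z => g z u v) x.
Proof. exact: smooth_at_differentiable (smooth_at_induced u v). Qed.

Lemma derive_induced u v w : 'D_u (fun z => g z v w) x =
  G (F x) (fundamental_form u v) ('D_w F x) + G (F x) ('D_v F x) (fundamental_form u w).
Proof.
rewrite -(derive_metric_along u (smooth_at_differentiable (sD v)) (smooth_at_differentiable (sD w))).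
by apply: near_eq_derive; apply: filterS gE => z ->.
Qed.

(** Koszul's formulas for g and G: the derivatives of g are given by
    [derive_induced], and all but one of the six terms cancel by symmetry. *)
Lemma gamma_induced u v w : g x (gamma g x u v) w = G (F x) (fundamental_form u v) ('D_w F x).
Proof.
rewrite (gammaE ig dg) !derive_induced.
have [_ gs _] := nbhs_singleton iG.
rewrite (fundamental_form_sym v u) (fundamental_form_sym w u) (fundamental_form_sym w v).
move: gs; move: (G (F x)) (fundamental_form u v) (fundamental_form u w)
  (fundamental_form v w) ('D_u F x) ('D_v F x) ('D_w F x) => h a b c d e k gs.
by rewrite (gs e b) (gs d c); lra.
Qed.

End AlongMap.

Section GermsAndComposition.
Context {R : realType} {m n : nat}.
Implicit Types (F : 'rV[R]_m -> 'rV[R]_n) (G : 'rV[R]_n -> 'rV[R]_n -> 'rV[R]_n -> R).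

Lemma nabla_near F F' G x u (Y Y' : 'rV[R]_m -> 'rV[R]_n) :
  (\forall z \near x, F z = F' z) -> (\forall z \near x, Y z = Y' z) ->
  nabla F G x u Y = nabla F' G x u Y'.
Proof.
move=> FF YY; rewrite /nabla (near_eq_derive u FF) (near_eq_derive u YY).
by rewrite (nbhs_singleton FF) (nbhs_singleton YY).
Qed.

Lemma nabla_comp k F G (S : 'rV[R]_k -> 'rV[R]_m) x u (Y : 'rV[R]_m -> 'rV[R]_n) :
  differentiable S x -> differentiable F (S x) -> differentiable Y (S x) ->
  nabla (fun z => F (S z)) G x u (fun z => Y (S z)) = nabla F G (S x) ('D_u S x) Y.
Proof.
move=> dS dF dY; rewrite /nabla.
by rewrite (derive_comp u dS dF) (derive_comp u dS dY).
Qed.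

End GermsAndComposition.

Section MovingDirection.
Context {R : realType} {m n k : nat}.
Variables (F : 'rV[R]_m -> 'rV[R]_n) (T : 'rV[R]_n -> 'rV[R]_k) (x : 'rV[R]_m).
Hypotheses (dF : differentiable F x) (sT : smooth_at T (F x)).

Let nT : \forall z \near x, differentiable T (F z).
Proof.
exact: near_continuous (differentiable_continuous dF) (smooth_at_near_differentiable sT).
Qed.

Let expand (W : 'rV[R]_m -> 'rV[R]_n) : \forall z \near x,
  \sum_j W z ord0 j *: 'D_(stdb j) T (F z) = 'D_(W z) T (F z).
Proof. by apply: filterS nT => z dz; rewrite derive_sum_stdb. Qed.

Let expand_coord (W : 'rV[R]_m -> 'rV[R]_n) i :
  (fun z => (\sum_j W z ord0 j *: 'D_(stdb j) T (F z)) ord0 i) =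
  (fun z => \sum_j W z ord0 j * ('D_(stdb j) T (F z)) ord0 i).
Proof. by apply/funext => z; rewrite summxE; apply: eq_bigr => j _; rewrite mxE. Qed.

Lemma differentiable_moving_direction (W : 'rV[R]_m -> 'rV[R]_n) : differentiable W x ->
  differentiable (fun z => 'D_(W z) T (F z)) x.
Proof.
move=> dW; apply: near_eq_differentiable (expand W) _.
apply/differentiable_coordP => i; rewrite expand_coord.
have -> : (fun z => \sum_j W z ord0 j * ('D_(stdb j) T (F z)) ord0 i) =
    \sum_j (fun z => W z ord0 j * ('D_(stdb j) T (F z)) ord0 i).
  by apply/funext => z; rewrite fct_sumE.
apply: differentiable_sum => j; apply: differentiableM.
  exact: ((differentiable_coordP _ _).1 dW j).
have dTj := smooth_at_differentiable (smooth_at_derive (stdb j) sT).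
exact: ((differentiable_coordP _ _).1 (differentiable_comp dF dTj) i).
Qed.

Lemma smooth_moving_direction (W : 'rV[R]_m -> 'rV[R]_n) : smooth_at F x -> smooth_at W x ->
  smooth_at (fun z => 'D_(W z) T (F z)) x.
Proof.
move=> sF sW; apply: smooth_at_near (expand W) _.
apply/smooth_at_coordP => i; rewrite expand_coord.
apply: smooth_at_sum => j _; apply: smooth_atM.
  exact: ((smooth_at_coordP _ _).1 sW j).
have sTj := smooth_at_derive (stdb j) sT.
exact: ((smooth_at_coordP _ _).1 (smooth_at_comp (f := 'D_(stdb j) T) sF sTj) i).
Qed.

End MovingDirection.

Section Isometry.
Context {R : realType} {m n k : nat}.
Variables (F : 'rV[R]_m -> 'rV[R]_n) (T : 'rV[R]_n -> 'rV[R]_k) (x : 'rV[R]_m).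
Variables (g : 'rV[R]_n -> 'rV[R]_n -> 'rV[R]_n -> R) (G : 'rV[R]_k -> 'rV[R]_k -> 'rV[R]_k -> R).
Hypotheses (dF : differentiable F x) (sT : smooth_at T (F x)).
Hypotheses (iG : \forall z \near T (F x), inner_product (G z))
  (sG : forall u v, smooth_at (fun z => G z u v) (T (F x))).
Hypotheses (gE : \forall z \near F x, forall u v, g z u v = G (T z) ('D_u T z) ('D_v T z))
  (ig : \forall z \near F x, inner_product (g z)).

(** Leibniz's rule for z |-> 'D_(Y z) T (F z) produces the second derivative of T,
    whose tangential part is given by the Christoffel symbols of g
    ([gamma_induced]). *)
Lemma nabla_isometry u w (Y : 'rV[R]_m -> 'rV[R]_n) : differentiable Y x ->
  G (T (F x)) (nabla (fun z => T (F z)) G x u (fun z => 'D_(Y z) T (F z))) ('D_w T (F x)) =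
  g (F x) (nabla F g x u Y) w.
Proof.
move=> dY; set b := 'D_w T (F x).
have [gl gs _] := nbhs_singleton iG.
have D a a' c : G (T (F x)) (a + a') c = G (T (F x)) a c + G (T (F x)) a' c.
  by have := gl 1 a a' c; rewrite scale1r mul1r.
have [gl' _ _] := nbhs_singleton ig.
have D' a a' c : g (F x) (a + a') c = g (F x) a c + g (F x) a' c.
  by have := gl' 1 a a' c; rewrite scale1r mul1r.
have lb : lin (fun a => G (T (F x)) a b : R^o) by move=> c a a'; rewrite gl.
have nT : \forall z \near x, differentiable T (F z).
  exact: near_continuous (differentiable_continuous dF) (smooth_at_near_differentiable sT).
have L : \forall z \near x, forall c a a', G (T (F x)) ('D_(c *: a + a') T (F z)) b =
    c * G (T (F x)) ('D_a T (F z)) b + G (T (F x)) ('D_a' T (F z)) b.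
  by apply: filterS nT => z dz c a a'; rewrite deriveDr // deriveZr // gl.
have dTa a := smooth_at_differentiable (smooth_at_derive a sT).
have dl (a : 'rV[R]_n) : differentiable (fun z => G (T (F x)) ('D_a T z) b) (F x).
  apply: (differentiable_moving (L := fun _ c => G (T (F x)) c b)).
  - by apply: filterS (smooth_at_near_differentiable sT) => z _ c a' a''; rewrite gl.
  - by move=> c; exact: differentiable_cst.
  - exact: dTa.
have dL a : differentiable (fun z => G (T (F x)) ('D_a T (F z)) b) x.
  exact: (differentiable_comp dF (dl a)).
have E1 := derive_lin_comp u lb (differentiable_moving_direction dF sT dY).
have E2 := derive_moving L u dL dY.
have E3 := derive_comp u dF (dl (Y x)).
have E4 := derive_lin_comp ('D_u F x) lb (dTa (Y x)).
rewrite /nabla D (derive_comp u dF (smooth_at_differentiable sT)) -E1 E2 E3 E4 D'.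
rewrite (gamma_induced sT iG sG gE ig) /fundamental_form /nabla D.
rewrite (nbhs_singleton gE) -/b.
move: (G (T (F x))) => h; ring.
Qed.

End Isometry.

Section PhiAlongMap.
Context {R : realType} {m : nat}.
Local Notation U := 'rV[R]_m.
Local Notation V := 'rV[R]_7.
Variables (F : U -> V) (G : V -> V -> V -> R) (phi : V -> V -> V -> V -> R) (x : U).
Hypotheses (sF : smooth_at F x)
  (phi1 : forall z b c, lin (fun a => phi z a b c : R^o))
  (phi12 : forall z a b c, phi z a b c = - phi z b a c)
  (phi23 : forall z a b c, phi z a b c = - phi z a c b)
  (sphi : forall a b c, smooth_at (fun z => phi z a b c) (F x)).

Let dF := smooth_at_differentiable sF.
Let phi2 z a c : lin (fun b => phi z a b c : R^o) := phi2_lin (phi1 z) (phi12 z) a c.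
Let phi3 z a b : lin (phi z a b : V -> R^o) := phi3_lin (phi1 z) (phi12 z) (phi23 z) a b.

Lemma derive_phi_along u (X Y Z : U -> V) :
  differentiable X x -> differentiable Y x -> differentiable Z x ->
  'D_u (fun z => phi (F z) (X z) (Y z) (Z z)) x =
  nabla_phi G phi (F x) ('D_u F x) (X x) (Y x) (Z x)
  + phi (F x) (nabla F G x u X) (Y x) (Z x) + phi (F x) (X x) (nabla F G x u Y) (Z x)
  + phi (F x) (X x) (Y x) (nabla F G x u Z).
Proof.
move=> dX dY dZ.
have dp a b c : differentiable (fun z => phi z a b c) (F x) by exact: smooth_at_differentiable.
have dpF a b c : differentiable (fun z => phi (F z) a b c) x.
  exact: (differentiable_comp dF (dp a b c)).
have L1 b c : \forall z \near x, forall k a a', phi (F z) (k *: a + a') b c =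
    k * phi (F z) a b c + phi (F z) a' b c.
  by near=> z; move=> k a a'; rewrite phi1.
have L2 c : \forall z \near x, forall k a a', phi (F z) (X z) (k *: a + a') c =
    k * phi (F z) (X z) a c + phi (F z) (X z) a' c.
  by near=> z; move=> k a a'; rewrite phi2.
have L3 : \forall z \near x, forall k a a', phi (F z) (X z) (Y z) (k *: a + a') =
    k * phi (F z) (X z) (Y z) a + phi (F z) (X z) (Y z) a'.
  by near=> z; move=> k a a'; rewrite phi3.
have d1 b c : differentiable (fun z => phi (F z) (X z) b c) x.
  exact: (differentiable_moving (L := fun z a => phi (F z) a b c) (L1 b c)).
have d2 c : differentiable (fun z => phi (F z) (X z) (Y z) c) x.
  exact: (differentiable_moving (L := fun z b => phi (F z) (X z) b c) (L2 c)).
rewrite (derive_moving L3 u d2 dZ).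
rewrite (derive_moving (L := fun z b => phi (F z) (X z) b (Z x)) (L2 _) u (fun b => d1 b _) dY).
rewrite (derive_moving (L := fun z a => phi (F z) a (Y x) (Z x)) (L1 _ _) u (fun a => dpF a _ _) dX).
rewrite (derive_comp (f := fun z => phi z (X x) (Y x) (Z x)) u dF (dp _ _ _)).
have D1 a a' b c : phi (F x) (a + a') b c = phi (F x) a b c + phi (F x) a' b c.
  by have := phi1 (F x) b c 1 a a'; rewrite !scale1r.
have D2 a a' b c : phi (F x) b (a + a') c = phi (F x) b a c + phi (F x) b a' c.
  by have := phi2 (F x) b c 1 a a'; rewrite !scale1r.
have D3 a a' b c : phi (F x) b c (a + a') = phi (F x) b c a + phi (F x) b c a'.
  by have := phi3 (F x) b c 1 a a'; rewrite !scale1r.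
rewrite /nabla D1 D2 D3 /nabla_phi.
move: (gamma G (F x)) => gam; move: (phi (F x)) => p; ring.
Unshelve. all: by end_near. Qed.

(** Leibniz's rule for the field dF (Z) = N x dF (X).  The terms in which b is
    differentiated cancel, by the hypothesis at x itself. *)
Lemma nabla_cross (N : U -> V) (X Z : U -> U) u b :
  (\forall z \near F x, inner_product (G z)) ->
  (forall a a', smooth_at (fun z => G z a a') (F x)) ->
  smooth_at N x -> differentiable X x -> differentiable Z x ->
  (\forall z \near x, forall a, G (F z) ('D_(Z z) F z) a = phi (F z) (N z) ('D_(X z) F z) a) ->
  G (F x) (nabla F G x u (fun z => 'D_(Z z) F z)) b =
  nabla_phi G phi (F x) ('D_u F x) (N x) ('D_(X x) F x) b
  + phi (F x) (nabla F G x u N) ('D_(X x) F x) b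
  + phi (F x) (N x) (nabla F G x u (fun z => 'D_(X z) F z)) b.
Proof.
move=> iG sG sN dX dZ E.
have dI : differentiable (fun z : U => z) x := smooth_at_differentiable (smooth_at_id x).
have dFX : differentiable (fun z => 'D_(X z) F z) x := differentiable_moving_direction dI sF dX.
have dFZ : differentiable (fun z => 'D_(Z z) F z) x := differentiable_moving_direction dI sF dZ.
have db : differentiable (fun _ : U => b) x by exact: differentiable_cst.
have E1 := derive_metric_along sF iG sG u dFZ db.
have E2 := derive_phi_along u (smooth_at_differentiable sN) dFX db.
have E3 : 'D_u (fun z => G (F z) ('D_(Z z) F z) b) x =
    'D_u (fun z => phi (F z) (N z) ('D_(X z) F z) b) x.
  by apply: near_eq_derive; apply: filterS E => z ->.
move: E3; rewrite E1 E2 (nbhs_singleton E); exact: addIr.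
Qed.

Lemma smooth_at_phi_along (X Y Z : U -> V) :
  smooth_at X x -> smooth_at Y x -> smooth_at Z x ->
  smooth_at (fun z => phi (F z) (X z) (Y z) (Z z)) x.
Proof.
move=> sX sY sZ.
apply: (smooth_at_moving (L := fun z c => phi (F z) (X z) (Y z) c)) sZ => [|c].
  by near=> z; move=> k a a'; rewrite phi3.
apply: (smooth_at_moving (L := fun z b => phi (F z) (X z) b c)) sY => [|b].
  by near=> z; move=> k a a'; rewrite phi2.
apply: (smooth_at_moving (L := fun z a => phi (F z) a b c)) sX => [|a].
  by near=> z; move=> k a a'; rewrite phi1.
exact: (smooth_at_scalar_comp sF (sphi a b c)).
Unshelve. all: by end_near. Qed.

End PhiAlongMap.

Section SmoothConnection.
Context {R : realType} {m n : nat}.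
Variables (F : 'rV[R]_m -> 'rV[R]_n) (G : 'rV[R]_n -> 'rV[R]_n -> 'rV[R]_n -> R) (x : 'rV[R]_m).
Hypotheses (sF : smooth_at F x) (iG : \forall z \near F x, inner_product (G z))
  (sG : \forall z \near F x, forall u v, smooth_at (fun y => G y u v) z).

Let nG : \forall z \near F x, (\forall y \near z, inner_product (G y)) /\
  forall u v, differentiable (fun y => G y u v) z.
Proof.
apply: filterS2 (near_near iG) sG => z iz sz; split=> // u v.
exact: smooth_at_differentiable.
Qed.

(** The Christoffel symbols are the solution of linear equations with smooth
    coefficients. *)
Lemma smooth_at_gamma u v : smooth_at (fun z => gamma G z u v) (F x).
Proof.
apply: (smooth_at_solve iG (nbhs_singleton sG)) => w.
have E : \forall z \near F x, 2^-1 *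
   ('D_u (fun y => G y v w) z + 'D_v (fun y => G y u w) z - 'D_w (fun y => G y u v) z) =
   G z (gamma G z u v) w.
  by apply: filterS nG => z [iz dz]; rewrite gammaE.
apply: smooth_at_near E _; apply: smooth_atM; first exact: smooth_at_cst.
have sGx := nbhs_singleton sG.
by apply: smooth_atB; first apply: smooth_atD; apply: smooth_at_derive.
Qed.

Lemma smooth_at_gamma_along (X Y : 'rV[R]_m -> 'rV[R]_n) :
  smooth_at X x -> smooth_at Y x -> smooth_at (fun z => gamma G (F z) (X z) (Y z)) x.
Proof.
have cF : {for x, continuous F}.
  exact: differentiable_continuous (smooth_at_differentiable sF).
have nGF := near_continuous cF nG.
move=> sX sY; apply/smooth_at_coordP => j.
apply: (smooth_at_moving (L := fun z b => gamma G (F z) (X z) b ord0 j)) sY => [|b].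
  by apply: filterS nGF => z [iz dz] c a a'; rewrite (gamma_lin iz dz) !mxE.
apply: (smooth_at_moving (L := fun z a => gamma G (F z) a b ord0 j)) sX => [|a].
  apply: filterS nGF => z [iz dz] c a a'.
  by rewrite !(gamma_sym iz dz _ b) (gamma_lin iz dz) !mxE.
exact: ((smooth_at_coordP _ _).1 (smooth_at_comp (f := fun z => gamma G z a b) sF (smooth_at_gamma a b)) j).
Qed.

Lemma smooth_at_nabla u (Y : 'rV[R]_m -> 'rV[R]_n) : smooth_at Y x ->
  smooth_at (fun z => nabla F G z u Y) x.
Proof.
move=> sY; apply: smooth_atD; first exact: smooth_at_derive.
by apply: smooth_at_gamma_along => //; exact: smooth_at_derive.
Qed.

End SmoothConnection.

(** * Umbilic operators on a hyperplane *)

Section ScalarOperators.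
Context {R : realType} {k : nat}.
Local Notation U := 'rV[R]_k.+3.
Variables (h : U -> U -> R) (J A : U -> U).
Hypotheses (ih : inner_product h) (lJ : lin J) (lA : lin A).
Hypotheses (JJ : forall u, J (J u) = - u) (Jh : forall u v, h (J u) (J v) = h u v).
Hypothesis A_sym : forall u v, h (A u) v = h u (A v).
Hypothesis A_line : forall u, exists a b, A u = a *: u + b *: J u.

Let hZ c u v : h (c *: u) v = c * h u v.
Proof.
have [hl _ _] := ih; have h0 := hl 1 0 0 v; have := hl c u 0 v.
by rewrite !addr0; move: h0; rewrite scale1r addr0; lra.
Qed.

Let hD u u' v : h (u + u') v = h u v + h u' v.
Proof. by have [hl _ _] := ih; have := hl 1 u u' v; rewrite scale1r mul1r. Qed.

Let hS u v : h u v = h v u. Proof. by case: ih. Qed.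

Let hN u v : h (- u) v = - h u v.
Proof. by rewrite -scaleN1r hZ mulN1r. Qed.

Let hp u : u != 0 -> h u u != 0.
Proof. by move=> u0; case: ih => _ _ hp; apply: lt0r_neq0; exact: hp. Qed.

Lemma J_orth u : h (J u) u = 0.
Proof. by have := Jh (J u) u; rewrite JJ hN (hS u); lra. Qed.

(** Orthogonality to u and v imposes two equations, in dimension at least 3. *)
Lemma orthogonal_vector u v : exists2 w : U, w != 0 & h w u = 0 /\ h w v = 0.
Proof.
pose M : 'M[R]_(k.+3, 2) := gram h *m row_mx u^T v^T.
have : kermx M != 0.
  rewrite -mxrank_eq0 mxrank_ker -lt0n subn_gt0 ltnS.
  by apply: leq_trans (rank_leq_col M) _.
case/rowV0Pn => w /sub_kermxP wM w0; exists w => //.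
have E (x : U) : h w x = (w *m gram h *m x^T) ord0 ord0 by rewrite gram_formE.
have : w *m gram h *m row_mx u^T v^T = 0 by rewrite -mulmxA.
rewrite mul_mx_row => /eqP; rewrite row_mx_eq0 => /andP[/eqP H1 /eqP H2].
by rewrite !E H1 H2 !mxE.
Qed.

(** Let A x = a x + b J x.  The coefficient b does not vary: compare u and J u with
    a vector w orthogonal to both.  Self-adjointness, applied to u and J u,
    gives b + b = 0. *)
Lemma eigen_everywhere u : exists a, A u = a *: u.
Proof.
have [->|u0] := eqVneq u 0.
  by exists 0; rewrite (lin_0 lA) scale0r.
have [w w0 [wu wJu]] := orthogonal_vector u (J u).
have AD := lin_D lA; have JD := lin_D lJ.
(* The J-component of A is the same on two orthogonal complex lines: compare
   the values of A at x, w and x + w. *)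
have key x : x != 0 -> h w x = 0 -> h w (J x) = 0 -> forall a b a' b',
    A x = a *: x + b *: J x -> A w = a' *: w + b' *: J w -> b = b'.
  move=> x0 wx wJx a b a' b' Ax Aw.
  have [c [d Axw]] := A_line (x + w).
  have Jwx : h (J w) x = 0 by rewrite -Jh JJ hN wJx oppr0.
  have JwJx : h (J w) (J x) = 0 by rewrite Jh.
  have JxJx : h (J x) (J x) != 0 by rewrite Jh; exact: hp.
  have JwJw : h (J w) (J w) != 0 by rewrite Jh; exact: hp.
  have E : a *: x + b *: J x + (a' *: w + b' *: J w) =
     c *: x + c *: w + (d *: J x + d *: J w).
    by rewrite -Ax -Aw -AD Axw JD !scalerDr.
  have bd : b = d.
    have := congr1 (fun z => h z (J x)) E; rewrite !hD !hZ wJx JwJx (hS x) J_orth.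
    by rewrite !mulr0 !addr0 !add0r => /(mulIf JxJx).
  have b'd : b' = d.
    have := congr1 (fun z => h z (J w)) E; rewrite !hD !hZ (hS w (J w)) J_orth.
    rewrite (hS x (J w)) Jwx (hS (J x)) JwJx !mulr0 !add0r => /(mulIf JwJw) //.
  by rewrite bd b'd.
have [a' [b' Aw]] := A_line w.
have [a [b Au]] := A_line u; have [c [d AJu]] := A_line (J u).
have Ju0 : J u != 0.
  by apply/eqP => Ju0; have := hp u0; rewrite -Jh Ju0 -[0](scale0r u) hZ mul0r eqxx.
have bb' : b = b' by apply: (key u) Au Aw.
have db' : d = b'.
  apply: (key (J u)) AJu Aw => //.
  by rewrite JJ hS hN hS wu oppr0.
have : b + d = 0.
  have := A_sym u (J u); rewrite Au AJu JJ (hS u) !hD !hZ hN (hS u (J u)) J_orth Jh.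
  rewrite !mulr0 !add0r => E; apply: (mulIf (hp u0)); rewrite mul0r mulrDl; lra.
rewrite bb' db' => b0; have b'0 : b' = 0 by lra.
by exists a; rewrite Au bb' b'0 scale0r addr0.
Qed.

(** An operator for which every vector is an eigenvector has one eigenvalue. *)
Lemma scalar_operator : exists a, forall u, A u = a *: u.
Proof.
pose e : U := const_mx 1.
have e0 : e != 0.
  by apply/eqP => /matrixP/(_ ord0 ord0); rewrite !mxE => /eqP; rewrite oner_eq0.
have [a Ae] := eigen_everywhere e; exists a => u.
have AZ := lin_Z lA; have AD := lin_D lA.
have [b Au] := eigen_everywhere u; have [c Aeu] := eigen_everywhere (e + u).
have E : (a - c) *: e = (c - b) *: u.
  have := Aeu; rewrite AD Ae Au scalerDr => H; rewrite !scalerBl.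
  by apply/eqP; rewrite subr_eq addrAC eq_sym subr_eq addrC -H.
have [cb|cb] := eqVneq (c - b) 0.
  move: E; rewrite cb scale0r => /eqP; rewrite scaler_eq0 (negPf e0) orbF subr_eq0.
  by move=> /eqP ac; rewrite Au ac; congr (_ *: _); apply/esym/eqP; rewrite -subr_eq0 cb.
have -> : u = ((c - b)^-1 * (a - c)) *: e.
  by rewrite -scalerA E scalerA mulVf // scale1r.
by rewrite AZ Ae !scalerA mulrC.
Qed.

End ScalarOperators.

Section Hyperplane.
Context {R : realType}.
Local Notation V := 'rV[R]_7.
Local Notation U := 'rV[R]_6.
Variables (g : V -> V -> R) (f : nat -> V) (phi : V -> V -> V -> R) (B : V -> V -> V).
Hypotheses (ig : inner_product g) (og : orthonormal7 g f).
Hypotheses (phi1 : forall b c, lin (fun a => phi a b c : R^o)).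
Hypotheses (phi12 : forall a b c, phi a b c = - phi b a c)
           (phi23 : forall a b c, phi a b c = - phi a c b).
Hypothesis phif : G2_components phi f.
Hypothesis BE : forall u v w, g (B u v) w = phi u v w.

Let gS a b : g a b = g b a. Proof. by case: ig. Qed.

Let gZ c u v : g (c *: u) v = c * g u v.
Proof.
have [hl _ _] := ig; have h0 := hl 1 0 0 v; have := hl c u 0 v.
by rewrite !addr0; move: h0; rewrite scale1r addr0; lra.
Qed.

Let gD u u' v : g (u + u') v = g u v + g u' v.
Proof. by have [hl _ _] := ig; have := hl 1 u u' v; rewrite scale1r mul1r. Qed.

Let gN u v : g (- u) v = - g u v.
Proof. by rewrite -scaleN1r gZ mulN1r. Qed.

Lemma cross_inner a b d : g (B a b) (B a d) = g a a * g b d - g a d * g b a.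
Proof.
have [s12 s23 _] := psi4_alternating ig og phi1 phi12 phi23 phif BE.
have := s12 a b a d; have := s23 b a a d; rewrite /psi4 -!BE; lra.
Qed.

Lemma cross_cross a b : B a (B a b) = g a b *: a - g a a *: b.
Proof.
apply: (inner_product_inj ig) => z; rewrite gD gN !gZ BE phi23 -BE cross_inner.
by rewrite (gS z b) (gS z a); ring.
Qed.

Variables (D : U -> V) (n : V) (xi : U -> U).
Hypotheses (lD : lin D) (D_inj : injective D).
Hypotheses (nn : g n n = 1) (nD : forall u, g n (D u) = 0).
Hypothesis xiE : forall u, D (xi u) = B n (D u).

Let D0 := lin_0 lD. Let DD := lin_D lD. Let DZ := lin_Z lD. Let DN := lin_N lD.

Lemma xi_lin : lin xi.
Proof.
move=> c u v; apply: D_inj; rewrite xiE !lD !xiE.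
exact: (B_lin2 ig phi1 phi12 BE).
Qed.

Lemma xi_sq u : xi (xi u) = - u.
Proof.
by apply: D_inj; rewrite !xiE cross_cross nn nD scale0r sub0r scale1r DN.
Qed.

Lemma xi_isometry u v : g (D (xi u)) (D (xi v)) = g (D u) (D v).
Proof. by rewrite !xiE cross_inner nn mul1r nD mul0r subr0. Qed.

Lemma tangent_inner_product : inner_product (fun u v => g (D u) (D v)).
Proof.
split=> [c u v w|u v|u u0]; first by rewrite DD DZ gD gZ.
  exact: gS.
case: ig => _ _; apply; apply/eqP => Du; move: u0; rewrite -(inj_eq D_inj) D0 Du.
by rewrite eqxx.
Qed.

(** The normal and the image of the hyperplane span the whole space. *)
Lemma normal_complement e : g e n = 0 -> (forall u, g e (D u) = 0) -> e = 0.
Proof.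
move=> en eD.
pose K : 'M[R]_(6 + 1, 7) := col_mx (\matrix_i D (stdb i)) n.
have rowK (v : 'rV[R]_(6 + 1)) : v *m K = D (lsubmx v) + rsubmx v ord0 ord0 *: n.
  rewrite -[v in LHS]hsubmxK mul_row_col; congr (_ + _).
    rewrite mulmx_sum_row [in RHS](rV_sum (lsubmx v)) (big_morph D DD D0).
    by apply: eq_bigr => i _; rewrite DZ rowK.
  by rewrite [rsubmx v]mx11_scalar mul_scalar_mx !mxE.
have K_unit : K \in unitmx.
  rewrite unitmxE unitfE; apply/negP => /det0P[v v0]; rewrite rowK => E.
  have r0 : rsubmx v ord0 ord0 = 0.
    have := congr1 (fun z => g z n) E; rewrite gD gZ nn mulr1 (gS _ n) nD add0r => ->.
    by rewrite -[0](scale0r n) gZ mul0r.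
  have l0 : lsubmx v = 0.
    by apply: D_inj; move: E; rewrite r0 scale0r addr0 D0.
  move/eqP: v0; apply; rewrite -[v]hsubmxK l0 [rsubmx v]mx11_scalar r0.
  by apply/rowP => i; rewrite mxE; case: splitP => j _; rewrite !mxE // mul0rn.
apply: (inner_product_inj ig) => w.
have -> : w = w *m invmx K *m K by rewrite mulmxKV.
rewrite rowK (gS e) gD gZ !(gS _ e) eD en mulr0 addr0.
by rewrite -[0 in RHS](scale0r (w : V)) gZ mul0r.
Qed.

(** The hypothesis on phi says that D u x D (A u) is orthogonal to the hyperplane,
    hence equal to k n.  Applying D u x _ to this, with [cross_cross], expresses
    A u by u and J u, where J is xi. *)
Lemma umbilic_operator (A : U -> U) : lin A ->
  (forall u v, g (D (A u)) (D v) = g (D u) (D (A v))) ->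
  (forall u w, phi (D (A u)) (D u) (D w) = 0) ->
  exists a, forall u, A u = a *: u.
Proof.
move=> lA A_sym A_phi.
apply: (scalar_operator tangent_inner_product xi_lin lA xi_sq xi_isometry A_sym) => u.
have [->|u0] := eqVneq u 0.
  by exists 0, 0; rewrite (lin_0 lA) !scale0r addr0.
have uu : g (D u) (D u) != 0.
  by have [_ _ hp] := tangent_inner_product; apply: lt0r_neq0; exact: hp.
pose k := g (B (D u) (D (A u))) n.
have Bk : B (D u) (D (A u)) = k *: n.
  apply/eqP; rewrite -subr_eq0; apply/eqP/normal_complement.
    by rewrite gD gN gZ nn mulr1 subrr.
  by move=> w; rewrite gD gN gZ nD mulr0 subr0 BE phi12 A_phi oppr0.
have := cross_cross (D u) (D (A u)); rewrite Bk.
have -> : B (D u) (k *: n) = - (k *: D (xi u)).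
  rewrite (B_skew ig phi12 BE); congr (- _).
  by rewrite (lin_Z (B_lin1 ig phi1 BE (D u))) xiE.
move=> E; set s := g (D u) (D u) in uu E; set t := g (D u) (D (A u)) in E.
exists (t / s), (k / s); apply: D_inj; rewrite DD !DZ.
apply: (scalerI uu); rewrite scalerDr !scalerA !(mulrCA s) divff // !mulr1.
by rewrite -[k *: _]opprK E opprB addrC subrK.
Qed.

End Hyperplane.

(** * Changes of charts *)

Lemma metric_rep_coord (R : realType) n (M : manifold R n) (c : chart R n M) (g : metric_field M) q
    (u v : tangent q) : atlas c -> cdom c q ->
  metric_rep g c (ccoord c q) (to_chart c u) (to_chart c v) = g q u v.
Proof. by move=> ac cq; rewrite /metric_rep /metric_in_chart ccoordK // !to_chartK. Qed.

Section ChartsAlongMap.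
Context {R : realType} {m n : nat} {M : manifold R m} {M' : manifold R n} (F : M -> M').
Hypothesis sF : smooth_map F.
Implicit Types (c : chart R m M) (p q : M).

Lemma push_to_chart c (c' : chart R n M') q (u : tangent q) : atlas c -> atlas c' -> cdom c q ->
  cdom c' (F q) ->
  to_chart c' (tangent_map F u) = 'D_(to_chart c u) (local_rep F c c') (ccoord c q).
Proof.
move=> ac ac' cq cFq; rewrite (to_chart_tangent_map u sF ac ac' cq cFq) deriveE //.
exact: smooth_at_differentiable (smooth_at_local_rep sF ac ac' cq cFq).
Qed.

Lemma push_of_chart c (c' : chart R n M') q w : atlas c -> atlas c' -> cdom c q -> cdom c' (F q) ->
  to_chart c' (tangent_map F (of_chart c q w)) = 'D_w (local_rep F c c') (ccoord c q).
Proof. by move=> ac ac' cq cFq; rewrite (push_to_chart _ ac ac' cq cFq) of_chartK. Qed.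

Lemma tangent_mapE p (u : tangent p) :
  tangent_map F u = 'D_u (local_rep F (chart_at p) (chart_at (F p))) (coord_at p).
Proof.
have := push_to_chart u (atlas_chart_at p) (atlas_chart_at (F p)) (cdom_chart_at p)
  (cdom_chart_at (F p)).
by rewrite !to_chart_at.
Qed.

Lemma tangent_map_lin p : lin (@tangent_map R m n M M' F p : 'rV[R]_m -> 'rV[R]_n).
Proof. by move=> k a b; rewrite /tangent_map linearP. Qed.

Lemma near_chart_points c (c' : chart R n M') p (P : 'rV[R]_m -> Prop) : cdom c p -> cdom c' (F p) ->
  (forall q, cdom c q -> cdom c' (F q) -> P (ccoord c q)) ->
  \forall z \near ccoord c p, P z.
Proof.
move=> cp cFp H; apply: filterS (near_overlap (sF.1 p) cp cFp) => z [q [cq cFq] <-].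
exact: H.
Qed.

Lemma field_in_charts_coord (Y : field_along F) c (c' : chart R n M') q : cdom c q ->
  field_in_charts Y c c' (ccoord c q) = to_chart c' (Y q).
Proof. by move=> cq; rewrite /field_in_charts ccoordK. Qed.

Lemma smooth_at_field (Y : field_along F) c (c' : chart R n M') q : smooth_along Y -> atlas c -> atlas c' ->
  cdom c q -> cdom c' (F q) -> smooth_at (field_in_charts Y c c') (ccoord c q).
Proof.
move=> sY ac ac' cq cFq; apply: smooth_on_at (sY _ _ ac ac').
exact: near_overlap (sF.1 q) cq cFq.
Qed.

Variable g : metric_field M'.

(** The chart expression of the induced metric is the pull-back by the chart
    expression of F, in any charts around the point. *)
Lemma metric_rep_induced c (c' : chart R n M') q u v : atlas c -> atlas c' -> cdom c q -> cdom c' (F q) ->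
  metric_rep (induced_metric F g) c (ccoord c q) u v =
  metric_rep g c' (local_rep F c c' (ccoord c q))
    ('D_u (local_rep F c c') (ccoord c q)) ('D_v (local_rep F c c') (ccoord c q)).
Proof.
move=> ac ac' cq cFq.
have E := metric_rep_coord g (tangent_map F (of_chart c q u)) (tangent_map F (of_chart c q v)) ac' cFq.
rewrite (push_of_chart u ac ac' cq cFq) (push_of_chart v ac ac' cq cFq) in E.
rewrite (local_rep_coord F c' cq) E.
rewrite /metric_rep /metric_in_chart.
by rewrite ccoordK.
Qed.

Lemma induced_metric_riemannian : riemannian_metric g ->
  (forall p, injective (@tangent_map R m n M M' F p)) ->
  riemannian_metric (induced_metric F g).
Proof.
move=> rg Finj; split=> [p|c u v ac].
  have [gl gs gp] := rg.1 (F p); split=> [k u v w|u v|u u0]; rewrite /induced_metric.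
  - by rewrite tangent_map_lin gl.
  - exact: gs.
  - apply: gp; apply/eqP => Fu; move/eqP: u0; apply; apply: Finj.
    exact: etrans Fu (esym (lin_0 (tangent_map_lin p))).
apply: smooth_at_on => x [q cq <-{x}]; set c' := chart_at (F q).
have ac' : atlas c' by exact: atlas_chart_at.
have cFq : cdom c' (F q) by exact: cdom_chart_at.
have sL := smooth_at_local_rep sF ac ac' cq cFq.
have iG : \forall z \near local_rep F c c' (ccoord c q), inner_product (metric_rep g c' z).
  by rewrite local_rep_coord //; exact: near_metric_rep_inner.
have sG u' v' : smooth_at (fun z => metric_rep g c' z u' v') (local_rep F c c' (ccoord c q)).
  by rewrite local_rep_coord //; exact: smooth_at_metric_rep.
apply: smooth_at_near (smooth_at_metric_along sL iG sG (smooth_at_derive u sL) (smooth_at_derive v sL)).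
apply: (near_chart_points cq cFq) => q' cq' cFq' ; exact: esym (metric_rep_induced _ _ ac ac' cq' cFq').
Qed.

Lemma christoffelE p (u v : tangent (F p)) : christoffel g u v =
  gamma (metric_rep g (chart_at (F p))) (coord_at (F p)) u v.
Proof. by rewrite /christoffel /gamma metric_rep_at. Qed.

Lemma cov_deriv_alongE (Y : field_along F) p (u : tangent p) :
  cov_deriv_along g Y u =
  nabla (local_rep F (chart_at p) (chart_at (F p))) (metric_rep g (chart_at (F p)))
    (coord_at p) u (field_in_charts Y (chart_at p) (chart_at (F p))).
Proof.
have E1 : local_rep F (chart_at p) (chart_at (F p)) (coord_at p) = coord_at (F p) :=
  local_rep_coord F (chart_at (F p)) (cdom_chart_at p).
have E2 : field_in_charts Y (chart_at p) (chart_at (F p)) (coord_at p) = Y p :=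
  etrans (field_in_charts_coord Y (chart_at (F p)) (cdom_chart_at p)) (to_chart_at (Y p)).
by rewrite /cov_deriv_along /nabla christoffelE -tangent_mapE -E1 E2.
Qed.

End ChartsAlongMap.

Section ChartInvariance.
Context {R : realType}.

Lemma induced_metric_id n (M : manifold R n) (g : metric_field M) : induced_metric idfun g = g.
Proof.
apply: boolp.functional_extensionality_dep => p; apply/funext => u; apply/funext => v.
by rewrite /induced_metric !tangent_map_id.
Qed.

Lemma metric_rep_change n (M : manifold R n) (g : metric_field M) (c c' : chart R n M) q :
  atlas c -> atlas c' -> cdom c q -> cdom c' q ->
  \forall z \near ccoord c q, forall u v, metric_rep g c z u v =
    metric_rep g c' (local_rep idfun c c' z) ('D_u (local_rep idfun c c') z)
      ('D_v (local_rep idfun c c') z).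
Proof.
move=> ac ac' cq c'q; apply: (near_chart_points (smooth_map_id M) cq c'q) => q' cq' c'q' u v.
have := metric_rep_induced (smooth_map_id M) g u v ac ac' cq' c'q'.
by rewrite induced_metric_id.
Qed.

Context {m n : nat} {M : manifold R m} {M' : manifold R n} (F : M -> M') (g : metric_field M').
Hypotheses (sF : smooth_map F) (rg : riemannian_metric g).

(** [cov_deriv_along] is defined with the charts [chart_at]; this is its value in
    arbitrary charts.  A change of chart on the source is a reparametrisation
    ([nabla_comp]), on the target an isometry between two chart expressions of the
    metric ([nabla_isometry]). *)
Lemma cov_deriv_in_charts (Y : field_along F) (c : chart R m M) (c' : chart R n M') q
    (u : tangent q) (w : tangent (F q)) :
  smooth_along Y -> atlas c -> atlas c' -> cdom c q -> cdom c' (F q) ->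
  metric_rep g c' (local_rep F c c' (ccoord c q))
    (nabla (local_rep F c c') (metric_rep g c') (ccoord c q) (to_chart c u)
      (field_in_charts Y c c')) (to_chart c' w) = @g (F q) (cov_deriv_along g Y u) w.
Proof.
move=> sY ac ac' cq cFq.
set c1 := chart_at q; set c1' := chart_at (F q).
have ac1 : atlas c1 by exact: atlas_chart_at.
have ac1' : atlas c1' by exact: atlas_chart_at.
have c1q : cdom c1 q by exact: cdom_chart_at.
have c1Fq : cdom c1' (F q) by exact: cdom_chart_at.
pose S := local_rep idfun c1 c; pose T := local_rep idfun c' c1'.
pose Fh := local_rep F c c'; pose Yh := field_in_charts Y c c'.
have Sx : S (ccoord c1 q) = ccoord c q := local_rep_coord (@idfun M) c c1q.
have Fx : Fh (ccoord c q) = ccoord c' (F q) := local_rep_coord F c' cq.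
have sS : smooth_at S (ccoord c1 q) := smooth_at_transition ac1 ac c1q cq.
have dS := smooth_at_differentiable sS.
have sFh : smooth_at Fh (S (ccoord c1 q)).
  by rewrite Sx; exact: (smooth_at_local_rep sF ac ac' cq cFq).
have sYh : smooth_at Yh (S (ccoord c1 q)).
  by rewrite Sx; exact: (smooth_at_field sF sY ac ac' cq cFq).
have FSx : Fh (S (ccoord c1 q)) = ccoord c' (F q) by rewrite Sx.
have sT : smooth_at T (Fh (S (ccoord c1 q))).
  by rewrite FSx; exact: (smooth_at_transition ac' ac1' cFq c1Fq).
have TFSx : T (Fh (S (ccoord c1 q))) = ccoord c1' (F q).
  by rewrite FSx; exact: (local_rep_coord (@idfun M') c1' cFq).
have dFS : differentiable (fun z => Fh (S z)) (ccoord c1 q).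
  exact: (differentiable_comp dS (smooth_at_differentiable sFh)).
have dYS : differentiable (fun z => Yh (S z)) (ccoord c1 q).
  exact: (differentiable_comp dS (smooth_at_differentiable sYh)).
have iG1 : \forall z \near T (Fh (S (ccoord c1 q))), inner_product (metric_rep g c1' z).
  by rewrite TFSx; exact: (near_metric_rep_inner rg ac1' c1Fq).
have sG1 a b : smooth_at (fun z => metric_rep g c1' z a b) (T (Fh (S (ccoord c1 q)))).
  by rewrite TFSx; exact: (smooth_at_metric_rep a b rg ac1' c1Fq).
have iG : \forall z \near Fh (S (ccoord c1 q)), inner_product (metric_rep g c' z).
  by rewrite FSx; exact: (near_metric_rep_inner rg ac' cFq).
have gE : \forall z \near Fh (S (ccoord c1 q)), forall a b, metric_rep g c' z a b =
    metric_rep g c1' (T z) ('D_a T z) ('D_b T z).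
  by rewrite FSx; exact: (metric_rep_change g ac' ac1' cFq c1Fq).
have near_q (P : 'rV[R]_m -> Prop) : (forall q', cdom c1 q' -> cdom c q' -> cdom c' (F q') ->
    cdom c1' (F q') -> P (ccoord c1 q')) -> \forall z \near ccoord c1 q, P z.
  move=> H; apply: filterS2 (near_overlap (sF.1 q) c1q cFq)
    (filterI (near_overlap (c := c1) (c' := c) (F := @idfun M) (@cvg_id _ _) c1q cq)
      (near_overlap (sF.1 q) c1q c1Fq)).
  move=> z [q1 [d1 e1] E1] [[q2 [d2 e2] E2] [q3 [d3 e3] E3]].
  have q12 : q2 = q1 by rewrite -(ccoordK d2) -(ccoordK d1) E1 E2.
  have q13 : q3 = q1 by rewrite -(ccoordK d3) -(ccoordK d1) E1 E3.
  by rewrite -E1; apply: H; rewrite // -?q12 // q12 -q13.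
have H := nabla_isometry dFS sT iG1 sG1 gE iG (u : 'rV[R]_m) (to_chart c' w) dYS.
have wE : 'D_(to_chart c' w) T (Fh (S (ccoord c1 q))) = w.
  rewrite FSx -[RHS](to_chartK w ac' cFq) of_chartE deriveE //.
  by rewrite -FSx; exact: smooth_at_differentiable.
have uE : 'D_(u : 'rV[R]_m) S (ccoord c1 q) = to_chart c u by rewrite deriveE.
rewrite wE TFSx (nabla_comp _ _ dS (smooth_at_differentiable sFh) (smooth_at_differentiable sYh)) in H.
rewrite uE Sx in H.
rewrite -/Fh -/Yh -H (cov_deriv_alongE sF).
suff <- : nabla (fun z => T (Fh (S z))) (metric_rep g c1') (ccoord c1 q) (u : 'rV[R]_m)
    (fun z => 'D_(Yh (S z)) T (Fh (S z))) =
  nabla (local_rep F c1 c1') (metric_rep g c1') (ccoord c1 q) (u : 'rV[R]_m) (field_in_charts Y c1 c1').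
  have := metric_rep_at g (F q); rewrite /coord_at -/c1' => ->.
  exact: erefl.
apply: nabla_near.
  apply: near_q => q' d1 d2 d3 d4.
  rewrite /S (local_rep_coord (@idfun M) c d1) /Fh (local_rep_coord F c' d2).
  by rewrite /T (local_rep_coord (@idfun M') c1' d3) (local_rep_coord F c1' d1).
apply: near_q => q' d1 d2 d3 d4.
rewrite /S (local_rep_coord (@idfun M) c d1) /Fh (local_rep_coord F c' d2) /Yh.
rewrite (field_in_charts_coord Y c' d2) (field_in_charts_coord Y c1' d1).
have := push_to_chart (smooth_map_id M') (Y q') ac' ac1' d3 d4.
by rewrite tangent_map_id.
Qed.

End ChartInvariance.

(** * Hypersurfaces of nearly G2 manifolds *)

Section Hypersurface.
Context {R : realType} (Mbar : manifold R 7) (phi : form_field Mbar 3)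
  (gbar : metric_field Mbar) (vol : form_field Mbar 7)
  (B : forall x : Mbar, tangent x -> tangent x -> tangent x)
  (M : manifold R 6) (iota : M -> Mbar) (N : field_along iota) (A xi : endo_field M).
Hypotheses (hphi : G2_structure phi) (hg : G2_metric phi gbar vol)
  (hnG2 : nearly_G2 phi gbar vol) (hB : cross_product phi gbar B)
  (hiota : immersion iota) (hN : unit_normal gbar N) (hA : shape_operator gbar N A)
  (hxi : forall (p : M) (u : tangent p),
     tangent_map iota (xi u) = B (N p) (tangent_map iota u)).
Local Notation U := 'rV[R]_6.
Local Notation V := 'rV[R]_7.
Local Notation g := (induced_metric iota gbar).
Local Notation Phi := (phi_rep phi).
Local Notation G := (metric_rep gbar).

Let sF : smooth_map iota := hiota.1.
Let Finj : forall p, injective (@tangent_map R _ _ M Mbar iota p) := hiota.2.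
Let rG : riemannian_metric gbar. Proof. by case: hg. Qed.
Let rg : riemannian_metric g := induced_metric_riemannian sF rG Finj.
Let sN : smooth_along N. Proof. by case: hN. Qed.

Lemma phi_rep_coord (c : chart R 7 Mbar) q (a b d : tangent q) : atlas c -> cdom c q ->
  Phi c (ccoord c q) (to_chart c a) (to_chart c b) (to_chart c d) = @phi q (vec3 a b d).
Proof. by move=> ac cq; rewrite phi_repE ccoordK // !to_chartK. Qed.

Lemma phi_rep_at q (a b d : tangent q) :
  Phi (chart_at q) (coord_at q) a b d = @phi q (vec3 a b d).
Proof.
have := phi_rep_coord a b d (atlas_chart_at q) (cdom_chart_at q).
by rewrite !to_chart_at.
Qed.

Lemma xi_in_charts (c : chart R 6 M) (c' : chart R 7 Mbar) q (v : tangent q) b :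
  atlas c -> atlas c' -> cdom c q -> cdom c' (iota q) ->
  G c' (local_rep iota c c' (ccoord c q))
    ('D_(to_chart c (xi v)) (local_rep iota c c') (ccoord c q)) b =
  Phi c' (local_rep iota c c' (ccoord c q)) (field_in_charts N c c' (ccoord c q))
    ('D_(to_chart c v) (local_rep iota c c') (ccoord c q)) b.
Proof.
move=> ac ac' cq cFq.
have E := hB (N q) (tangent_map iota v) (of_chart c' (iota q) b).
have E1 := metric_rep_coord gbar (tangent_map iota (xi v)) (of_chart c' (iota q) b) ac' cFq.
have E2 := phi_rep_coord (N q) (tangent_map iota v) (of_chart c' (iota q) b) ac' cFq.
have E3 : @gbar (iota q) (tangent_map iota (xi v)) (of_chart c' (iota q) b) =
    @phi (iota q) (vec3 (N q) (tangent_map iota v) (of_chart c' (iota q) b)).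
  by rewrite hxi.
have E4 := etrans E1 (etrans E3 (esym E2)).
rewrite (of_chartK b ac' cFq) in E4.
rewrite (push_to_chart sF (xi v) ac ac' cq cFq) (push_to_chart sF v ac ac' cq cFq) in E4.
rewrite (local_rep_coord iota c' cq) (field_in_charts_coord N c' cq); exact: E4.
Qed.

Section InCharts.
Variables (c : chart R 6 M) (c' : chart R 7 Mbar) (q : M).
Hypotheses (ac : atlas c) (ac' : atlas c') (cq : cdom c q) (cFq : cdom c' (iota q)).
Local Notation Fh := (local_rep iota c c').
Local Notation Nh := (field_in_charts N c c').
Local Notation x := (ccoord c q).

Lemma immersion_rep_smooth : smooth_at Fh x.
Proof. exact: (smooth_at_local_rep sF ac ac' cq cFq). Qed.

Lemma normal_rep_smooth : smooth_at Nh x.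
Proof. exact: (smooth_at_field sF sN ac ac' cq cFq). Qed.

Let Fx : Fh x = ccoord c' (iota q) := local_rep_coord iota c' cq.

Lemma ambient_metric_near : \forall z \near Fh x, inner_product (G c' z) /\
  forall u v, smooth_at (fun y => G c' y u v) z.
Proof.
rewrite Fx; apply: (near_chart_points (smooth_map_id Mbar) cFq cFq) => q' cq' _; split.
  by apply: metric_rep_inner => //; rewrite ccoordK.
by move=> u v; exact: (smooth_at_metric_rep u v rG ac' cq').
Qed.

Lemma ambient_metric_inner : \forall z \near Fh x, inner_product (G c' z).
Proof. by apply: filterS ambient_metric_near => z []. Qed.

Lemma ambient_metric_smooth u v : smooth_at (fun y => G c' y u v) (Fh x).
Proof. by have [_] := nbhs_singleton ambient_metric_near. Qed.

Lemma ambient_phi_smooth a b d : smooth_at (fun y => Phi c' y a b d) (Fh x).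
Proof. rewrite Fx; exact: (smooth_at_phi_rep hphi a b d ac' cFq). Qed.

Lemma induced_metric_near : \forall z \near x, forall u v,
  metric_rep g c z u v = G c' (Fh z) ('D_u Fh z) ('D_v Fh z).
Proof.
apply: (near_chart_points sF cq cFq) => q' cq' cFq' u v.
exact: (metric_rep_induced sF gbar u v ac ac' cq' cFq').
Qed.

Lemma normal_orthogonal_near : \forall z \near x, forall u, G c' (Fh z) (Nh z) ('D_u Fh z) = 0.
Proof.
apply: (near_chart_points sF cq cFq) => q' cq' cFq' u.
have [_ _ N0] := hN; have := N0 q' (of_chart c q' u).
rewrite -(metric_rep_coord gbar _ _ ac' cFq') (push_of_chart sF _ ac ac' cq' cFq').
by rewrite (local_rep_coord iota c' cq') (field_in_charts_coord N c' cq').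
Qed.

(** The inner products of xi W with fixed vectors are values of phi. *)
Lemma smooth_xi_in_chart (W : U -> U) : smooth_at W x ->
  smooth_at (fun z => to_chart c (xi (of_chart c (cparam c z) (W z)))) x.
Proof.
move=> sW; apply: (smooth_at_solve (g := metric_rep g c)).
- exact: (near_metric_rep_inner rg ac cq).
- by move=> a b; exact: (smooth_at_metric_rep a b rg ac cq).
move=> a.
have sI : smooth_at (fun z : U => z) x := smooth_at_id x.
have sW' := smooth_moving_direction (smooth_at_differentiable sI) immersion_rep_smooth sI sW.
have H := smooth_at_phi_along immersion_rep_smooth (@phi_rep_lin _ _ _ hphi c') (@phi_rep12 _ _ _ hphi c')
  (@phi_rep23 _ _ _ hphi c') ambient_phi_smooth normal_rep_smooth sW' (smooth_at_derive a immersion_rep_smooth).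
apply: smooth_at_near H.
apply: (near_chart_points sF cq cFq) => q' cq' cFq'.
have E := xi_in_charts (of_chart c q' (W (ccoord c q'))) ('D_a Fh (ccoord c q')) ac ac' cq' cFq'.
rewrite of_chartK // in E; rewrite -E ccoordK //.
by rewrite (metric_rep_induced sF gbar _ _ ac ac' cq' cFq').
Qed.

End InCharts.

Let phi_at q : (fun a b d => @phi q (vec3 a b d)) = Phi (chart_at q) (coord_at q).
Proof. by apply/funext => a; apply/funext => b; apply/funext => d; rewrite phi_rep_at. Qed.

Let BE q (a b d : tangent q) : @gbar q (B a b) d = Phi (chart_at q) (coord_at q) a b d.
Proof. by rewrite phi_rep_at; exact: hB. Qed.

Let Glin p : lin (@tangent_map R _ _ M Mbar iota p : U -> V) := tangent_map_lin iota p.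

Lemma xi_linear p : lin (@xi p : U -> U).
Proof.
exact: (xi_lin (rG.1 (iota p)) (@phi_rep_lin _ _ _ hphi _ _) (@phi_rep12 _ _ _ hphi _ _)
  (@BE (iota p)) (Glin p) (@Finj p) (@hxi p)).
Qed.

Lemma hypersurface_almost_hermitian : almost_hermitian g xi.
Proof.
have [_ NN N0] := hN.
split=> [|||p u v].
- exact: rg.
- split=> [p a u v|c w ac]; first exact: xi_linear.
  apply: smooth_at_on => x [q cq <-].
  exact: (smooth_xi_in_chart ac (atlas_chart_at (iota q)) cq (cdom_chart_at (iota q))
    (smooth_at_cst w _)).
- move=> p u; have [f [of_ cf _]] := G2_point hphi hg (iota p).
  rewrite phi_at in cf.
  exact: (xi_sq (rG.1 (iota p)) of_ (@phi_rep_lin _ _ _ hphi _ _) (@phi_rep12 _ _ _ hphi _ _)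
    (@phi_rep23 _ _ _ hphi _ _) cf (@BE (iota p)) (Glin p) (@Finj p) (NN p) (N0 p) (@hxi p)).
- have [f [of_ cf _]] := G2_point hphi hg (iota p).
  rewrite phi_at in cf.
  exact: (xi_isometry (rG.1 (iota p)) of_ (@phi_rep_lin _ _ _ hphi _ _) (@phi_rep12 _ _ _ hphi _ _)
    (@phi_rep23 _ _ _ hphi _ _) cf (@BE (iota p)) (NN p) (N0 p) (@hxi p)).
Qed.

Section AtAPoint.
Variable p : M.
Local Notation c := (chart_at p).
Local Notation c' := (chart_at (iota p)).
Local Notation x := (coord_at p).
Local Notation Fh := (local_rep iota c c').
Local Notation Nh := (field_in_charts N c c').
Let ac : atlas c := atlas_chart_at p.
Let ac' : atlas c' := atlas_chart_at (iota p).
Let cp : cdom c p := cdom_chart_at p.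
Let cFp : cdom c' (iota p) := cdom_chart_at (iota p).
Let Fx : Fh x = coord_at (iota p) := local_rep_coord iota c' cp.
Let sFh : smooth_at Fh x := immersion_rep_smooth ac ac' cp cFp.
Let sNh : smooth_at Nh x := normal_rep_smooth ac ac' cp cFp.
Let iG := ambient_metric_inner ac' cp cFp.

(** The Gauss formula: [nabla_isometry] for the chart expression of the immersion. *)
Lemma levi_civita_gauss (W : vector_field M) (u w : U) :
  smooth_at (field_in_charts W c c) x ->
  G c' (Fh x) (nabla Fh (G c') x u (fun z => 'D_(field_in_charts W c c z) Fh z)) ('D_w Fh x) =
  @g p (cov_deriv_along g W (p := p) u) w.
Proof.
move=> sW.
pose I := local_rep idfun c c.
have Ix : I x = x := local_rep_coord (@idfun M) c cp.
have nI : \forall z \near x, I z = z.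
  by apply: filterS (near_ccoordK cp) => z.
have sI : smooth_at I x := smooth_at_transition ac ac cp cp.
have H : G c' (Fh (I x)) (nabla (fun z => Fh (I z)) (G c') x u
      (fun z => 'D_(field_in_charts W c c z) Fh (I z))) ('D_w Fh (I x)) =
    metric_rep g c (I x) (nabla I (metric_rep g c) x u (field_in_charts W c c)) w.
  apply: nabla_isometry.
  - exact: (smooth_at_differentiable sI).
  - by rewrite Ix.
  - by rewrite Ix.
  - by rewrite Ix => a b; exact: (ambient_metric_smooth ac' cp cFp).
  - by rewrite Ix; exact: (induced_metric_near ac ac' cp cFp).
  - by rewrite Ix; exact: (near_metric_rep_inner rg ac cp).
  - exact: (smooth_at_differentiable sW).
rewrite Ix metric_rep_at in H.
rewrite (cov_deriv_alongE (smooth_map_id M)) -H.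
suff -> : nabla (fun z => Fh (I z)) (G c') x u (fun z => 'D_(field_in_charts W c c z) Fh (I z)) =
   nabla Fh (G c') x u (fun z => 'D_(field_in_charts W c c z) Fh z) by exact: erefl.
by apply: nabla_near; apply: filterS nI => z ->.
Qed.

Let gl : forall a u v w, @g p (a *: u + v) w = a * @g p u w + @g p v w.
Proof. by have [h _ _] := rg.1 p. Qed.

Let gS u v : @g p u v = @g p v u.
Proof. by have [_ h _] := rg.1 p. Qed.

Lemma xi_skew u w : @g p (xi u) w = - @g p u (xi w).
Proof.
rewrite (gS u) /induced_metric !hxi !BE.
exact: (@phi_rep23 _ _ _ hphi).
Qed.

Let nabN (u : U) : nabla Fh (G c') x u Nh = - tangent_map iota (A (u : tangent p)).
Proof. by rewrite hA opprK (cov_deriv_alongE sF). Qed.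

(** Of the three terms of [nabla_cross], the torsion term is 0 and the second one is
    the right-hand side, as D_u N = - dF (A u).  The third one is
    - g (nabla_u X, xi w) = g (xi (nabla_u X), w), which turns nabla_u (xi X) into
    (nabla_u xi) X. *)
Lemma nabla_xi (X : vector_field M) w : smooth_vector_field X ->
  @g p (cov_deriv_endo g xi X X p) w =
  - Phi c' (coord_at (iota p)) (tangent_map iota (A (X p))) (tangent_map iota (X p))
      (tangent_map iota (w : tangent p)).
Proof.
move=> sX; pose u : U := X p; pose b := 'D_w Fh x.
pose Xh := field_in_charts X c c; pose Zh := field_in_charts (apply_endo xi X) c c.
have sXh : smooth_at Xh x := smooth_at_field (smooth_map_id M) sX ac ac cp cp.
have sZh : smooth_at Zh x.
  apply: smooth_at_near (smooth_xi_in_chart ac ac' cp cFp sXh).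
  apply: filterS (near_cparam cp (near_cdom cp)) => z cz.
  by rewrite /Zh /Xh /field_in_charts to_chartK.
have K : \forall z \near x, forall a, G c' (Fh z) ('D_(Zh z) Fh z) a =
    Phi c' (Fh z) (Nh z) ('D_(Xh z) Fh z) a.
  apply: (near_chart_points sF cp cFp) => q cq cFq a.
  have := xi_in_charts (X q) a ac ac' cq cFq.
  have -> : to_chart c (xi (X q)) = Zh (ccoord c q).
    exact: esym (field_in_charts_coord (F := @idfun M) (apply_endo xi X) c cq).
  have -> : to_chart c (X q) = Xh (ccoord c q).
    exact: esym (field_in_charts_coord (F := @idfun M) X c cq).
  exact.
have Xx : Xh x = u.
  rewrite /Xh /coord_at (field_in_charts_coord (F := @idfun M) X c cp).
  exact: (@to_chart_at R 6 M p (X p)).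
have E := nabla_cross sFh (@phi_rep_lin _ _ _ hphi c') (@phi_rep12 _ _ _ hphi c')
  (@phi_rep23 _ _ _ hphi c') (ambient_phi_smooth ac' cp cFp) u b iG (ambient_metric_smooth ac' cp cFp)
  sNh (smooth_at_differentiable sXh) (smooth_at_differentiable sZh) K.
rewrite (levi_civita_gauss u w sZh) in E.
(* D_u phi (N, u, w) = 0, by skewness in the two occurrences of u. *)
have T0 : nabla_phi (G c') (Phi c') (Fh x) ('D_u Fh x) (Nh x) ('D_(Xh x) Fh x) b = 0.
  rewrite Xx Fx (nabla_phi12 (G c')).
  - by rewrite (torsion_skew hphi hg hnG2) oppr0.
  - by near=> z; exact: (@phi_rep12 _ _ _ hphi).
  - by move=> a d e; rewrite -Fx; exact: (ambient_phi_smooth ac' cp cFp).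
rewrite T0 add0r Xx nabN in E.
have E2 : Phi c' (Fh x) (Nh x) (nabla Fh (G c') x u (fun z => 'D_(Xh z) Fh z)) b =
    - @g p (cov_deriv_along g X (p := p) u) (xi (w : tangent p)).
  rewrite (@phi_rep23 _ _ _ hphi); congr (- _).
  have := xi_in_charts (w : tangent p) (nabla Fh (G c') x u (fun z => 'D_(Xh z) Fh z)) ac ac' cp cFp.
  rewrite !to_chart_at => H; apply: etrans (esym H) _.
  have [_ Gs _] := nbhs_singleton iG; rewrite Gs.
  exact: (levi_civita_gauss u (xi (w : tangent p)) sXh).
rewrite E2 in E.
have -> : @g p (cov_deriv_endo g xi X X p) w =
    @g p (cov_deriv_along g (apply_endo xi X) (p := p) u) w
    + @g p (cov_deriv_along g X (p := p) u) (xi (w : tangent p)).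
  rewrite /cov_deriv_endo /levi_civita addrC -scaleN1r gl xi_skew.
  by rewrite mulN1r opprK addrC.
rewrite E subrK Fx /b -!(tangent_mapE sF).
have := @phi_rep_lin _ _ _ hphi c' (coord_at (iota p)) (tangent_map iota (X p))
  (tangent_map iota (w : tangent p)) => lp.
exact: (lin_N lp (tangent_map iota (A (X p)))).
Unshelve. all: by end_near. Qed.

Lemma shape_linear : lin (@A p : U -> U).
Proof.
move=> a u v; apply: (@Finj p); rewrite (Glin p).
have Nl : lin (fun u : U => nabla Fh (G c') x u Nh).
  move=> k u1 u2; rewrite /nabla (deriveDr _ _ (smooth_at_differentiable sNh)).
  rewrite (deriveZr _ _ (smooth_at_differentiable sNh)).
  rewrite (deriveDr _ _ (smooth_at_differentiable sFh)) (deriveZr _ _ (smooth_at_differentiable sFh)).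
  have dG a1 a2 : differentiable (fun z => G c' z a1 a2) (Fh x).
    exact: smooth_at_differentiable (ambient_metric_smooth ac' cp cFp _ _).
  rewrite (gamma_sym iG dG) (gamma_lin iG dG) !(gamma_sym iG dG (Nh x)).
  by rewrite scalerDr addrACA.
have := Nl a u v; rewrite !nabN scalerN -opprD; exact: oppr_inj.
Qed.

(** Derivative of g (N, dF v) = 0; the right-hand side is the second fundamental
    form, symmetric in u and v. *)
Lemma shape_normal u v : @g p (A (u : tangent p)) v =
  G c' (Fh x) (Nh x) (fundamental_form Fh (G c') x u v).
Proof.
have E := derive_metric_along sFh iG (ambient_metric_smooth ac' cp cFp) u
  (smooth_at_differentiable sNh) (smooth_at_differentiable (smooth_at_derive v sFh)).
have E0 : 'D_u (fun z => G c' (Fh z) (Nh z) ('D_v Fh z)) x = 0.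
  have N0 : \forall z \near x, G c' (Fh z) (Nh z) ('D_v Fh z) = (fun _ : U => 0 : R) z.
    by apply: filterS (normal_orthogonal_near ac ac' cp cFp) => z ->.
  by rewrite (near_eq_derive u N0); exact: derive_cst.
move: E; rewrite E0 nabN -(tangent_mapE sF) => /esym/eqP; rewrite addr_eq0 => /eqP E.
apply: oppr_inj; apply: etrans _ E; rewrite Fx metric_rep_at.
have [h _ _] := rG.1 (iota p).
have l0 : lin (fun a : V => @gbar (iota p) a (tangent_map iota (v : tangent p)) : R^o).
  by move=> k a1 a2; exact: h.
exact: esym (lin_N l0 (tangent_map iota (A (u : tangent p)))).
Qed.

Lemma shape_self_adjoint u v : @g p (A (u : tangent p)) v = @g p u (A (v : tangent p)).
Proof.
have E := fundamental_form_sym sFh iG (ambient_metric_smooth ac' cp cFp) u v.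
have E1 := shape_normal u v; rewrite E in E1.
exact: etrans E1 (etrans (esym (shape_normal v u)) (gS _ _)).
Qed.

End AtAPoint.

(** In fixed charts around a point, - alpha g (e, e) = g (D_e N, dF e) for a
    coordinate vector e.  By [cov_deriv_in_charts] this holds at all points near
    the given one, though D_e N is defined there with other charts. *)
Lemma umbilic_factor_smooth (alpha : M -> R) :
  (forall p (u : tangent p), A u = alpha p *: (u : U)) -> smooth_fun alpha.
Proof.
move=> Aa c ac; apply: smooth_at_on => x [q cq <-].
pose c' := chart_at (iota q).
have ac' : atlas c' := atlas_chart_at (iota q).
have cFq : cdom c' (iota q) := cdom_chart_at (iota q).
pose Fh := local_rep iota c c'; pose Nh := field_in_charts N c c'.
pose e : U := stdb ord0.
have e0 : e != 0.
  by apply/eqP => /matrixP/(_ ord0 ord0); rewrite !mxE !eqxx => /eqP; rewrite oner_eq0.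
have sFh : smooth_at Fh (ccoord c q) := immersion_rep_smooth ac ac' cq cFq.
have sNh : smooth_at Nh (ccoord c q) := normal_rep_smooth ac ac' cq cFq.
have iG := ambient_metric_inner ac' cq cFq.
have sG : \forall z \near Fh (ccoord c q), forall u v, smooth_at (fun y => G c' y u v) z.
  by apply: filterS (ambient_metric_near ac' cq cFq) => z [].
have sM := smooth_at_metric_along sFh iG (ambient_metric_smooth ac' cq cFq)
  (smooth_at_nabla sFh iG sG e sNh) (smooth_at_derive e sFh).
have gee q' : cdom c q' -> metric_rep g c (ccoord c q') e e != 0.
  move=> cq'; have cq'' : cdom c (cparam c (ccoord c q')) by rewrite ccoordK.
  have [_ _ gp] := metric_rep_inner rg ac cq''.
  by apply: lt0r_neq0; exact: gp.
have sV := smooth_atV (f := fun z => metric_rep g c z e e) (gee q cq) (smooth_at_metric_rep e e rg ac cq).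
apply: smooth_at_near (smooth_atM (smooth_atN sM) sV).
apply: (near_chart_points sF cq cFq) => q' cq' cFq'.
rewrite /= (ccoordK cq'); apply: (mulIf (gee q' cq')); rewrite mulfVK ?gee //.
pose u : tangent q' := of_chart c q' e.
have H := cov_deriv_in_charts sF rG u (tangent_map iota u) sN ac ac' cq' cFq'.
rewrite (of_chartK e ac cq') (push_of_chart sF e ac ac' cq' cFq') in H.
rewrite -/Fh -/Nh in H; rewrite H.
have -> : cov_deriv_along gbar N u = - tangent_map iota (A u) by rewrite hA opprK.
have E := metric_rep_coord g u u ac cq'; rewrite (of_chartK e ac cq') in E; rewrite E.
have [h _ _] := rG.1 (iota q').
have l0 : lin (fun a : V => @gbar (iota q') a (tangent_map iota u) : R^o).
  by move=> k a1 a2; exact: h.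
have l1 := lin_N l0 (tangent_map iota (A u)).
have l2 := lin_Z (Glin q') (alpha q') u.
have l3 := lin_Z l0 (alpha q') (tangent_map iota u).
by rewrite l1 (Aa q' u) l2 l3 opprK.
Qed.

Theorem nearly_kahler_iff_umbilic : nearly_kahler g xi <-> totally_umbilic A.
Proof.
have [_ NN N0] := hN.
have Phi0 q a b d : Phi (chart_at q) (coord_at q) (a *: b) b d = 0.
  have l := @phi_rep_lin _ _ _ hphi (chart_at q) (coord_at q) b d.
  rewrite (lin_Z l).
  have := @phi_rep12 _ _ _ hphi (chart_at q) (coord_at q) b b d => /eqP.
  by rewrite -addr_eq0 -mulr2n mulrn_eq0 /= => /eqP ->; rewrite scaler0.
split=> [[_ NK]|[alpha [_ Aa]]].
  have key p : exists a, forall u : U, A (u : tangent p) = a *: u.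
    have [f [of_ cf _]] := G2_point hphi hg (iota p).
    rewrite phi_at in cf.
    suff K (u w : U) : Phi (chart_at (iota p)) (coord_at (iota p)) (tangent_map iota (A (u : tangent p)))
        (tangent_map iota (u : tangent p)) (tangent_map iota (w : tangent p)) = 0.
      exact: (umbilic_operator (rG.1 (iota p)) of_ (@phi_rep_lin _ _ _ hphi _ _)
        (@phi_rep12 _ _ _ hphi _ _) (@phi_rep23 _ _ _ hphi _ _) cf (@BE (iota p)) (Glin p)
        (@Finj p) (NN p) (N0 p) (@hxi p) (shape_linear p) (@shape_self_adjoint p) K).
    have [X [sX Xp]] := extend_tangent_vector (u : tangent p).
    have := @nabla_xi p X w sX; rewrite (NK X sX p) Xp => H.
    apply: oppr_inj; rewrite oppr0 -H.
    have l0 : lin (fun a : U => @g p a w : R^o) by have [h _ _] := rg.1 p; move=> k a1 a2; exact: h.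
    exact: (lin_0 l0).
  pose alpha p := projT1 (cid (key p)).
  have Aa p (u : tangent p) : A u = alpha p *: (u : U) := projT2 (cid (key p)) u.
  by exists alpha; split=> [|X _ p]; [exact: umbilic_factor_smooth|exact: Aa].
split=> [|X sX p]; first exact: hypersurface_almost_hermitian.
apply: (inner_product_inj (rg.1 p)) => w; rewrite (@nabla_xi p X w sX) (Aa X sX p).
have l2 := lin_Z (Glin p) (alpha p) (X p).
rewrite l2 Phi0 oppr0.
have l0 : lin (fun a : U => @g p a w : R^o) by have [h _ _] := rg.1 p; move=> k a1 a2; exact: h.
exact: esym (lin_0 l0).
Qed.

End Hypersurface.

Theorem theorem1p2 (R : realType)
  (Mbar : manifold R 7) (phi : form_field Mbar 3)
  (gbar : metric_field Mbar) (vol : form_field Mbar 7)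
  (B : forall x : Mbar, tangent x -> tangent x -> tangent x)
  (M : manifold R 6) (iota : M -> Mbar) (o : form_field M 6)
  (N : field_along iota) (A xi : endo_field M) :
  G2_structure phi ->
  G2_metric phi gbar vol ->
  nearly_G2 phi gbar vol ->
  cross_product phi gbar B ->
  immersion iota ->
  orientation_form o ->
  unit_normal gbar N ->
  normal_oriented o vol N ->
  shape_operator gbar N A ->
  (forall (p : M) (u : tangent p),
     tangent_map iota (xi p u) = B (iota p) (N p) (tangent_map iota u)) ->
  (nearly_kahler (induced_metric iota gbar) xi <-> totally_umbilic A).
Proof.
move=> hphi hg hnG2 hB hiota _ hN _ hA hxi.
exact: (nearly_kahler_iff_umbilic hphi hg hnG2 hB hiota hN hA hxi).
Qed.
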